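(* Let $d>3$ be an integer, $0<L\le U$, $\gamma\in\mathbb{R}$, $\alpha_{\uparrow}>1$, $0<\alpha_{\downarrow}<1$. Let $h\in\mathcal{P}^{\gamma}_{d,L,U}$, i.e. $h\in\mathcal{T}^{\gamma}(f)$ for some $f\in\mathcal{S}_{d,L,U}$, and let $x^{\mathrm{opt}}$ be the unique global minimum of $h$. Let $\{(\tilde\theta_t,\mathcal{F}_t)\}_{t\ge0}=\mathtt{ES}(h,\tilde\theta_0,\{z_t\}_{t\ge0})$, $\tilde\theta_t=(\tilde m_t,\log\tilde\sigma_t)$, be the state sequence of the (1+1)-ES solving $h$, where $\tilde m_0\neq x^{\mathrm{opt}}$ and $h(\tilde m_0)\le\gamma$. Suppose that $\alpha_{\uparrow},\alpha_{\downarrow}$ are set so that $p_{\mathrm{target}}\in I_q$ (where $I_q$ is computed from $f$). Then the upper convergence rate on $h$ satisfies $\exp(-\mathrm{CR}^{\mathrm{upper}})\le\exp(-B^{\mathrm{upper}}_{d,L,U})$, where $$B^{\mathrm{upper}}_{d,L,U}=\frac12\sup_{q^{\mathrm{low}},q^{\mathrm{high}}}\min\left\{\frac w4,\log\frac{\alpha_{\uparrow}}{\alpha_{\downarrow}}\right\}\cdot\min\{p_{\mathrm{target}}-q^{\mathrm{low}},\,q^{\mathrm{high}}-p_{\mathrm{target}}\}>0,$$ the supremum being over all $q^{\mathrm{low}}\in I_q$ and $q^{\mathrm{high}}\in I_q^{\mathrm{high}}(q^{\mathrm{low}})$ with $q^{\mathrm{low}}<p_{\mathrm{target}}<q^{\mathrm{high}}$,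 and $w=w(q^{\mathrm{low}},q^{\mathrm{high}})$.
   Context: **Algorithm.** A state is $\theta=(m,\log\sigma)\in\Theta=\mathbb{R}^{d+1}$ with $m\in\mathbb{R}^d$, $\sigma>0$. Let $\{z_t\}_{t\ge0}$ be independent $\mathcal{N}(0,I)$ vectors in $\mathbb{R}^d$. For measurable $f:\mathbb{R}^d\to\mathbb{R}$ and $\theta_0\in\Theta$, $\{(\theta_t,\mathcal{F}_t)\}_{t\ge0}=\mathtt{ES}(f,\theta_0,\{z_t\}_{t\ge0})$ denotes the process $\theta_{t+1}=\theta_t+\mathcal{G}(\theta_t,z_t;f)$ with its natural filtration, where $\mathcal{G}(\theta,z;f)=(\sigma z,\log\alpha_{\uparrow})\mathbb{1}\{f(m+\sigma z)\le f(m)\}+(0,\log\alpha_{\downarrow})\mathbb{1}\{f(m+\sigma z)>f(m)\}$. Set $p_{\mathrm{target}}=\log(1/\alpha_{\downarrow})/\log(\alpha_{\uparrow}/\alpha_{\downarrow})$. **Upper convergence rate.** The upper convergence rate on $h$ is $\exp(-\mathrm{CR}^{\mathrm{upper}})$, where $\mathrm{CR}^{\mathrm{upper}}$ is the constant satisfying $\Pr\left[\limsup_{t\to\infty}\frac1t\log\left(\|\tilde m_t-x^{\mathrm{opt}}\|/\|\tilde m_0-x^{\mathrm{opt}}\|\right)=-\mathrm{CR}^{\mathrm{upper}}\right]=1$. **Quantities attached to $f$.** $\Theta_0=\{\theta\in\Theta: m\ne0\}$. For $z\sim\mathcal{N}(0,I)$ and $\theta\in\Theta_0$: $\mathcal{Q}_z(\theta)=\frac{2}{\sigma^2}(f(m+\sigma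 z)-f(m)-\langle\nabla f(m),\sigma z\rangle)$, $z_e=\langle z,\nabla f(m)\rangle/\|\nabla f(m)\|$, $\mathcal{V}_{\mathrm{std}}(\theta)=\mathrm{Var}[\mathcal{Q}_z(\theta)]/(\mathbb{E}[\mathcal{Q}_z(\theta)])^2$ (expectation over $z$, $\theta$ fixed), $\kappa_{\inf}=\inf_{\theta\in\Theta_0}\mathbb{E}[\mathcal{Q}_z(\theta)]/\mathbb{E}[\mathcal{Q}_z(\theta)\mathbb{1}\{z_e\le0\}]$ (which is $\geq 1$), $E_{\mathcal{Q}}=\sup_{\theta\in\Theta_0}\mathbb{E}[\mathcal{Q}_z(\theta)]$. $\Phi$ is the standard normal cdf. **Function classes.** $\mathcal{S}_{d,L,U}$ is the set of $f:\mathbb{R}^d\to\mathbb{R}$ such that: (A1) $f$ is measurable, continuously differentiable, $L$-strongly convex and $U$-Lipschitz smooth on $\mathbb{R}^d$, i.e. $f(x)+\langle y-x,\nabla f(x)\rangle+\frac L2\|x-y\|^2\le f(y)\le f(x)+\langle y-x,\nabla f(x)\rangle+\frac U2\|x-y\|^2$ for all $x,y$, and its unique global minimum is at the origin with $f(0)=0$; (A2) $\sup_{\theta\in\Theta_0}\mathcal{V}_{\mathrm{std}}(\theta)<\frac14\min\{\Phi(\frac{\kappa_{\inf}}2\cdot\frac1{\sqrt{2\pi}})-\frac12,\ 1-\Phi(\frac{\kappa_{\inf}}2\cdot\frac3{\sqrt{2\pi}})\}$. $\mathcal{T}^{\gamma}(f)$ is the set of all $h:\mathbb{R}^d\to\mathbb{R}$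 with a unique global minimum $x^{\mathrm{opt}}\in\mathbb{R}^d$ that can be expressed as $h(x)=g(f(x-x^{\mathrm{opt}}))$ for all $x$ with $h(x)\le\gamma$, where $g:\mathbb{R}\to\mathbb{R}$ is strictly increasing. $\mathcal{P}^{\gamma}_{d,L,U}=\bigcup_{f\in\mathcal{S}_{d,L,U}}\mathcal{T}^{\gamma}(f)$. **Thresholds.** For $q\in(0,\frac12)$, $B_\theta^{\mathrm{high}}(q)=\sup_{\epsilon>\sqrt{2\mathcal{V}_{\mathrm{std}}(\theta)/(1-2q)}}\frac{2\Phi^{-1}(1-(q+\mathcal{V}_{\mathrm{std}}(\theta)/\epsilon^2))}{1+\epsilon}$; for $q\in(\mathcal{V}_{\mathrm{std}}(\theta),\frac12)$, $B_\theta^{\mathrm{low}}(q)=\inf_{\epsilon\in(\sqrt{\mathcal{V}_{\mathrm{std}}(\theta)/q},1)}\frac{2\Phi^{-1}(1-(q-\mathcal{V}_{\mathrm{std}}(\theta)/\epsilon^2))}{1-\epsilon}$. $B_{\inf}^{\mathrm{high}}(q)=\inf_{\theta\in\Theta_0}B_\theta^{\mathrm{high}}(q)$, $B_{\sup}^{\mathrm{low}}(q)=\sup_{\theta\in\Theta_0}B_\theta^{\mathrm{low}}(q)$. Below, $q$ ranges over the points of $(0,\frac12)$ at which the functions involved are defined, and $I_q$, $I_q^{\mathrm{high}}(q^{\mathrm{low}})$ are open subintervals of $(0,\frac12)$: $I_q=\left(\max\left\{\sup_{\theta\in\Theta_0}\mathcal{V}_{\mathrm{std}}(\theta),\ \sup\{q:\kappa_{\inf}\sqrt{2/\pi}\le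 B_{\sup}^{\mathrm{low}}(q)\}\right\},\frac12\right)$; $I_q^{\mathrm{high}}(q^{\mathrm{low}})=\left(\sup_{\theta\in\Theta_0}\sup\{q: B_\theta^{\mathrm{low}}(q^{\mathrm{low}})\le\frac{\alpha_{\uparrow}}{\alpha_{\downarrow}}B_\theta^{\mathrm{high}}(q)\},\frac12\right)$; $Q=Q(q^{\mathrm{low}})=\inf\{q:B_{\inf}^{\mathrm{high}}(q)<B_{\sup}^{\mathrm{low}}(q^{\mathrm{low}})\}$; $w=w(q^{\mathrm{low}},q^{\mathrm{high}})=\frac{L}{E_{\mathcal{Q}}}\cdot\frac{B_{\inf}^{\mathrm{high}}(q^{\mathrm{high}})}{\kappa_{\inf}}\cdot\left(\sqrt{\tfrac2\pi}\,\kappa_{\inf}-B_{\sup}^{\mathrm{low}}(q^{\mathrm{low}})\right)\cdot Q(q^{\mathrm{low}})$.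
   Formalization: The class T^γ(f) is taken with the extra requirement that g(f(x−x^opt))>γ wherever h(x)>γ, i.e. {h≤γ} is a sublevel set of f(·−x^opt); without it the claim fails, e.g. if h=f only at 0 and at the starting point and h=γ+1 elsewhere. *)

(* Defs.v *)
From HB Require Import structures.
From mathcomp Require Import all_boot all_order all_algebra.
From mathcomp Require Import all_classical all_reals all_analysis.

Set Implicit Arguments.
Unset Strict Implicit.
Unset Printing Implicit Defensive.
Import Order.TTheory GRing.Theory Num.Theory.
Import numFieldNormedType.Exports.
Local Open Scope classical_set_scope.
Local Open Scope ring_scope.

(* Points of R^d are row vectors ['rV[R]_d].  The library's product
   sigma-algebra on finite powers of [R] lives on [d.-tuple R], so random vectors
   take their values there and are turned into row vectors by [rvec]. *)

Definition rvec (R : realType) (d : nat) (z : d.-tuple R) : 'rV[R]_d :=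
  \row_i tnth z i.

(* Borel measurability on R^d: the Borel sigma-algebra is the product one. *)
Definition borel_fun (R : realType) (d : nat) (f : 'rV[R]_d -> R) : Prop :=
  measurable_fun [set: d.-tuple R] (fun x : d.-tuple R => f (rvec x)).

(* The library norm on ['rV[R]_d] is the sup norm, hence the explicit Euclidean
   structure; both norms induce the same topology and derivatives. *)
Definition dotv (R : realType) (d : nat) (x y : 'rV[R]_d) : R :=
  \sum_i x ord0 i * y ord0 i.

Definition enorm (R : realType) (d : nat) (x : 'rV[R]_d) : R :=
  Num.sqrt (dotv x x).

Definition grad (R : realType) (d : nat) (f : 'rV[R]_d -> R) (x : 'rV[R]_d) :
  'rV[R]_d := \row_i 'D_(delta_mx ord0 i) f x.

(* [normal_prob] lives on [measurableTypeR R], whose sigma-algebra is that of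
   the canonical measurableType on [R] but whose display is different; hence the
   type of the first component. *)
Definition tuple_cons (R : realType) (n : nat)
    (xs : measurableTypeR R * n.-tuple R) : n.+1.-tuple R :=
  [the n.+1.-tuple R of (xs.1 : R) :: xs.2].

Lemma measurable_tuple_cons (R : realType) (n : nat) :
  measurable_fun [set: measurableTypeR R * n.-tuple R] (@tuple_cons R n).
Proof.
have mid : measurable_fun [set: measurableTypeR R]
    (idfun : measurableTypeR R -> R) by exact: measurable_id.
apply: (@measurable_cons _ _ _ _ (fun xs => xs.1 : R) n (fun xs => xs.2)).
  exact: (measurableT_comp mid measurable_fst).
exact: measurable_snd.
Qed.

HB.instance Definition _ (R : realType) (n : nat) :=
  isMeasurableFun.Build _ _ _ _ (@tuple_cons R n) (@measurable_tuple_cons R n).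

(* N(0, I) on R^n, as the n-fold product of N(0, 1). *)
Fixpoint std_gauss (R : realType) (n : nat) : probability (n.-tuple R) R :=
  match n with
  | 0 => [the probability _ _ of \d_([tuple] : 0.-tuple R)]
  | n'.+1 => [the probability _ _ of distribution
       [the probability _ _ of (normal_prob (0 : R) 1 \x std_gauss R n')%E]
       [the {mfun _ >-> _} of @tuple_cons R n']]
  end.

Definition Phi (R : realType) (x : R) : R := fine (normal_prob 0 1 `]-oo, x]).

(* The inverse of the bijection Phi : R -> ]0, 1[; only used on ]0, 1[. *)
Definition Phi_inv (R : realType) (p : R) : R := get [set x : R | Phi x = p].

Definition mutually_independent (dO dT : measure_display)
    (Omega : measurableType dO) (T : measurableType dT) (R : realType)
    (P : probability Omega R) (X : nat -> Omega -> T) : Prop :=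
  forall (s : seq nat) (A : nat -> set T), uniq s ->
    (forall t, measurable (A t)) ->
    P (\big[setI/setT]_(t <- s) (X t @^-1` A t)) =
    (\prod_(t <- s) P (X t @^-1` A t))%E.

Definition iid_std_gauss (dO : measure_display) (Omega : measurableType dO)
    (R : realType) (P : probability Omega R) (d : nat)
    (z : nat -> {RV P >-> d.-tuple R}) : Prop :=
  mutually_independent P z /\
  forall (t : nat) (A : set (d.-tuple R)), measurable A ->
    distribution P (z t) A = std_gauss R d A.

(* A state (m, log sigma) of the (1+1)-ES: the second component is log sigma. *)
Definition state (R : realType) (d : nat) : Type := ('rV[R]_d * R)%type.

Definition sigma_of (R : realType) (d : nat) (theta : state R d) : R :=
  expR theta.2.

Definition ES_update (R : realType) (d : nat) (aup adown : R)
    (f : 'rV[R]_d -> R) (theta : state R d) (z : 'rV[R]_d) : state R d :=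
  if f (theta.1 + sigma_of theta *: z) <= f theta.1
  then (sigma_of theta *: z, ln aup) else (0, ln adown).

Fixpoint ES (R : realType) (d : nat) (aup adown : R) (f : 'rV[R]_d -> R)
    (theta0 : state R d) (z : nat -> 'rV[R]_d) (t : nat) : state R d :=
  match t with
  | 0 => theta0
  | s.+1 => let theta := ES aup adown f theta0 z s in
            (theta.1 + (ES_update aup adown f theta (z s)).1,
             theta.2 + (ES_update aup adown f theta (z s)).2)
  end.

Definition ES_process (dO : measure_display) (Omega : measurableType dO)
    (R : realType) (P : probability Omega R) (d : nat) (aup adown : R)
    (f : 'rV[R]_d -> R) (theta0 : state R d)
    (z : nat -> {RV P >-> d.-tuple R}) (t : nat) (w : Omega) : state R d :=
  ES aup adown f theta0 (fun s => rvec (z s w)) t.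

Definition p_target (R : realType) (aup adown : R) : R :=
  ln (1 / adown) / ln (aup / adown).

(* limsup_t (1/t) log (|| m_t - x || / || m_0 - x ||) along a trajectory *)
Definition limsup_log_rate (R : realType) (d : nat) (x : 'rV[R]_d)
    (theta : nat -> state R d) : \bar R :=
  limn_esup (fun t : nat =>
    (t%:R^-1 * ln (enorm ((theta t).1 - x) / enorm ((theta 0).1 - x)))%:E).

Definition is_CR_upper (dO : measure_display) (Omega : measurableType dO)
    (R : realType) (P : probability Omega R) (d : nat) (x : 'rV[R]_d)
    (theta : nat -> Omega -> state R d) (CR : R) : Prop :=
  P [set w | limsup_log_rate x (fun t => theta t w) = (- CR)%:E] = 1%E.

(* Suprema and infima are taken in [\bar R] where they may be infinite or over an
   empty set (with supremum -oo, which is harmless since q is also required to be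
   in ]0, 1/2[).  The others are taken in [R]: for [f] in [S_class L U] below and
   q in the domains considered, they are over nonempty sets bounded on the
   relevant side.  Likewise the expectations and variances under [fine] are then
   finite. *)

Definition Theta0 (R : realType) (d : nat) : set (state R d) :=
  [set theta | theta.1 != 0].

Definition Qz (R : realType) (d : nat) (f : 'rV[R]_d -> R) (theta : state R d)
    (z : d.-tuple R) : R :=
  let m := theta.1 in let sigma := sigma_of theta in
  2 / sigma ^+ 2 *
  (f (m + sigma *: rvec z) - f m - dotv (grad f m) (sigma *: rvec z)).

Definition z_e (R : realType) (d : nat) (f : 'rV[R]_d -> R) (theta : state R d)
    (z : d.-tuple R) : R :=
  dotv (rvec z) (grad f theta.1) / enorm (grad f theta.1).

Definition E_Qz (R : realType) (d : nat) (f : 'rV[R]_d -> R)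
    (theta : state R d) : R :=
  fine ('E_(std_gauss R d)[Qz f theta])%E.

Definition E_Qz_neg (R : realType) (d : nat) (f : 'rV[R]_d -> R)
    (theta : state R d) : R :=
  fine ('E_(std_gauss R d)[(fun z : d.-tuple R =>
    Qz f theta z * \1_[set y | z_e f theta y <= 0] z)%R])%E.

Definition V_std (R : realType) (d : nat) (f : 'rV[R]_d -> R)
    (theta : state R d) : R :=
  fine (variance (std_gauss R d) (Qz f theta)) / E_Qz f theta ^+ 2.

Definition V_sup (R : realType) (d : nat) (f : 'rV[R]_d -> R) : \bar R :=
  ereal_sup [set (V_std f theta)%:E | theta in @Theta0 R d].

Definition kappa_inf (R : realType) (d : nat) (f : 'rV[R]_d -> R) : R :=
  inf [set E_Qz f theta / E_Qz_neg f theta | theta in @Theta0 R d].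

Definition E_Q (R : realType) (d : nat) (f : 'rV[R]_d -> R) : R :=
  sup [set E_Qz f theta | theta in @Theta0 R d].

Definition unique_global_min (R : realType) (d : nat) (h : 'rV[R]_d -> R)
    (x : 'rV[R]_d) : Prop := forall y, y != x -> h x < h y.

Definition assumption_A1 (R : realType) (d : nat) (L U : R)
    (f : 'rV[R]_d -> R) : Prop :=
  [/\ borel_fun f,
      (forall x, differentiable f x) /\ continuous (grad f),
      forall x y,
        f x + dotv (y - x) (grad f x) + L / 2 * enorm (x - y) ^+ 2 <= f y /\
        f y <= f x + dotv (y - x) (grad f x) + U / 2 * enorm (x - y) ^+ 2,
      unique_global_min f 0
    & f 0 = 0].

Definition assumption_A2 (R : realType) (d : nat) (f : 'rV[R]_d -> R) : Prop :=
  (V_sup f < (1 / 4 *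
     Num.min (Phi (kappa_inf f / 2 * (1 / Num.sqrt (2 * pi))) - 1 / 2)
             (1 - Phi (kappa_inf f / 2 * (3 / Num.sqrt (2 * pi)))))%:E)%E.

Definition S_class (R : realType) (d : nat) (L U : R) : set ('rV[R]_d -> R) :=
  [set f | assumption_A1 L U f /\ assumption_A2 f].

(* [h] coincides with g(f(. - xopt)) on its sublevel set at level gamma, and this
   is also a sublevel set of g(f(. - xopt)): outside of it g(f(. - xopt)) exceeds
   gamma as well.  Without the last clause [h] could be larger than gamma at
   points where f(. - xopt) is small, e.g. everywhere except at xopt and at one
   other point, where a search started there would remain forever. *)
Definition T_class (R : realType) (d : nat) (gamma : R) (f : 'rV[R]_d -> R) :
    set ('rV[R]_d -> R) :=
  [set h | exists xopt : 'rV[R]_d, unique_global_min h xopt /\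
    exists g : R -> R, {homo g : a b / a < b} /\
      forall x, (h x <= gamma -> h x = g (f (x - xopt))) /\
                (gamma < h x -> gamma < g (f (x - xopt)))].

Definition B_high (R : realType) (d : nat) (f : 'rV[R]_d -> R)
    (theta : state R d) (q : R) : R :=
  let V := V_std f theta in
  sup [set 2 * Phi_inv (1 - (q + V / e ^+ 2)) / (1 + e) | e in
       [set e : R | Num.sqrt (2 * V / (1 - 2 * q)) < e]].

Definition B_low (R : realType) (d : nat) (f : 'rV[R]_d -> R)
    (theta : state R d) (q : R) : R :=
  let V := V_std f theta in
  inf [set 2 * Phi_inv (1 - (q - V / e ^+ 2)) / (1 - e) | e in
       [set e : R | Num.sqrt (V / q) < e < 1]].

Definition B_high_inf (R : realType) (d : nat) (f : 'rV[R]_d -> R) (q : R) : R :=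
  inf [set B_high f theta q | theta in @Theta0 R d].

Definition B_low_sup (R : realType) (d : nat) (f : 'rV[R]_d -> R) (q : R) :
  \bar R := ereal_sup [set (B_low f theta q)%:E | theta in @Theta0 R d].

(* Domain of definition of every B_high(theta), hence of [B_high_inf]. *)
Definition high_dom (R : realType) : set R := [set q : R | 0 < q < 1 / 2].

(* Common domain of definition of all B_low(theta), i.e. that of [B_low_sup]. *)
Definition low_dom (R : realType) (d : nat) (f : 'rV[R]_d -> R) : set R :=
  [set q : R | 0 < q < 1 / 2 /\ forall theta, @Theta0 R d theta -> V_std f theta < q].

Definition I_q (R : realType) (d : nat) (f : 'rV[R]_d -> R) : set R :=
  [set q : R | 0 < q < 1 / 2 /\
    (Order.max (V_sup f)
       (ereal_sup [set r%:E | r in [set r | low_dom f r /\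
          ((kappa_inf f * Num.sqrt (2 / pi))%:E <= B_low_sup f r)%E]])
     < q%:E)%E].

Definition I_q_high (R : realType) (d : nat) (aup adown : R)
    (f : 'rV[R]_d -> R) (qlow : R) : set R :=
  [set q : R | 0 < q < 1 / 2 /\
    (ereal_sup [set ereal_sup [set r%:E | r in [set r | high_dom r /\
          (B_low f theta qlow <= aup / adown * B_high f theta r)%R]]
        | theta in @Theta0 R d]
     < q%:E)%E].

Definition Q_inf (R : realType) (d : nat) (f : 'rV[R]_d -> R) (qlow : R) : R :=
  inf [set q : R | high_dom q /\ ((B_high_inf f q)%:E < B_low_sup f qlow)%E].

(* [B_low_sup f qlow] is finite for [qlow] in [I_q f], where [w] is used. *)
Definition w_rate (R : realType) (d : nat) (L : R) (f : 'rV[R]_d -> R)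
    (qlow qhigh : R) : R :=
  L / E_Q f * (B_high_inf f qhigh / kappa_inf f) *
  (Num.sqrt (2 / pi) * kappa_inf f - fine (B_low_sup f qlow)) * Q_inf f qlow.

Definition B_upper (R : realType) (d : nat) (L aup adown : R)
    (f : 'rV[R]_d -> R) : R :=
  let p := p_target aup adown in
  1 / 2 * sup [set r : R | exists qlow qhigh : R,
    [/\ I_q f qlow, I_q_high aup adown f qlow qhigh, qlow < p < qhigh
      & r = Num.min (w_rate L f qlow qhigh / 4) (ln (aup / adown)) *
            Num.min (p - qlow) (qhigh - p)]].

(* Main.v *)
From HB Require Import structures.
Require Import Defs.
From mathcomp Require Import all_boot all_order all_algebra.
From mathcomp Require Import all_classical all_reals all_analysis.
From mathcomp Require Import measurable_realfun ring lra.

(** Why the (1+1)-ES converges linearly with the announced rate.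

    On the sublevel set where the search takes place, [h] is a strictly
    increasing function of a translate of [f], so that [h] and [f] accept the
    same moves ([ES_translate]) and only [f] has to be studied.

    The increment of [f] in one step is a Gaussian linear part plus a remainder
    [sigma ^+ 2 / 2 * Qz] ([f_increment]).  If [Qz] were constant, the success
    probability would be [Phi (- sigma_hat / 2)], with [sigma_hat] the step size
    rescaled by the gradient.  Chebyshev's inequality turns this into two
    thresholds: below [B_high q] the success probability is at least [q], above
    [B_low q] it is at most [q] ([psucc_ge_of_small], [psucc_le_of_large]).
    When [sigma_hat] is not too large, the expected relative decrease of [f] is
    bounded from below in terms of [sigma / Num.sqrt (f m)]; this uses the
    Polyak-Lojasiewicz inequality ([mean_decrease_rel_ge]).

    Let [D = ln (f m)] and [S = ln sigma].  The three regimes are glued by the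
    potential [D + v * `|S - D / 2 - c|].  It is nondecreasing in [D], and [D]
    never increases.  For a relative step size that is too small, successes are
    more frequent than [p_target], so that [S] grows on average and the penalty
    decreases; for one that is too large the mirror argument applies; in between
    the expected decrease of [f] pays for the moves of the step size.  The
    interval [I_q_high] guarantees that the regime of large steps starts at
    least one increase and one reduction of the step size beyond the end of the
    regime of small ones, so that no change of the step size within either of
    them crosses a kink [c] placed in between.  In every state the expected
    decrease of the potential is then at least
    [Num.min (w / 4) Lam * Num.min (p - ql) (qh - p)], with
    [Lam = ln (aup / adown)] ([drift_everywhere]).

    The increments of the potential are dominated by bounded variables; hence
    the exponential of a small multiple of it contracts in expectation
    ([lyapunov_drift]).  By independence of the noise this iterates along the
    process, and the expected series of the rescaled exponentials converges;
    therefore the potential, and with it [ln (f m)], decreases almost surely at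
    every smaller linear rate ([random_recursion_as_decay],
    [ae_potential_decay]).  Since [f] dominates the squared norm, half of this
    rate is a rate for [ln (enorm m)], and the supremum over [ql] and [qh] is
    approached along a sequence ([ae_limsup_log_rate]).

    The rate is positive because [assumption_A2] keeps [Q_inf] away from zero
    ([Q_inf_gt0]) and because [B_high q <= 2 * Phi_inv (1 - q) <= B_low q],
    which leaves room for [qh] ([I_q_high_nonempty]). *)

Set Implicit Arguments.
Unset Strict Implicit.
Unset Printing Implicit Defensive.
Import Order.TTheory GRing.Theory Num.Theory.
Import numFieldNormedType.Exports.
Local Open Scope classical_set_scope.
Local Open Scope ring_scope.

(** * Integrals of nonnegative functions *)

Import HBNNSimple.

(** By linearity it suffices to treat indicators, where this is [nuE]; monotone
    convergence along simple functions does the rest. *)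
Lemma ge0_integral_density d (T : measurableType d) (R : realType)
    (mu nu : {measure set T -> \bar R}) (p : T -> R)
    (mp : measurable_fun setT p) (p0 : forall x, 0 <= p x)
    (nuE : forall A, measurable A -> nu A = (\int[mu]_(x in A) (p x)%:E)%E)
    (f : T -> \bar R) (mf : measurable_fun setT f)
    (f0 : forall x, (0 <= f x)%E) :
  (\int[nu]_x f x = \int[mu]_x (f x * (p x)%:E))%E.
Proof.
have simple (g : {nnsfun T >-> R}) :
    (\int[nu]_x (g x)%:E = \int[mu]_x ((g x)%:E * (p x)%:E))%E.
  transitivity (\int[nu]_x (\sum_(y \in range g) (y * \1_(g @^-1` [set y]) x)%:E))%E.
    apply: eq_integral => x _; rewrite {1}(fimfunE g) fsumEFin//.
  rewrite ge0_integral_fsum//; last 2 first.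
    - by move=> y; apply/measurable_EFinP/measurable_funM.
    - by move=> y x _; exact: nnfun_muleindic_ge0.
  transitivity (\int[mu]_x (\sum_(y \in range g) ((y * \1_(g @^-1` [set y]) x)%:E * (p x)%:E)))%E; last first.
    apply: eq_integral => x _; under eq_fsbigr do rewrite EFinM.
    rewrite -ge0_mule_fsuml//; last by move=> y; exact: nnfun_muleindic_ge0.
    by congr (_ * _)%E; rewrite fsumEFin// -fimfunE.
  rewrite ge0_integral_fsum//; last 2 first.
    - move=> y; apply/measurable_EFinP.
      by do 2 apply: measurable_funM => //.
    - move=> y x _; apply: mule_ge0; first exact: nnfun_muleindic_ge0.
      by rewrite lee_fin.
  apply: eq_fsbigr => y /[!inE] -[t _ <-].
  have gy0 : (0 <= g t)%R by [].
  under eq_integral do rewrite EFinM.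
  under [RHS]eq_integral do rewrite EFinM -muleA.
  rewrite ge0_integralZl//; last exact/measurable_EFinP.
  rewrite ge0_integralZl//; last 2 first.
    - by apply: emeasurable_funM; exact/measurable_EFinP.
    - by move=> x _; rewrite mule_ge0// lee_fin.
  congr (_ * _)%E; rewrite integral_indic// setIT nuE// integral_mkcond.
  apply: eq_integral => x _; rewrite patchE indicE.
  by case: (x \in _); rewrite ?mul1e ?mul0e.
pose g := nnsfun_approx measurableT mf.
have fE x : f x = limn (EFin \o g^~ x).
  by apply/esym/cvg_lim => //; exact: cvg_nnsfun_approx.
transitivity (limn (fun n => \int[nu]_x (g n x)%:E))%E.
  rewrite -monotone_convergence//=; last 3 first.
  - by move=> n; exact/measurable_EFinP.
  - by move=> n x _; rewrite lee_fin.
  - by move=> x _ a b ab; rewrite lee_fin; exact/lefP/nd_nnsfun_approx.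
  by apply: eq_integral => x _; exact: fE.
transitivity (limn (fun n => \int[mu]_x ((g n x)%:E * (p x)%:E)))%E.
  by congr (limn _); apply/funext => n; exact: simple.
rewrite -monotone_convergence//=; last 3 first.
  - by move=> n; apply: emeasurable_funM; exact/measurable_EFinP.
  - by move=> n x _; rewrite mule_ge0// lee_fin.
  - move=> x _ a b ab; apply: lee_wpmul2r; rewrite ?lee_fin//.
    exact/lefP/nd_nnsfun_approx.
apply: eq_integral => x _; apply/cvg_lim => //.
by apply: cvgeZr; [|exact: cvg_nnsfun_approx].
Qed.

Lemma ge0_integralZl_real dT (T : measurableType dT) (R : realType)
    (mu : {measure set T -> \bar R}) (k : R) (h : T -> R) :
  measurable_fun setT h -> (forall x, 0 <= h x) -> 0 <= k ->
  (\int[mu]_x (k * h x)%:E = k%:E * \int[mu]_x (h x)%:E)%E.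
Proof.
move=> mh h0 k0; under eq_integral do rewrite EFinM.
by apply: ge0_integralZl => //;
  [exact/measurable_EFinP | move=> x _; rewrite lee_fin].
Qed.

Lemma ge0_integralD_real dT (T : measurableType dT) (R : realType)
    (mu : {measure set T -> \bar R}) (h1 h2 : T -> R) :
  measurable_fun setT h1 -> (forall x, 0 <= h1 x) ->
  measurable_fun setT h2 -> (forall x, 0 <= h2 x) ->
  (\int[mu]_x (h1 x + h2 x)%:E = \int[mu]_x (h1 x)%:E + \int[mu]_x (h2 x)%:E)%E.
Proof.
move=> mh1 h10 mh2 h20; under eq_integral do rewrite EFinD.
by apply: ge0_integralD => //;
  [move=> x _; rewrite lee_fin | exact/measurable_EFinP
  | move=> x _; rewrite lee_fin | exact/measurable_EFinP].
Qed.

(** * Affine changes of variables and normal densities *)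

Definition affine (R : realType) (a b : R) (x : measurableTypeR R) :
  measurableTypeR R := a * x + b.

Lemma measurable_affine (R : realType) (a b : R) :
  measurable_fun setT (affine a b).
Proof. by apply: measurable_funD => //; exact: measurable_funM. Qed.

HB.instance Definition _ (R : realType) (a b : R) :=
  isMeasurableFun.Build _ _ _ _ (affine a b) (measurable_affine a b).

(** Lebesgue measure is the only measure that gives intervals their length, and
    the preimage of an interval by [affine a b] is an interval whose length is
    divided by [`|a|]; the two signs of [a] swap its end points, hence which of
    them belongs to it. *)
Lemma lebesgue_measure_affine (R : realType) (a b : R) (A : set R) :
  a != 0 -> measurable A ->
  pushforward lebesgue_measure (affine a b) A =
  (`|a|^-1%:E * @lebesgue_measure R A)%E.
Proof.
move=> a0 mA.
have a_gt0 : 0 < `|a| by rewrite normr_gt0.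
pose scaled : {measure set (measurableTypeR R) -> \bar R} :=
  mscale (NngNum (ltW a_gt0)) (pushforward lebesgue_measure (affine a b)).
suff -> : lebesgue_measure A = scaled (measurable_affine a b) A.
  by rewrite /mscale/= muleA -EFinM mulVf ?gt_eqF// mul1e.
apply: lebesgue_measure_unique => //= _ [[u v]] _ <-.
rewrite /mscale/= /pushforward.
have [apos|aneg|/eqP] := ltgtP a 0; last by rewrite (negbTE a0).
  rewrite (_ : _ @^-1` _ = `[(v - b) / a, (u - b) / a[%classic); last first.
    apply/seteqP; split=> x /=; rewrite /affine !in_itv/=.
      by rewrite ler_ndivrMr// ltr_ndivlMr// => /andP[? ?]; apply/andP; split; lra.
    by rewrite ler_ndivrMr// ltr_ndivlMr// => /andP[? ?]; apply/andP; split; lra.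
  rewrite !lebesgue_measure_itv/= !lte_fin ltr_nM2r ?invr_lt0// ltrD2r.
  case: ifPn => _; last by rewrite mule0.
  by rewrite ltr0_norm// -EFinM; congr EFin; field.
rewrite (_ : _ @^-1` _ = `](u - b) / a, (v - b) / a]%classic); last first.
  apply/seteqP; split=> x /=; rewrite /affine !in_itv/=.
    by rewrite ler_pdivlMr// ltr_pdivrMr// => /andP[? ?]; apply/andP; split; lra.
  by rewrite ler_pdivlMr// ltr_pdivrMr// => /andP[? ?]; apply/andP; split; lra.
rewrite !lebesgue_measure_itv/= !lte_fin ltr_pM2r ?invr_gt0// ltrD2r.
case: ifPn => _; last by rewrite mule0.
by rewrite gtr0_norm// -EFinM; congr EFin; field.
Qed.

Lemma ge0_integral_affine (R : realType) (a b : R)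
    (f : measurableTypeR R -> \bar R) : a != 0 ->
  measurable_fun setT f -> (forall x, (0 <= f x)%E) ->
  (\int[lebesgue_measure]_x f (affine a b x) =
   `|a|^-1%:E * \int[@lebesgue_measure R]_x f x)%E.
Proof.
move=> a0 mf f0.
have a_gt0 : 0 <= `|a|^-1 by rewrite invr_ge0.
transitivity (\int[mscale (NngNum a_gt0) (@lebesgue_measure R)]_x f x)%E; last first.
  by rewrite ge0_integral_mscale//.
transitivity (\int[pushforward lebesgue_measure (affine a b)]_x f x)%E.
  by rewrite ge0_integral_pushforward//; exact: measurableT_comp.
apply: eq_measure_integral => A mA _.
by rewrite [LHS]lebesgue_measure_affine.
Qed.

Lemma ge0_integral_normal_prob (R : realType) (m s : R)
    (f : measurableTypeR R -> \bar R) :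
  measurable_fun setT f -> (forall x, (0 <= f x)%E) ->
  (\int[normal_prob m s]_x f x =
   \int[lebesgue_measure]_x (f x * (normal_pdf m s x)%:E))%E.
Proof.
move=> mf f0; apply: (@ge0_integral_density _ _ _ lebesgue_measure) => //.
- exact: measurable_normal_pdf.
- exact: normal_pdf_ge0.
Qed.

(** Completing the square in [y]: the product of two centred Gaussian densities
    is the density of the sum of the variables at [u] times the conditional
    density of one of them given [u].  Integrating over [y] makes the second
    factor disappear, so that the convolution is read off. *)
Lemma normal_pdf_convolution (R : realType) (r s u y : R) : 0 < r -> 0 < s ->
  normal_pdf 0 s y * normal_pdf 0 r (u - y) =
  normal_pdf 0 (Num.sqrt (r ^+ 2 + s ^+ 2)) u *
  normal_pdf (u * s ^+ 2 / (r ^+ 2 + s ^+ 2))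
             (r * s / Num.sqrt (r ^+ 2 + s ^+ 2)) y.
Proof.
move=> r0 s0.
have q0 : 0 < r ^+ 2 + s ^+ 2 by rewrite addr_gt0// exprn_gt0.
have t0 : 0 < Num.sqrt (r ^+ 2 + s ^+ 2) by rewrite sqrtr_gt0.
have rs0 : 0 < r * s / Num.sqrt (r ^+ 2 + s ^+ 2).
  by rewrite divr_gt0// mulr_gt0.
rewrite !normal_pdfE ?gt_eqF// /normal_peak /normal_fun !expr_div_n !sqr_sqrtr ?ltW//.
rewrite !subr0 mulrACA -expRD [RHS]mulrACA -[in RHS]expRD.
congr (_ * expR _).
  rewrite -!invfM -!sqrtrM; last 2 first.
  - by rewrite !mulrn_wge0// mulr_ge0// ?pi_ge0// ltW.
  - by rewrite mulrn_wge0// mulr_ge0 ?pi_ge0// exprn_ge0// ltW.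
  by congr (Num.sqrt _)^-1; field; rewrite gt_eqF.
field.
by rewrite !gt_eqF//= exprMn mulr_gt0 ?exprn_gt0.
Qed.

(** * Linear forms of the standard Gaussian vector *)

Lemma normal_pdf_scale (R : realType) (a x : R) : a != 0 ->
  `|a| * normal_pdf 0 `|a| (a * x) = normal_pdf 0 1 x.
Proof.
move=> a0; have na0 : 0 < `|a| by rewrite normr_gt0.
rewrite !normal_pdfE ?oner_eq0 ?gt_eqF// /normal_peak /normal_fun !subr0.
rewrite real_normK ?num_real// expr1n mul1r mulrA -mulrnAr sqrtrM ?sqr_ge0//.
rewrite sqrtr_sqr invfM mulrA divff ?gt_eqF// mul1r.
by congr (_ * expR _); rewrite exprMn -mulrnAr; field.
Qed.

Lemma normal_prob_scale (R : realType) (a : R) (A : set R) : a != 0 ->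
  measurable A -> normal_prob 0 1 ((fun x => a * x) @^-1` A) =
  normal_prob 0 `|a| A.
Proof.
move=> a0 mA; have na0 : 0 < `|a| by rewrite normr_gt0.
have mn : measurable_fun setT (fun x : R => normal_pdf 0 `|a| x).
  exact: measurable_normal_pdf.
rewrite /normal_prob [LHS]integral_mkcond [RHS]integral_mkcond.
set f : measurableTypeR R -> \bar R := ((EFin \o normal_pdf 0 `|a|) \_ A).
have mf : measurable_fun setT f.
  apply/(measurable_restrictT _ _).1 => //.
  exact/measurable_funTS/measurable_EFinP.
transitivity (`|a|%:E * \int[lebesgue_measure]_x (f (affine a 0 x)))%E.
  rewrite -ge0_integralZl//.
  - apply: eq_integral => x _; rewrite /f /affine addr0 !patchE.
    rewrite (_ : (x \in _) = (a * x \in A)); last first.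
      by apply/idP/idP => /[!inE].
    by case: ifP => _; rewrite ?mule0//= -EFinM normal_pdf_scale.
  - exact: (measurableT_comp mf (measurable_affine a 0)).
  - by move=> x _; rewrite /f patchE; case: ifP => // _; rewrite lee_fin normal_pdf_ge0.
rewrite ge0_integral_affine//.
- by rewrite muleA -EFinM divff ?gt_eqF// mul1e.
- by move=> x; rewrite /f patchE; case: ifP => // _; rewrite lee_fin normal_pdf_ge0.
Qed.

Lemma normal_prob_shift (R : realType) (s b : R) (A : set R) :
  measurable A -> normal_prob 0 s ((fun y => y + b) @^-1` A) =
  (\int[lebesgue_measure]_u (\1_A u * normal_pdf 0 s (u - b))%:E)%E.
Proof.
move=> mA.
have mn : measurable_fun setT (fun x : R => normal_pdf 0 s (x - b)).
  by apply: measurableT_comp; [exact: measurable_normal_pdf|exact: measurable_funB].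
have mf : measurable_fun setT (fun u : measurableTypeR R =>
    (\1_A u * normal_pdf 0 s (u - b))%:E).
  exact/measurable_EFinP/measurable_funM.
have := @ge0_integral_affine R 1 b _ (oner_neq0 _) mf.
rewrite normr1 invr1 mul1e => <-; last first.
  by move=> x; rewrite lee_fin mulr_ge0// normal_pdf_ge0.
rewrite /normal_prob [LHS]integral_mkcond; apply: eq_integral => x _.
rewrite patchE /affine mul1r addrK indicE.
rewrite (_ : (x \in _) = (x + b \in A)); last by apply/idP/idP => /[!inE].
by case: (_ \in _); rewrite ?mul1r ?mul0r.
Qed.

(** Tonelli exchanges the integrals and the change of variable [y = a x] brings
    the integrand to the form of [normal_pdf_convolution]. *)
Lemma normal_prob_convolution (R : realType) (a s : R) (A : set R) :
  a != 0 -> 0 < s -> measurable A ->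
  (\int[normal_prob 0 1]_x normal_prob 0 s ((fun y => y + a * x)%R @^-1` A) =
   normal_prob 0 (Num.sqrt (s ^+ 2 + a ^+ 2)) A)%E.
Proof.
move=> a0 s0 mA; have na0 : 0 < `|a| by rewrite normr_gt0.
pose h (x u : measurableTypeR R) : R := \1_A u * normal_pdf 0 s (u - a * x).
pose k (x u : measurableTypeR R) : R := h x u * normal_pdf 0 1 x.
have mI : measurable_fun [set: measurableTypeR R] (\1_A : _ -> R).
  exact: measurable_indic.
have mh : measurable_fun [set: measurableTypeR R * measurableTypeR R]
    (fun xu => h xu.1 xu.2).
  apply: measurable_funM; first exact: (measurableT_comp mI).
  apply: (measurableT_comp (measurable_normal_pdf 0 s)) => //.
  by apply: measurable_funB => //; exact: measurable_funM.
have mk : measurable_fun [set: measurableTypeR R * measurableTypeR R]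
    (fun xu => k xu.1 xu.2).
  apply: measurable_funM => //.
  exact: (measurableT_comp (measurable_normal_pdf 0 1)).
have h0 x u : (0 <= (h x u)%:E)%E by rewrite lee_fin mulr_ge0// normal_pdf_ge0.
have k0 x u : (0 <= (k x u)%:E)%E by rewrite lee_fin !mulr_ge0// normal_pdf_ge0.
transitivity (\int[lebesgue_measure]_x \int[lebesgue_measure]_u (k x u)%:E)%E.
  under eq_integral do rewrite normal_prob_shift//.
  rewrite ge0_integral_normal_prob; last 2 first.
  - apply: (@measurable_fun_fubini_tonelli_F _ _ _ _ _ lebesgue_measure
      (fun xu => (h xu.1 xu.2)%:E)) => //.
    exact/measurable_EFinP.
  - by move=> x; apply: integral_ge0 => u _; exact: h0.
  apply: eq_integral => x _; rewrite -ge0_integralZr//.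
  - apply/measurable_EFinP/measurable_funM => //.
    apply: (measurableT_comp (measurable_normal_pdf 0 s)) => //.
    exact: measurable_funB.
  - by move=> u _; exact: h0.
  - by rewrite lee_fin normal_pdf_ge0.
rewrite (@fubini_tonelli _ _ _ _ _ lebesgue_measure lebesgue_measure
  (fun xu => (k xu.1 xu.2)%:E))//=; last exact/measurable_EFinP.
rewrite /normal_prob [RHS]integral_mkcond; apply: eq_integral => u _.
set r := Num.sqrt _.
pose g (y : measurableTypeR R) : \bar R :=
  (normal_pdf 0 r u *
   normal_pdf (u * `|a| ^+ 2 / (s ^+ 2 + `|a| ^+ 2)) (s * `|a| / r) y)%:E.
have gE y : g y = (normal_pdf 0 `|a| y * normal_pdf 0 s (u - y))%:E.
  rewrite /g /r normal_pdf_convolution// real_normK ?num_real//.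
have mg : measurable_fun setT g.
  by apply/measurable_EFinP/measurable_funM => //; exact: measurable_normal_pdf.
have g0 y : (0 <= g y)%E by rewrite lee_fin mulr_ge0// normal_pdf_ge0.
have int_g : (\int[lebesgue_measure]_y g y = (normal_pdf 0 r u)%:E)%E.
  rewrite /g; under eq_integral do rewrite EFinM.
  rewrite ge0_integralZl//= ?integral_normal_pdf ?mule1//.
  - by apply/measurable_EFinP; exact: measurable_normal_pdf.
  - by move=> y _; rewrite lee_fin normal_pdf_ge0.
  - by rewrite lee_fin normal_pdf_ge0.
transitivity ((\1_A u * `|a|)%:E * \int[lebesgue_measure]_x g (affine a 0 x))%E.
  rewrite -ge0_integralZl//.
  - apply: eq_integral => x _; rewrite gE /affine addr0 -EFinM; congr EFin.
    by rewrite /k /h -(normal_pdf_scale x a0); ring.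
  - exact: (measurableT_comp mg (measurable_affine a 0)).
rewrite ge0_integral_affine// int_g -!EFinM mulrA mulfK ?gt_eqF//.
by rewrite patchE indicE; case: (_ \in _); rewrite ?mul1r ?mul0r.
Qed.

Lemma dotv_cons (R : realType) n (a : 'rV[R]_n.+1) x (z : n.-tuple R) :
  dotv a (rvec (tuple_cons (x, z))) =
  a ord0 ord0 * x + dotv (\row_j a ord0 (lift ord0 j)) (rvec z).
Proof.
rewrite /dotv big_ord_recl !mxE/=; congr (_ + _).
by apply: eq_bigr => j _; rewrite !mxE/= (tnth_nth 0) [in RHS](tnth_nth 0).
Qed.

Lemma measurable_dotv_rvec (R : realType) n (a : 'rV[R]_n) :
  measurable_fun [set: n.-tuple R] (fun z => dotv a (rvec z)).
Proof.
apply: (eq_measurable_fun (fun z : n.-tuple R => \sum_i a ord0 i * tnth z i)).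
  by move=> z _; apply: eq_bigr => i _; rewrite mxE.
apply: measurable_sum => i; apply: measurable_funM => //.
exact: measurable_tnth.
Qed.

(** The law of a linear form is all that is needed of the rotation invariance of
    the Gaussian vector.  By induction on the dimension: the first coordinate is
    independent of the others, so its contribution [b * x] is added by a
    convolution, unless [b] or the remaining vector [a'] vanishes. *)
Lemma std_gauss_linear (R : realType) n (a : 'rV[R]_n) (A : set R) :
  enorm a != 0 -> measurable A ->
  std_gauss R n [set z | A (dotv a (rvec z))] = normal_prob 0 (enorm a) A.
Proof.
elim: n a A => [|n IHn] a A.
  by rewrite /enorm /dotv big_ord0 sqrtr0 eqxx.
set b := a ord0 ord0; set a' : 'rV[R]_n := \row_j a ord0 (lift ord0 j).
have aE : dotv a a = dotv a' a' + b ^+ 2.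
  by rewrite /dotv big_ord_recl addrC expr2; congr (_ + _); apply: eq_bigr => j _; rewrite !mxE.
move=> an0 mA.
transitivity (\int[normal_prob 0 1]_x
   std_gauss R n [set z | A (dotv a' (rvec z) + b * x)%R])%E.
  apply: eq_integral => x _ /=; congr (std_gauss R n _).
  apply/seteqP; split=> z /=; rewrite /xsection/= ?inE/= dotv_cons addrC//.
have mshift (c : R) : measurable ((fun y => y + c) @^-1` A).
  have mD : measurable_fun [set: R] (fun y => y + c) by exact: measurable_funD.
  by rewrite -[X in measurable X]setTI; exact: mD.
have [a'0|a'0] := eqVneq (enorm a') 0.
  have a'_eq0 : dotv a' a' = 0.
    apply/eqP; rewrite eq_le -sqrtr_eq0 -/(enorm a') a'0 eqxx/=.
    by apply: sumr_ge0 => j _; rewrite -expr2 sqr_ge0.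
  have a'z z : dotv a' z = 0.
    rewrite /dotv big1// => j _.
    have /psumr_eq0P/(_ a'_eq0)/(_ j isT)/eqP : forall i : 'I_n, true ->
        0 <= a' ord0 i * a' ord0 i by move=> i _; rewrite -expr2 sqr_ge0.
    by rewrite mulf_eq0 orbb => /eqP ->; rewrite mul0r.
  have E : enorm a = `|b| by rewrite /enorm aE a'_eq0 add0r sqrtr_sqr.
  have b0 : b != 0 by rewrite -normr_eq0 -E.
  have mM : measurable_fun [set: R] (fun x => b * x) by exact: measurable_funM.
  have mB : measurable ((fun x => b * x) @^-1` A : set (measurableTypeR R)).
    by rewrite -[X in measurable X]setTI; exact: mM.
  rewrite E -normal_prob_scale//.
  transitivity (\int[normal_prob 0 1]_x
      (\1_((fun x => b * x) @^-1` A) x)%:E)%E; last by rewrite integral_indic ?setIT.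
  apply: eq_integral => x _.
  rewrite (_ : [set _ | _] = if b * x \in A then setT else set0); last first.
    apply/seteqP; split=> z /=; rewrite a'z add0r.
      by move=> Ax; rewrite mem_set.
    by case: ifPn => // /[!inE].
  rewrite indicE (_ : (x \in _) = (b * x \in A)); last by apply/idP/idP => /[!inE].
  by case: ifPn => _; rewrite ?probability_setT ?measure0.
have a'_gt0 : 0 < enorm a' by rewrite lt_neqAle eq_sym a'0 sqrtr_ge0.
have [b0|b0] := eqVneq b 0.
  have E : enorm a = enorm a' by rewrite /enorm aE b0 expr0n addr0.
  rewrite (eq_integral (fun=> normal_prob 0 (enorm a) A)).
    have cstE (c : \bar R) : (\int[normal_prob (0 : R) 1]_x c = c)%E.
      rewrite (integral_cst (normal_prob (0 : R) 1) measurableT c)//.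
      by rewrite [X in (_ * X)%E](probability_setT (normal_prob 0 1)) mule1.
    exact: cstE.
  move=> x _; rewrite E -IHn//; congr (std_gauss R n _).
  by apply/seteqP; split => z /=; rewrite b0 mul0r addr0.
transitivity (\int[normal_prob 0 1]_x
    normal_prob 0 (enorm a') ((fun y => y + b * x)%R @^-1` A))%E.
  by apply: eq_integral => x _; rewrite -IHn//.
have -> : enorm a = Num.sqrt (enorm a' ^+ 2 + b ^+ 2).
  rewrite [in LHS]/enorm aE sqr_sqrtr//.
  by apply: sumr_ge0 => j _; rewrite -expr2 sqr_ge0.
exact: normal_prob_convolution.
Qed.

(** * The standard normal distribution *)

(** With [y = x ^+ 2 / 4], the density is proportional to [exp (- 2 y)], and
    [16 y ^+ 2 * exp (- 2 y) <= 64 exp (- y)]; the right-hand side is a multiple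
    of the density of variance 2. *)
Lemma normal_fourth_moment_lty (R : realType) :
  (\int[normal_prob (0 : R) 1]_x (x ^+ 4)%:E < +oo)%E.
Proof.
have s20 : Num.sqrt 2 != 0 :> R by rewrite gt_eqF// sqrtr_gt0.
rewrite ge0_integral_normal_prob; last 2 first.
- by apply/measurable_EFinP; exact: measurable_funX.
- by move=> x; rewrite lee_fin exprn_even_ge0.
pose c : R := 64 * (normal_peak 1 / normal_peak (Num.sqrt 2)).
have c0 : 0 <= c by rewrite mulr_ge0// divr_ge0 ?normal_peak_ge0.
apply: (@le_lt_trans _ _ (\int[lebesgue_measure]_x
    (c * normal_pdf 0 (Num.sqrt 2) x)%:E)%E).
  apply: ge0_le_integral => //.
  - by move=> x _; rewrite mule_ge0// lee_fin ?normal_pdf_ge0// exprn_even_ge0.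
  - apply/measurable_EFinP/measurable_funM; first exact: measurable_funX.
    exact: measurable_normal_pdf.
  - apply/measurable_EFinP/measurable_funM => //.
    exact: measurable_normal_pdf.
  move=> x _; rewrite -EFinM lee_fin !normal_pdfE ?oner_eq0// /normal_fun !subr0.
  rewrite expr1n sqr_sqrtr// /c.
  have p2 : normal_peak (Num.sqrt 2) != 0 :> R by rewrite gt_eqF// normal_peak_gt0.
  (* [exp y >= (1 + y / 2) ^+ 2 >= y ^+ 2 / 4] gives the constant 64. *)
  pose y := x ^+ 2 / 4; have y0 : 0 <= y by rewrite divr_ge0// sqr_ge0.
  have -> : - x ^+ 2 / (2 *+ 2) = - y by rewrite /y; field.
  have -> : - x ^+ 2 / (1 *+ 2) = - y - y by rewrite /y; field.
  rewrite [leRHS](_ : _ = normal_peak 1 * (64 * expR (- y))); last by field.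
  rewrite mulrCA ler_wpM2l ?normal_peak_ge0// expRD mulrA ler_wpM2r ?expR_ge0//.
  rewrite expRN ler_pdivrMr ?expR_gt0// (_ : x ^+ 4 = 16 * y ^+ 2); last by rewrite /y; field.
  have := expR_ge1Dx (y / 2); have -> : expR y = expR (y / 2) ^+ 2.
    by rewrite expr2 -expRD; congr expR; field.
  nra.
under eq_integral do rewrite EFinM.
rewrite ge0_integralZl//=.
- by rewrite integral_normal_pdf mule1 ltry.
- by apply/measurable_EFinP; exact: measurable_normal_pdf.
- by move=> x _; rewrite lee_fin normal_pdf_ge0.
Qed.

(** The density is, up to sign, a primitive of [x] times itself; the value is
    its peak [1 / sqrt (2 pi)]. *)
Lemma integral_normal_neg_part (R : realType) :
  (\int[normal_prob (0 : R) 1]_x (Num.max (- x) 0)%:E = (normal_peak (1 : R))%:E)%E.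
Proof.
have mmax : measurable_fun [set: R] (fun x => Num.max (- x) 0).
  by apply: measurable_maxr => //; exact: measurable_funN.
rewrite ge0_integral_normal_prob; last 2 first.
- exact/measurable_EFinP.
- by move=> x; rewrite lee_fin le_max lexx orbT.
pose f (x : R) : R := x * normal_pdf 0 1 x.
pose F (x : R) : R := - normal_peak 1 * expR (- 2^-1 * x ^+ 2).
have FE : F = (fun x => - normal_pdf 0 1 x).
  apply/funext => x; rewrite /F normal_pdfE ?oner_eq0// /normal_fun subr0 mulNr.
  by congr (- (_ * expR _)); field.
have cpdf : continuous (fun x : R => normal_pdf 0 1 x).
  by apply: continuous_normal_pdf; exact: oner_neq0.
have cf : continuous f by move=> x; apply: cvgM => //; exact: cpdf.
have dF (x : R) : is_derive x (1 : R) F (f x).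
  have d2 : is_derive x (1 : R) (fun x : R => - 2^-1 * x ^+ 2) (- x).
    by apply: is_derive_eq; rewrite /GRing.scale/=; field.
  have := @is_derive1_comp R expR _ x _ _ (is_derive_expR _) d2.
  move=> /(is_deriveZ (- normal_peak 1)) dE; apply: is_derive_eq (dE) _.
  have -> : f x = x * - F x by rewrite FE opprK.
  by rewrite /GRing.scale/= /F; ring.
pose g (x : R) : \bar R := (Num.max 0 (f x))%:E.
have mg : measurable_fun [set: R] g.
  apply/measurable_EFinP/measurable_maxr => //.
  exact: continuous_measurable_fun.
transitivity (\int[lebesgue_measure]_(r in `]-oo, (0%R:R)]) g (- r)%R)%E.
  rewrite [RHS]integral_mkcond; apply: eq_integral => x _.
  rewrite patchE mem_setE in_itv/= -EFinM /g; case: leP => x0.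
    rewrite max_l ?oppr_ge0// max_r; last first.
      by rewrite mulr_ge0 ?oppr_ge0// normal_pdf_ge0.
    rewrite /f; congr ((_ * _)%:E).
    by rewrite !normal_pdfE ?oner_eq0// /normal_fun !subr0 sqrrN.
  by rewrite max_r ?oppr_le0 1?ltW// mul0r.
rewrite -ge0_integration_by_substitution0//; last first.
  by move=> r; rewrite lee_fin le_max lexx.
transitivity (\int[lebesgue_measure]_(r in `[(0%R:R), +oo[) (f r)%:E)%E.
  apply: eq_integral => x; rewrite mem_setE in_itv/= andbT => x0.
  by rewrite /g max_r// mulr_ge0// normal_pdf_ge0.
rewrite (@ge0_continuous_FTC2y _ f F _ 0).
- rewrite /F expr0n mulr0 expR0 mulr1 -EFinB; congr EFin; ring.
- by move=> x x0; rewrite mulr_ge0// normal_pdf_ge0.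
- exact: continuous_subspaceT.
- rewrite -(mulr0 (- normal_peak 1)); apply: cvgM; first exact: cvg_cst.
  under eq_fun do rewrite mulNr mulrC.
  apply: (cvg_comp (fun x : R => x ^+ 2 / 2) (fun x => expR (- x))).
    by apply: gt0_cvgMly => //; exact: cvgr_expr2.
  exact: cvgr_expR.
- by move=> x _; have [] := dF x.
- rewrite FE; apply: cvg_at_right_filter; apply: cvgN; exact: cpdf.
- by move=> x _; rewrite derive1E; have [] := dF x.
Qed.

Lemma PhiE (R : realType) (x : R) :
  (Phi x)%:E = normal_prob (0 : R) 1 `]-oo, x].
Proof. by rewrite /Phi fineK// fin_num_measure. Qed.

Lemma Phi_sub (R : realType) (x y : R) : x <= y ->
  (Phi y - Phi x)%:E = normal_prob (0 : R) 1 `]x, y].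
Proof.
move=> xy; rewrite EFinB !PhiE.
rewrite (_ : `]-oo, y] = `]-oo, x] `|` `]x, y])%classic; last first.
  apply/seteqP; split=> t /=; rewrite !in_itv/=.
    by case: (leP t x) => //=; [left|right].
  by case=> [/le_trans|/andP[]//]; apply.
rewrite measureU//.
  by rewrite addeAC subee ?add0e// fin_num_measure.
apply/seteqP; split=> t //=; rewrite !in_itv/= => -[tx /andP[xt _]].
by move: (le_lt_trans tx xt); rewrite ltxx.
Qed.

(** The density is bounded below by a positive constant on every bounded
    interval. *)
Lemma Phi_lt (R : realType) (x y : R) : (Phi x < Phi y) = (x < y).
Proof.
suff lt a b : a < b -> Phi a < Phi b :> R.
  apply/idP/idP; [|exact: lt]; apply: contraTT; rewrite -!leNgt le_eqVlt.
  by move=> /predU1P[->//|/lt/ltW].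
move=> {x y} ab; rewrite -subr_gt0 -lte_fin Phi_sub ?ltW//.
pose m := `|a| + `|b|.
pose c : R := normal_peak 1 * expR (- m ^+ 2 / 2).
have c0 : 0 < c by rewrite mulr_gt0 ?expR_gt0// normal_peak_gt0.
apply: (@lt_le_trans _ _ (\int[lebesgue_measure]_(x in `]a, b]) c%:E)%E).
  rewrite integral_cst//= lebesgue_measure_itv/= lte_fin ab -EFinB -EFinM lte_fin.
  by rewrite mulr_gt0// subr_gt0.
apply: ge0_le_integral => //=.
- by move=> x _; rewrite lee_fin ltW.
- by apply/measurable_EFinP/measurable_funTS; exact: measurable_normal_pdf.
move=> x; rewrite in_itv/= => /andP[ax xb].
rewrite lee_fin normal_pdfE ?oner_eq0// /normal_fun subr0 expr1n.
rewrite ler_wpM2l ?normal_peak_ge0// ler_expR !mulNr lerN2 ler_wpM2r//.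
have xm (t : R) : a < t -> t <= b -> `|t| <= m.
  move=> ta tb; rewrite /m ler_norml; have := ler_norm b; have := ler_norm (- a).
  rewrite normrN; have := normr_ge0 a; have := normr_ge0 b.
  by move=> *; apply/andP; split; lra.
by rewrite -(real_normK (num_real x)) ler_sqr ?nnegrE ?addr_ge0// xm.
Qed.

Lemma Phi_le (R : realType) (x y : R) : (Phi x <= Phi y) = (x <= y).
Proof. by rewrite !leNgt Phi_lt. Qed.

Lemma Phi_lipschitz (R : realType) (x y : R) : x <= y ->
  Phi y - Phi x <= normal_peak 1 * (y - x).
Proof.
move=> xy; rewrite -lee_fin Phi_sub//.
apply: (@le_trans _ _ (\int[lebesgue_measure]_(x in `]x, y]) (normal_peak (1 : R))%:E)%E).
  apply: ge0_le_integral => //=.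
  - by move=> t _; rewrite lee_fin normal_pdf_ge0.
  - by apply/measurable_EFinP/measurable_funTS; exact: measurable_normal_pdf.
  by move=> t _; rewrite lee_fin normal_pdf_ub ?oner_eq0.
rewrite integral_cst//= lebesgue_measure_itv/= lte_fin.
case: ltP => [_|yx]; first by rewrite -EFinB -EFinM.
by rewrite mule0 lee_fin mulr_ge0 ?normal_peak_ge0// subr_ge0.
Qed.

Lemma Phi_continuous (R : realType) : continuous (@Phi R).
Proof.
move=> x; apply/(@cvgrPdist_le _ R^o) => e e0.
have k0 : 0 < normal_peak 1 :> R by rewrite normal_peak_gt0// oner_eq0.
near=> y.
have : `|x - y| <= e / normal_peak 1.
  by near: y; apply: (@cvgr_dist_le _ R^o); rewrite ?divr_gt0//; exact: cvg_id.
rewrite ler_pdivlMr// mulrC; apply: le_trans.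
have [xy|yx] := leP x y.
  rewrite (distrC (Phi x)) (distrC x) !ger0_norm ?subr_ge0 ?Phi_le//.
  exact: Phi_lipschitz.
rewrite !ger0_norm ?subr_ge0 ?Phi_le ?(ltW yx)//.
by apply: Phi_lipschitz; exact: ltW.
Unshelve. all: by end_near. Qed.

Lemma normal_prob_set1 (R : realType) (x : R) : normal_prob 0 1 [set x] = 0%E.
Proof.
have /null_content_dominatesP := normal_prob_dominates (0 : R) 1.
by apply => //; exact: lebesgue_measure_set1.
Qed.

Lemma PhiN (R : realType) (x : R) : Phi (- x) = 1 - Phi x.
Proof.
apply: EFin_inj; rewrite EFinB !PhiE.
have mx : measurable (`]-oo, - x]%classic : set R) by [].
have N1 : -1 != 0 :> R by rewrite oppr_eq0 oner_eq0.
rewrite -[LHS](_ : normal_prob 0 `|-1| `]-oo, (- x)%R]%classic = _); last by rewrite normrN1.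
rewrite -normal_prob_scale//.
rewrite (_ : _ @^-1` _ = [set x] `|` ~` `]-oo, x]%classic); last first.
  apply/seteqP; split=> y /=; rewrite !in_itv/= mulN1r lerN2.
    case: (ltgtP x y) => // [xy _|-> _]; last by left.
    by right.
  case=> [->|/negP]; first by rewrite lexx.
  by rewrite -ltNge => /ltW.
rewrite measureU//; last 2 first.
- exact: measurableC.
- by apply/seteqP; split=> y //= [-> /negP]; rewrite in_itv/= lexx.
rewrite [X in (X + _ = _)%E](normal_prob_set1 x) add0e.
exact: (@probability_setC _ _ _ (normal_prob (0 : R) 1)).
Qed.

Lemma Phi0 (R : realType) : Phi 0 = 1 / 2 :> R.
Proof. by have := PhiN (0 : R); rewrite oppr0; lra. Qed.

Lemma Phi_gt0 (R : realType) (x : R) : 0 < Phi x.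
Proof.
apply: (@le_lt_trans _ _ (Phi (x - 1))); last by rewrite Phi_lt gtrBl.
by rewrite -lee_fin PhiE.
Qed.

Lemma Phi_lt1 (R : realType) (x : R) : Phi x < 1.
Proof. by rewrite -(opprK x) PhiN gtrBl Phi_gt0. Qed.

(** Every level of [`]0, 1[] is attained, by the intermediate value theorem; so
    the choice in [Phi_inv] picks a preimage. *)
Lemma Phi_invK (R : realType) (p : R) : 0 < p < 1 -> Phi (Phi_inv p) = p.
Proof.
move=> /andP[p0 p1]; rewrite /Phi_inv.
have large (q : R) : q < 1 -> exists x, q < Phi x.
  move=> q1.
  have mid : measurable_fun setT (idfun : measurableTypeR R -> R).
    exact: measurable_id.
  pose X : {RV (normal_prob (0 : R) 1) >-> R} :=
    HB.pack (idfun : measurableTypeR R -> R) (isMeasurableFun.Build _ _ _ _ _ mid).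
  have /fine_cvgP[_] := cvg_cdfy1 X.
  move=> /cvgr_gt/(_ q q1)[M [_ MP]].
  exists (M + 1); have := MP (M + 1); rewrite ltrDl => /(_ ltr01)//.
have [b pb] := large _ p1.
have [a' pa'] : exists x, 1 - p < Phi x by apply: large; rewrite gtrBl.
have pa : Phi (- a') < p by rewrite PhiN; lra.
have ab : - a' <= b by rewrite -Phi_le; apply/ltW/(lt_trans pa).
have [|c _ cp] := @IVT _ (@Phi R) _ _ p ab (continuous_subspaceT (@Phi_continuous R)).
  by rewrite ge_min le_max (ltW pa) (ltW pb) orbT.
by apply: (@getPex _ [set x | Phi x = p]); exists c.
Qed.

(** * Random recursions driven by independent noise *)

(** Measurable rectangles are stable by intersection and generate the product
    sigma-algebra. *)
Lemma finite_measure_prod_unique d1 d2 (X : measurableType d1)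
    (Z : measurableType d2) (R : realType)
    (m1 m2 : {measure set (X * Z) -> \bar R}) : (m1 setT < +oo)%E ->
  (forall A B, measurable A -> measurable B -> m1 (A `*` B) = m2 (A `*` B)) ->
  forall C, measurable C -> m1 C = m2 C.
Proof.
move=> m1oo m12 C mC.
pose rect : set (set (X * Z)) :=
  [set A `*` B | A in measurable & B in measurable].
apply: (@measure_unique _ _ _ rect (fun=> setT)) => //.
- by rewrite measurable_prod_measurableType.
- move=> _ _ [A1 mA1 [B1 mB1 <-]] [A2 mA2 [B2 mB2 <-]].
  rewrite -setXI; exists (A1 `&` A2); first exact: measurableI.
  by exists (B1 `&` B2) => //; exact: measurableI.
- by move=> _; exists setT => //; exists setT => //; rewrite setXTT.
- by rewrite bigcup_const//; exists 0.
- by move=> _ [A mA [B mB <-]]; exact: m12.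
Qed.

Section random_recursion.
Context (dO dX dZ : measure_display) (Omega : measurableType dO)
  (X : measurableType dX) (Z : measurableType dZ) (R : realType).
Variables (P : probability Omega R) (F : X * Z -> X) (x0 : X).
Variable zeta : nat -> {RV P >-> Z}.
Hypothesis mF : measurable_fun setT F.

Fixpoint random_recursion (t : nat) (w : Omega) : X :=
  if t is s.+1 then F (random_recursion s w, zeta s w) else x0.

Lemma measurable_random_recursion t : measurable_fun setT (random_recursion t).
Proof.
elim: t => [|t IHt] /=; first exact: measurable_cst.
by apply: (measurableT_comp mF); exact: measurable_fun_pair.
Qed.

(** As functions of [C] both sides are finite measures on the product, and they
    agree on rectangles. *)
Lemma indep_pair (Y : Omega -> X) (U : Omega -> Z) (E : set Omega) :
  measurable_fun setT Y -> measurable_fun setT U -> measurable E ->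
  (forall A B, measurable A -> measurable B ->
    P (Y @^-1` A `&` U @^-1` B `&` E) = (P (Y @^-1` A `&` U @^-1` B) * P E)%E) ->
  forall C, measurable C ->
    P ((fun w => (Y w, U w)) @^-1` C `&` E) =
    (P ((fun w => (Y w, U w)) @^-1` C) * P E)%E.
Proof.
move=> mY mU mE indep C mC.
have mYU : measurable_fun setT (fun w => (Y w, U w)).
  exact: measurable_fun_pair.
pose m1 : {measure set (X * Z) -> \bar R} :=
  pushforward (mrestr P mE) (fun w => (Y w, U w)).
have PE0 : 0 <= fine (P E) by rewrite fine_ge0.
pose m2 : {measure set (X * Z) -> \bar R} :=
  mscale (NngNum PE0) (pushforward P (fun w => (Y w, U w))).
have := @finite_measure_prod_unique _ _ _ _ _ (m1 mYU) (m2 mYU).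
rewrite /m1 /m2/= /mscale/= /pushforward /mrestr.
rewrite fineK ?fin_num_measure// muleC; apply => //.
  rewrite preimage_setT setTI (le_lt_trans (probability_le1 _ _))//.
  exact: ltry.
by move=> A B mA mB; rewrite muleC; exact: indep.
Qed.

Hypothesis zeta_indep : mutually_independent P zeta.

Let tail_event (s : seq nat) (B : nat -> set Z) : set Omega :=
  \big[setI/setT]_(i <- s) (zeta i @^-1` B i).

Let measurable_tail_event s B : (forall i, measurable (B i)) ->
  measurable (tail_event s B).
Proof.
move=> mB; apply: bigsetI_measurable => i _.
by rewrite -[X in measurable X]setTI; exact: measurable_funPT.
Qed.

(** The state at time [t] is a function of the noise before [t].  The statement
    carries an arbitrary event on the noise from [t] on, because the induction
    moves the noise at time [t] from the future to the past. *)
Lemma random_recursion_indep t (A : set X) (s : seq nat) (B : nat -> set Z) :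
  measurable A -> (forall i, measurable (B i)) ->
  uniq s -> all (leq t) s ->
  P (random_recursion t @^-1` A `&` tail_event s B) =
  (P (random_recursion t @^-1` A) * P (tail_event s B))%E.
Proof.
elim: t A s B => [|t IHt] A s B mA mB us st.
  have [Ax0|nAx0] := pselect (A x0).
    rewrite (_ : _ @^-1` A = setT); last by apply/seteqP; split.
    by rewrite setTI probability_setT mul1e.
  rewrite (_ : _ @^-1` A = set0); last by apply/seteqP; split.
  by rewrite set0I measure0 mul0e.
have mt := measurable_random_recursion t.
apply: (@indep_pair (random_recursion t) (zeta t) (tail_event s B) mt
  (measurable_funPT _) (measurable_tail_event s mB) _ (F @^-1` A)).
- move=> A' B' mA' mB'.
  have ts : t \notin s by apply/negP => /(allP st); rewrite ltnn.
  pose B1 i := if i == t then B' else B i.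
  have mB1 i : measurable (B1 i) by rewrite /B1; case: ifP.
  have B1s : tail_event s B1 = tail_event s B.
    rewrite /tail_event !big_seq; apply: eq_bigr => i si.
    by rewrite /B1; case: eqP => // it; move: ts; rewrite -it si.
  have B1t : zeta t @^-1` B' = tail_event [:: t] B1.
    by rewrite /tail_event big_seq1 /B1 eqxx.
  have B1ts : zeta t @^-1` B' `&` tail_event s B = tail_event (t :: s) B1.
    by rewrite -B1s /tail_event big_cons /B1 eqxx.
  rewrite -setIA B1ts IHt//; last 2 first.
  - by rewrite /= ts.
  - by rewrite /= leqnn; apply: sub_all st => i /ltnW.
  rewrite B1t IHt//; last by rewrite /= leqnn.
  rewrite -muleA; congr (_ * _)%E.
  rewrite -B1s /tail_event !zeta_indep//=; last by rewrite ts.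
  by rewrite big_cons big_seq1.
- by rewrite -[X in measurable X]setTI; exact: mF.
Qed.

Variable gamma : probability Z R.
Hypothesis zeta_law : forall t A, measurable A -> distribution P (zeta t) A = gamma A.

(** The current noise is independent of the current state, so that it may be
    integrated out first with the state held fixed.  This replaces conditioning
    on the past. *)
Lemma integral_random_recursion t (g : X * Z -> \bar R) :
  measurable_fun setT g -> (forall x, 0 <= g x)%E ->
  (\int[P]_w g (random_recursion t w, zeta t w) =
   \int[P]_w \int[gamma]_z g (random_recursion t w, z))%E.
Proof.
move=> mg g0.
have mt := measurable_random_recursion t.
pose Y : {RV P >-> X} :=
  HB.pack (random_recursion t) (isMeasurableFun.Build _ _ _ _ _ mt).
have mJ : measurable_fun setT (fun w => (random_recursion t w, zeta t w)).
  exact: measurable_fun_pair.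
pose J : {RV P >-> (X * Z)%type} :=
  HB.pack (fun w => (random_recursion t w, zeta t w)) (isMeasurableFun.Build _ _ _ _ _ mJ).
transitivity (\int[distribution P J]_xz g xz)%E.
  by rewrite ge0_integral_distribution.
transitivity (\int[distribution P Y \x gamma]_xz g xz)%E.
  apply: eq_measure_integral => C mC _.
  apply/esym/product_measure_unique => // A B mA mB.
  have /= := @random_recursion_indep t A [:: t] (fun=> B) mA (fun=> mB) isT.
  rewrite /tail_event big_seq1 leqnn => /(_ isT) E.
  rewrite -(zeta_law t)//.
rewrite fubini_tonelli1//= ge0_integral_distribution//.
- exact: measurable_fun_fubini_tonelli_F.
- by move=> x; apply: integral_ge0.
Qed.

Lemma random_recursion_supermartingale (W : X -> \bar R) (rho : R) :
  measurable_fun setT W -> (forall x, 0 <= W x)%E -> 0 <= rho ->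
  (forall x, \int[gamma]_z W (F (x, z)) <= rho%:E * W x)%E ->
  forall t, (\int[P]_w W (random_recursion t w) <= (rho ^+ t)%:E * W x0)%E.
Proof.
move=> mW W0 rho0 drift; elim=> [|t IHt] /=.
  by rewrite integral_cst//= probability_setT mule1 mul1e.
have mWt := measurableT_comp mW (measurable_random_recursion t).
rewrite (integral_random_recursion t (measurableT_comp mW mF)); last first.
  by move=> x; exact: W0.
apply: (@le_trans _ _ (\int[P]_w (rho%:E * W (random_recursion t w)))%E).
  apply: ge0_le_integral => //.
  - by move=> w _; apply: integral_ge0 => z _; exact: W0.
  - exact: (measurableT_comp (@measurable_fun_fubini_tonelli_F _ _ _ _ _ gamma
      (W \o F) (measurableT_comp mW mF) (fun x => W0 (F x)))
      (measurable_random_recursion t)).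
  - exact: emeasurable_funM.
  - by move=> w _; exact: drift.
rewrite ge0_integralZl// exprS EFinM -muleA.
  by apply: lee_wpmul2l; rewrite ?lee_fin.
Qed.

(** In expectation [W] decays like [expR (- b * t)], so the series of the
    [expR (b' * t) * W] has a finite expectation.  It is then almost surely
    finite, and it bounds each of its terms. *)
Lemma random_recursion_as_decay (W : X -> \bar R) (b b' : R) :
  measurable_fun setT W -> (forall x, 0 <= W x)%E -> (W x0 < +oo)%E -> b' < b ->
  (forall x, \int[gamma]_z W (F (x, z)) <= (expR (- b))%:E * W x)%E ->
  {ae P, forall w, exists C : R, forall t,
    (W (random_recursion t w) <= (C * expR (- b' * t%:R))%:E)%E}.
Proof.
move=> mW W0 Wx0 bb drift.
have EW := random_recursion_supermartingale mW W0 (expR_ge0 _) drift.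
pose S w := (\sum_(0 <= t <oo) ((expR (b' * t%:R))%:E * W (random_recursion t w)))%E.
have mWt t : measurable_fun setT
    (fun w => (expR (b' * t%:R))%:E * W (random_recursion t w))%E.
  apply: emeasurable_funM => //.
  exact: (measurableT_comp mW (measurable_random_recursion t)).
have St0 t w : (0 <= (expR (b' * t%:R))%:E * W (random_recursion t w))%E.
  by rewrite mule_ge0// lee_fin expR_ge0.
pose q := expR (- (b - b')).
have q1 : q < 1 by rewrite -expR0 ltr_expR oppr_lt0 subr_gt0.
have mS : measurable_fun setT S.
  by apply: ge0_emeasurable_sum => // t w _ _; exact: St0.
have intS : (\int[P]_w S w < +oo)%E.
  rewrite integral_nneseries//.
  apply: (@le_lt_trans _ _ (\sum_(0 <= t <oo) ((fine (W x0))%:E * (q ^+ t)%:E))%E).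
    apply: lee_nneseries => [t _ _|t _].
      by apply: integral_ge0 => w _; exact: St0.
    rewrite ge0_integralZl//; last 1 first.
    - exact: (measurableT_comp mW (measurable_random_recursion t)).
    rewrite fineK ?ge0_fin_numE//.
    apply: (@le_trans _ _ ((expR (b' * t%:R))%:E * ((expR (- b) ^+ t)%:E * W x0))%E).
      by apply: lee_wpmul2l; rewrite ?lee_fin ?expR_ge0.
    rewrite muleA -EFinM muleC le_eqVlt; apply/orP; left; apply/eqP.
    congr (_ * _%:E)%E; rewrite -!expRM_natr -expRD; congr expR; ring.
  under eq_eseriesr do rewrite -EFinM.
  have w0 : 0 <= fine (W x0) by rewrite fine_ge0.
  apply: (@le_lt_trans _ _ (fine (W x0) * (1 - q)^-1)%:E); last exact: ltry.
  apply: lime_le.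
    by apply: is_cvg_nneseries => t _ _; rewrite lee_fin mulr_ge0// exprn_ge0// expR_ge0.
  apply: nearW => n; rewrite sumEFin lee_fin.
  by apply: (@geometric_le_lim _ n) => //; rewrite ?expR_gt0// ger0_norm ?expR_ge0.
have intgS : P.-integrable setT S.
  apply/integrableP; split => //.
  rewrite (eq_integral S)// => w _; rewrite gee0_abs//.
  by apply: nneseries_ge0 => t _ _.
have := integrable_ae measurableT intgS.
apply: filterS => w /(_ I) Sfin; exists (fine (S w)) => t.
have : ((expR (b' * t%:R))%:E * W (random_recursion t w) <= S w)%E.
  apply: le_trans (nneseries_lim_ge t.+1 _) => //.
  rewrite big_nat_recr//=; apply: leeDr; exact: sume_ge0.
rewrite -[X in (_ <= X)%E -> _](fineK Sfin) -lee_pdivlMl ?expR_gt0//.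
by move=> /le_trans; apply; rewrite lee_fin mulrC mulNr expRN.
Qed.

End random_recursion.

(** * Euclidean geometry, strong convexity and smoothness *)

Section euclidean.
Context {R : realType} {d : nat}.
Implicit Types x y z : 'rV[R]_d.

Lemma dotvC x y : dotv x y = dotv y x.
Proof. by apply: eq_bigr => i _; rewrite mulrC. Qed.

Lemma dotvDl x y z : dotv (x + y) z = dotv x z + dotv y z.
Proof. by rewrite /dotv -big_split/=; apply: eq_bigr => i _; rewrite mxE mulrDl. Qed.

Lemma dotvZl (a : R) x y : dotv (a *: x) y = a * dotv x y.
Proof. by rewrite /dotv mulr_sumr; apply: eq_bigr => i _; rewrite mxE mulrA. Qed.

Lemma dotvDr x y z : dotv x (y + z) = dotv x y + dotv x z.
Proof. by rewrite dotvC dotvDl !(dotvC _ x). Qed.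

Lemma dotvZr (a : R) x y : dotv x (a *: y) = a * dotv x y.
Proof. by rewrite dotvC dotvZl dotvC. Qed.

Lemma dotvNl x y : dotv (- x) y = - dotv x y.
Proof. by rewrite -scaleN1r dotvZl mulN1r. Qed.

Lemma dotv0l x : dotv 0 x = 0.
Proof. by rewrite -(scale0r 0) dotvZl mul0r. Qed.

Lemma dotvv_ge0 x : 0 <= dotv x x.
Proof. by apply: sumr_ge0 => i _; rewrite -expr2 sqr_ge0. Qed.

Lemma dotvv_eq0 x : (dotv x x == 0) = (x == 0).
Proof.
apply/eqP/eqP => [x0|->]; last exact: dotv0l.
apply/rowP => i; rewrite mxE.
have /psumr_eq0P/(_ x0)/(_ i isT)/eqP : forall i : 'I_d, true ->
    0 <= x ord0 i * x ord0 i by move=> j _; rewrite -expr2 sqr_ge0.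
by rewrite mulf_eq0 orbb => /eqP.
Qed.

Lemma enorm_ge0 x : 0 <= enorm x. Proof. exact: sqrtr_ge0. Qed.

Lemma enorm_sqr x : enorm x ^+ 2 = dotv x x.
Proof. by rewrite sqr_sqrtr// dotvv_ge0. Qed.

Lemma enorm_eq0 x : (enorm x == 0) = (x == 0).
Proof. by rewrite -sqrf_eq0 enorm_sqr dotvv_eq0. Qed.

Lemma enorm_gt0 x : (0 < enorm x) = (x != 0).
Proof. by rewrite lt_neqAle eq_sym enorm_eq0 enorm_ge0 andbT. Qed.

Lemma enormN x : enorm (- x) = enorm x.
Proof. by rewrite /enorm dotvNl dotvC dotvNl opprK. Qed.

Lemma enormZ (a : R) x : enorm (a *: x) = `|a| * enorm x.
Proof.
by rewrite /enorm dotvZl dotvZr mulrA -expr2 sqrtrM ?sqr_ge0// sqrtr_sqr.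
Qed.

Lemma dotv_sqr_le x y : dotv x y ^+ 2 <= dotv x x * dotv y y.
Proof.
have [->|y0] := eqVneq y 0.
  by rewrite dotvC !dotv0l expr0n mulr0.
have yy0 : 0 < dotv y y by rewrite lt_neqAle eq_sym dotvv_eq0 y0 dotvv_ge0.
have := dotvv_ge0 (dotv y y *: x + (- dotv x y) *: y).
rewrite !(dotvDl, dotvDr, dotvZl, dotvZr) (dotvC y x) => h.
have : 0 <= dotv y y * (dotv x x * dotv y y - dotv x y ^+ 2).
  by move: h; congr (_ <= _); ring.
by rewrite pmulr_rge0// subr_ge0.
Qed.

Lemma dotv_le_enorm x y : dotv x y <= enorm x * enorm y.
Proof.
rewrite (le_trans (ler_norm _))// -(@ler_pXn2r _ 2) ?nnegrE//; last first.
  by rewrite mulr_ge0 ?enorm_ge0.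
by rewrite real_normK ?num_real// exprMn !enorm_sqr dotv_sqr_le.
Qed.

End euclidean.

Section strongly_convex_smooth.
Context {R : realType} {d : nat}.
Variables (L U : R) (f : 'rV[R]_d -> R).
Hypotheses (L0 : 0 < L) (A1 : assumption_A1 L U f).

Let g := grad f.

Lemma f_ge0 x : 0 <= f x.
Proof.
have [_ _ _ fmin f0] := A1; have [->|x0] := eqVneq x 0; first by rewrite f0.
by rewrite -f0 ltW// fmin.
Qed.

Lemma f_gt0 x : (0 < f x) = (x != 0).
Proof.
have [_ _ _ fmin f0] := A1; have [->|x0] := eqVneq x 0; first by rewrite f0 ltxx.
by rewrite -f0 fmin.
Qed.

Lemma f_eq0 x : (f x == 0) = (x == 0).
Proof. by apply/negb_inj; rewrite -f_gt0 lt_neqAle eq_sym f_ge0 andbT. Qed.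

Lemma strong_convexity x y :
  f x + dotv (y - x) (g x) + L / 2 * enorm (y - x) ^+ 2 <= f y.
Proof.
by have [_ _ /(_ x y)[+ _] _ _] := A1; rewrite -(enormN (x - y)) opprB.
Qed.

Lemma smoothness x y :
  f y <= f x + dotv (y - x) (g x) + U / 2 * enorm (y - x) ^+ 2.
Proof.
by have [_ _ /(_ x y)[_ +] _ _] := A1; rewrite -(enormN (x - y)) opprB.
Qed.

(** The Polyak-Lojasiewicz inequality: strong convexity bounds [f 0 = 0] from
    below by a quadratic function of the distance to [m], whose minimum is
    [f m - enorm (grad f m) ^+ 2 / (2 * L)]. *)
Lemma f_le_grad m : 2 * L * f m <= enorm (g m) ^+ 2.
Proof.
have := strong_convexity m 0; have [_ _ _ _ ->] := A1.
rewrite sub0r dotvNl enormN; have := dotv_le_enorm m (g m).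
have := enorm_ge0 m; have := enorm_ge0 (g m).
move: (enorm m) (enorm (g m)) => a b b0 a0 mg sc.
have fab : f m <= a * b - L / 2 * a ^+ 2 by lra.
apply: (@le_trans _ _ (2 * L * (a * b - L / 2 * a ^+ 2))).
  by rewrite ler_wpM2l// mulr_ge0// ltW.
have -> : 2 * L * (a * b - L / 2 * a ^+ 2) = b ^+ 2 - (L * a - b) ^+ 2 by field.
by rewrite gerBl sqr_ge0.
Qed.

(** Moving from the minimum by a small multiple of [- a * y], with [a] the slope
    along [y], would make [f] negative by the smoothness bound unless [a] is
    zero. *)
Lemma grad_min_orth y : dotv y (g 0) = 0.
Proof.
(* The denominator [k] makes the step short enough for the slope to win over
   the curvature [U], and the added 1 keeps it positive. *)
set a := dotv y (g 0); pose b := dotv y y; pose k := 1 + `|U| * b.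
have b0 : 0 <= b by exact: dotvv_ge0.
have Ub : U * b <= k.
  by rewrite /k (le_trans (ler_wpM2r b0 (ler_norm U)))// lerDr.
have k0 : 0 < k by rewrite ltr_wpDr// mulr_ge0.
have := smoothness 0 ((- a / k) *: y); have := f_ge0 ((- a / k) *: y).
have [_ _ _ _ ->] := A1; rewrite subr0 enorm_sqr !dotvZl dotvZr -/a -/b add0r.
move=> /le_trans/[apply].
have -> : - a / k * a + U / 2 * (- a / k * (- a / k * b)) =
  - (a ^+ 2 / k) * (1 - U * b / k / 2) by field; rewrite gt_eqF.
have h : 1 / 2 <= 1 - U * b / k / 2.
  have : U * b / k <= 1 by rewrite ler_pdivrMr// mul1r.
  lra.
rewrite mulNr oppr_ge0 pmulr_lle0; last by apply: lt_le_trans h.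
rewrite ler_pdivrMr// mul0r => a2.
by apply/eqP; rewrite -sqrf_eq0 eq_le a2 sqr_ge0.
Qed.

Lemma f_quadratic_lb x : L / 2 * enorm x ^+ 2 <= f x.
Proof.
have := strong_convexity 0 x; have [_ _ _ _ ->] := A1.
by rewrite subr0 grad_min_orth !add0r.
Qed.

Lemma grad_neq0 m : m != 0 -> 0 < enorm (g m).
Proof.
rewrite -f_gt0 => fm; rewrite lt_neqAle eq_sym enorm_ge0 andbT.
apply: contraTneq fm => g0; rewrite -leNgt.
have := f_le_grad m; rewrite g0 expr0n/= pmulr_rle0// mulr_gt0//.
Qed.

End strongly_convex_smooth.

(** * Moments of the standard Gaussian vector *)

Section gaussian_vector.
Context {R : realType} {d : nat}.
Local Notation gauss := (std_gauss R d).

(** Integral form of [std_gauss_linear]. *)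
Lemma ge0_integral_std_gauss_linear (a : 'rV[R]_d)
    (k : measurableTypeR R -> \bar R) :
  enorm a = 1 -> measurable_fun setT k -> (forall x, 0 <= k x)%E ->
  (\int[gauss]_z k (dotv a (rvec z)) = \int[normal_prob 0 1]_x k x)%E.
Proof.
move=> a1 mk k0.
have mT : measurable_fun setT (fun z => dotv a (rvec z) : measurableTypeR R).
  exact: measurable_dotv_rvec.
pose T : {RV gauss >-> measurableTypeR R} :=
  HB.pack (fun z => dotv a (rvec z) : measurableTypeR R)
    (isMeasurableFun.Build _ _ _ _ _ mT).
transitivity (\int[distribution gauss T]_x k x)%E.
  by rewrite ge0_integral_distribution.
apply: eq_measure_integral => A mA _.
have := @std_gauss_linear R d a A; rewrite a1; exact.
Qed.

Lemma gauss_fourth_moment_lty (a : 'rV[R]_d) : enorm a = 1 ->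
  (\int[gauss]_z (dotv a (rvec z) ^+ 4)%:E < +oo)%E.
Proof.
move=> a1.
rewrite (@ge0_integral_std_gauss_linear a (fun x => (x ^+ 4)%:E))//.
- exact: normal_fourth_moment_lty.
- by apply/measurable_EFinP; exact: measurable_funX.
- by move=> x; rewrite lee_fin exprn_even_ge0.
Qed.

Definition nrm2 (z : d.-tuple R) : R := dotv (rvec z) (rvec z).

Lemma nrm2E z : nrm2 z = \sum_i tnth z i ^+ 2.
Proof. by apply: eq_bigr => i _; rewrite mxE expr2. Qed.

Lemma measurable_nrm2 : measurable_fun setT nrm2.
Proof.
apply: (eq_measurable_fun (fun z : d.-tuple R => \sum_i tnth z i ^+ 2)).
  by move=> z _; rewrite nrm2E.
apply: measurable_sum => i; apply: measurable_funX.
exact: measurable_tnth.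
Qed.

Lemma nrm2_ge0 z : 0 <= nrm2 z. Proof. exact: dotvv_ge0. Qed.

(** The Cauchy-Schwarz inequality bounds the squared norm of the squares by [d]
    times the sum of the fourth powers, which are fourth moments of linear
    forms. *)
Lemma integral_nrm2_sqr_lty : (\int[gauss]_z (nrm2 z ^+ 2)%:E < +oo)%E.
Proof.
have le z : nrm2 z ^+ 2 <= d%:R * \sum_i tnth z i ^+ 4.
  have := @dotv_sqr_le R d (const_mx 1) (\row_i tnth z i ^+ 2).
  rewrite nrm2E /dotv; under eq_bigr do rewrite !mxE mul1r.
  under [X in _ <= X * _]eq_bigr do rewrite !mxE mul1r.
  under [X in _ <= _ * X]eq_bigr do rewrite !mxE -exprD.
  by rewrite sumr_const card_ord.
have mt i : measurable_fun setT (fun z : d.-tuple R => (tnth z i ^+ 4)%:E).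
  by apply/measurable_EFinP/measurable_funX; exact: measurable_tnth.
apply: (@le_lt_trans _ _ (\int[gauss]_z (d%:R%:E * \sum_i (tnth z i ^+ 4)%:E))%E).
  apply: ge0_le_integral => //.
  - by move=> z _; rewrite lee_fin sqr_ge0.
  - by apply/measurable_EFinP/measurable_funX; exact: measurable_nrm2.
  - by apply: emeasurable_funM => //; apply: emeasurable_sum => i; exact: mt.
  - by move=> z _; rewrite sumEFin -EFinM lee_fin.
rewrite ge0_integralZl//; last 2 first.
- by apply: emeasurable_sum => i; exact: mt.
- by move=> z _; apply: sume_ge0 => i _; rewrite lee_fin exprn_even_ge0.
rewrite lte_mul_pinfty//.
rewrite ge0_integral_sum//; last first.
  by move=> i z _; rewrite lee_fin exprn_even_ge0.
apply/lte_sum_pinfty => i _.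
have dE : (fun z : d.-tuple R => (tnth z i ^+ 4)%:E) =
    (fun z => (dotv (delta_mx ord0 i) (rvec z) ^+ 4)%:E).
  apply/funext => z; rewrite /dotv (bigD1 i)//= big1 ?addr0; last first.
    by move=> j ji; rewrite mxE eqxx (negbTE ji) mul0r.
  by rewrite !mxE !eqxx mul1r.
rewrite dE; apply: gauss_fourth_moment_lty.
rewrite /enorm /dotv (bigD1 i)//= big1 ?addr0.
  by rewrite mxE !eqxx mulr1 sqrtr1.
by move=> j ji; rewrite mxE eqxx (negbTE ji) mul0r.
Qed.

Lemma integral_nrm2_lty : (\int[gauss]_z (nrm2 z)%:E < +oo)%E.
Proof.
apply: (@le_lt_trans _ _ (\int[gauss]_z (1 + (nrm2 z ^+ 2)%:E))%E).
  apply: ge0_le_integral => //.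
  - by move=> z _; rewrite lee_fin nrm2_ge0.
  - by apply/measurable_EFinP; exact: measurable_nrm2.
  - apply/measurable_EFinP/measurable_funD => //.
    by apply: measurable_funX; exact: measurable_nrm2.
  - by move=> z _; rewrite -EFinD lee_fin; have := sqr_ge0 (nrm2 z - 1); nra.
rewrite ge0_integralD//=.
- by rewrite integral_cst//= probability_setT mul1e lte_add_pinfty ?ltry ?integral_nrm2_sqr_lty.
- by move=> z _; rewrite lee_fin sqr_ge0.
- by apply/measurable_EFinP/measurable_funX; exact: measurable_nrm2.
Qed.

End gaussian_vector.

(** * Success probability of one step *)

Lemma measurable_borel_affine (R : realType) (d : nat) (f : 'rV[R]_d -> R)
    (m : 'rV[R]_d) (c : R) : borel_fun f ->
  measurable_fun setT (fun z : d.-tuple R => f (m + c *: rvec z)).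
Proof.
move=> mf.
pose T (z : d.-tuple R) : d.-tuple R := [tuple m ord0 i + c * tnth z i | i < d].
have mT : measurable_fun setT T.
  apply/measurable_fun_tnthP => i.
  apply: (eq_measurable_fun (fun z : d.-tuple R => m ord0 i + c * tnth z i)).
    by move=> z _ /=; rewrite tnth_mktuple.
  apply: measurable_funD => //; apply: measurable_funM => //.
  exact: measurable_tnth.
apply: (eq_measurable_fun ((fun x => f (rvec x)) \o T)).
  move=> z _ /=; congr f; apply/rowP => i.
  by rewrite !mxE tnth_mktuple.
exact: measurableT_comp.
Qed.

Section one_step.
Context {R : realType} {d : nat}.
Variables (L U : R) (f : 'rV[R]_d -> R).
Hypotheses (L0 : 0 < L) (A1 : assumption_A1 L U f).
Local Notation gauss := (std_gauss R d).
Variables (m : 'rV[R]_d) (s : R).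
Hypothesis m0 : m != 0.

Local Notation theta := ((m, s) : state R d).
Local Notation sigma := (expR s).
Local Notation N := (enorm (grad f m)).
Local Notation Q := (Qz f theta).
Local Notation ze := (z_e f theta).

Let sigma_gt0 : 0 < sigma. Proof. exact: expR_gt0. Qed.
Let N_gt0 : 0 < N. Proof. exact: grad_neq0 L0 A1 _ m0. Qed.

(** [Qz] is the second-order remainder of [f] divided by [sigma ^+ 2 / 2], and
    strong convexity and smoothness enclose this remainder.  Hence [Qz] has a
    finite variance, and moments bounded uniformly in the state. *)
Lemma Qz_bounds z : L * nrm2 z <= Q z <= U * nrm2 z.
Proof.
have stepE : m + sigma *: rvec z - m = sigma *: rvec z.
  by rewrite addrAC subrr add0r.
have nz : enorm (sigma *: rvec z) ^+ 2 = sigma ^+ 2 * nrm2 z.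
  by rewrite enorm_sqr dotvZl dotvZr mulrA -expr2.
have := strong_convexity A1 m (m + sigma *: rvec z).
have := smoothness A1 m (m + sigma *: rvec z).
rewrite stepE nz (dotvC _ (grad f m)) /Qz/= /sigma_of/=.
set D := dotv _ _; set y := f (m + _) => h1 h2.
have s2 : 0 < sigma ^+ 2 / 2 by rewrite divr_gt0// exprn_gt0.
have -> : 2 / sigma ^+ 2 * (y - f m - D) = (y - f m - D) / (sigma ^+ 2 / 2).
  by field; rewrite gt_eqF.
by rewrite ler_pdivlMr// ler_pdivrMr//; apply/andP; split; lra.
Qed.

Lemma Qz_ge0 z : 0 <= Q z.
Proof.
by have /andP[+ _] := Qz_bounds z; apply: le_trans; rewrite mulr_ge0 ?nrm2_ge0 ?ltW.
Qed.

(** The increment splits into a linear part, which is exactly Gaussian, and a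
    nonnegative remainder, which is nearly constant when [V_std] is small. *)
Lemma f_increment z :
  f (m + sigma *: rvec z) - f m = sigma * N * ze z + sigma ^+ 2 / 2 * Q z.
Proof.
rewrite /Qz/= /z_e/= /sigma_of/= dotvZr (dotvC (grad f m)).
by field; rewrite !gt_eqF.
Qed.

Lemma measurable_step : measurable_fun setT
  (fun z : d.-tuple R => f (m + sigma *: rvec z)).
Proof. by apply: measurable_borel_affine; have [] := A1. Qed.

Lemma measurable_ze : measurable_fun setT ze.
Proof.
apply: measurable_funM => //.
apply: (eq_measurable_fun (fun z => dotv (grad f m) (rvec z))).
  by move=> z _; rewrite dotvC.
exact: measurable_dotv_rvec.
Qed.

Lemma measurable_Qz : measurable_fun setT Q.
Proof.
apply: measurable_funM => //; apply: measurable_funB.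
  by apply: measurable_funB => //; exact: measurable_step.
apply: (eq_measurable_fun (fun z => sigma * dotv (grad f m) (rvec z))).
  by move=> z _; rewrite /= dotvZr.
by apply: measurable_funM => //; exact: measurable_dotv_rvec.
Qed.

Definition mean_nrm2 : R := fine (\int[gauss]_z (nrm2 z)%:E)%E.

Lemma integral_Qz : (\int[gauss]_z (Q z)%:E = (E_Qz f theta)%:E)%E.
Proof.
rewrite /E_Qz unlock fineK// ge0_fin_numE; last first.
  by apply: integral_ge0 => z _; rewrite lee_fin Qz_ge0.
apply: (@le_lt_trans _ _ (\int[gauss]_z (`|U|%:E * (nrm2 z)%:E))%E).
  apply: ge0_le_integral => //.
  - by move=> z _; rewrite lee_fin Qz_ge0.
  - by apply/measurable_EFinP; exact: measurable_Qz.
  - apply: emeasurable_funM => //; apply/measurable_EFinP; exact: measurable_nrm2.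
  - move=> z _; rewrite -EFinM lee_fin.
    have /andP[_ /le_trans->//] := Qz_bounds z.
    by rewrite ler_wpM2r ?nrm2_ge0// ler_norm.
rewrite ge0_integralZl//.
- by rewrite lte_mul_pinfty// ?lee_fin// integral_nrm2_lty.
- by apply/measurable_EFinP; exact: measurable_nrm2.
- by move=> z _; rewrite lee_fin nrm2_ge0.
Qed.

(** Uniform in the state: it makes [E_Q] a supremum of a bounded set. *)
Lemma E_Qz_le : E_Qz f theta <= `|U| * mean_nrm2.
Proof.
rewrite -lee_fin -integral_Qz EFinM fineK; last first.
  rewrite ge0_fin_numE ?integral_nrm2_lty//.
  by apply: integral_ge0 => z _; rewrite lee_fin nrm2_ge0.
rewrite -ge0_integralZl//; last 2 first.
- by apply/measurable_EFinP; exact: measurable_nrm2.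
- by move=> z _; rewrite lee_fin nrm2_ge0.
apply: ge0_le_integral => //.
- by move=> z _; rewrite lee_fin Qz_ge0.
- by apply/measurable_EFinP; exact: measurable_Qz.
- apply: emeasurable_funM => //; apply/measurable_EFinP; exact: measurable_nrm2.
move=> z _; rewrite -EFinM lee_fin.
have /andP[_ /le_trans->//] := Qz_bounds z.
by rewrite ler_wpM2r ?nrm2_ge0// ler_norm.
Qed.

Let unit_grad : 'rV[R]_d := N^-1 *: grad f m.

Let unit_grad1 : enorm unit_grad = 1.
Proof. by rewrite enormZ gtr0_norm ?invr_gt0// mulVf ?gt_eqF. Qed.

Let zeE z : ze z = dotv unit_grad (rvec z).
Proof. by rewrite /z_e/= dotvZl mulrC dotvC. Qed.

Lemma ze_law (A : set R) : measurable A ->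
  gauss [set z | A (ze z)] = normal_prob 0 1 A.
Proof.
move=> mA; under eq_set do rewrite zeE.
by rewrite std_gauss_linear ?unit_grad1 ?oner_eq0.
Qed.

Lemma ze_cdf (x : R) : gauss [set z | ze z <= x] = (Phi x)%:E.
Proof.
by rewrite PhiE -ze_law.
Qed.

Lemma ze_sqr_le z : ze z ^+ 2 <= nrm2 z.
Proof.
rewrite zeE (le_trans (dotv_sqr_le _ _))//.
by rewrite -(enorm_sqr unit_grad) unit_grad1 expr1n mul1r.
Qed.

Lemma integral_ze_neg_part :
  (\int[gauss]_z (Num.max (- ze z) 0)%:E = (normal_peak (1 : R))%:E)%E.
Proof.
rewrite -integral_normal_neg_part.
under eq_integral do rewrite zeE.
rewrite (@ge0_integral_std_gauss_linear _ _ unit_grad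
  (fun x => (Num.max (- x) 0)%:E))//.
- by apply/measurable_EFinP/measurable_maxr => //; exact: measurable_funN.
- by move=> x; rewrite lee_fin le_max lexx orbT.
Qed.

Let neg_half : set (d.-tuple R) := [set z | ze z <= 0].

Let measurable_neg_half : measurable neg_half.
Proof.
rewrite (_ : neg_half = ze @^-1` `]-oo, 0]%classic).
  by rewrite -[X in measurable X]setTI; apply: measurable_ze.
by apply/seteqP; split => z /=; rewrite in_itv.
Qed.

Lemma measurable_Qz_neg : measurable_fun setT (fun z => Q z * \1_neg_half z).
Proof. by apply: measurable_funM; [exact: measurable_Qz|exact: measurable_indic]. Qed.

(** Positivity comes from the half-space where [z_e <= -1], on which
    [L <= L * nrm2 z <= Qz]. *)
Lemma integral_Qz_neg :
  (\int[gauss]_z (Q z * \1_neg_half z)%:E = (E_Qz_neg f theta)%:E)%E /\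
  0 < E_Qz_neg f theta <= E_Qz f theta.
Proof.
have Q1_ge0 z : 0 <= Q z * \1_neg_half z by rewrite mulr_ge0 ?Qz_ge0.
have Q1_le : (\int[gauss]_z (Q z * \1_neg_half z)%:E <= (E_Qz f theta)%:E)%E.
  rewrite -integral_Qz; apply: ge0_le_integral => //.
  - by move=> z _; rewrite lee_fin.
  - by apply/measurable_EFinP; exact: measurable_Qz_neg.
  - by apply/measurable_EFinP; exact: measurable_Qz.
  - by move=> z _; rewrite lee_fin ler_piMr ?Qz_ge0// indicE lern1 leq_b1.
have intE : (\int[gauss]_z (Q z * \1_neg_half z)%:E = (E_Qz_neg f theta)%:E)%E.
  rewrite /E_Qz_neg unlock fineK// ge0_fin_numE.
    by apply: le_lt_trans Q1_le _; exact: ltry.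
  by apply: integral_ge0 => z _; rewrite lee_fin.
split=> //; apply/andP; split; last by rewrite -lee_fin -intE.
rewrite -lte_fin -intE.
apply: (@lt_le_trans _ _ (L%:E * gauss [set z | (ze z <= -1)%R])%E).
  by rewrite ze_cdf -EFinM lte_fin mulr_gt0// Phi_gt0.
have mA : measurable [set z | ze z <= -1].
  rewrite (_ : mkset _ = ze @^-1` `]-oo, -1]%classic).
    by rewrite -[X in measurable X]setTI; apply: measurable_ze.
  by apply/seteqP; split => z /=; rewrite in_itv.
have -> : gauss [set z | ze z <= -1] =
    (\int[gauss]_z (\1_[set z | (ze z <= -1)%R] z)%:E)%E.
  by rewrite integral_indic ?setIT.
rewrite -ge0_integralZl//; last 2 first.
- by apply/measurable_EFinP; exact: measurable_indic.
- by rewrite lee_fin ltW.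
apply: ge0_le_integral => //.
- by move=> z _; rewrite -EFinM lee_fin mulr_ge0// ltW.
- exact/measurable_EFinP/measurable_funM.
- by apply/measurable_EFinP; exact: measurable_Qz_neg.
move=> z _; rewrite -EFinM lee_fin !indicE.
have [|] := boolP (z \in _); last by rewrite mulr0 Q1_ge0.
rewrite inE /= mulr1 => z1; rewrite mem_set ?mulr1; last first.
  by rewrite /neg_half/= (le_trans z1)// oppr_le0.
have /andP[+ _] := Qz_bounds z; apply: le_trans.
rewrite -[leLHS]mulr1 ler_wpM2l ?(ltW L0)//.
by have := ze_sqr_le z; nra.
Qed.

Lemma E_Qz_gt0 : 0 < E_Qz f theta.
Proof. by have [_ /andP[/lt_le_trans + h]] := integral_Qz_neg; apply. Qed.

(** [Qz ^+ 2 <= (U * nrm2 z) ^+ 2], and the fourth moment of the Gaussian norm is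
    finite. *)
Lemma variance_Qz_fin : variance gauss Q \is a fin_num.
Proof.
have E0 := ltW E_Qz_gt0; set E := E_Qz f theta in E0.
rewrite ge0_fin_numE ?variance_ge0//.
rewrite /variance covariance.unlock expectation.unlock.
rewrite integral_Qz /= -/E.
apply: (@le_lt_trans _ _ (\int[gauss]_z
    ((2 * U ^+ 2)%:E * (nrm2 z ^+ 2)%:E + (2 * E ^+ 2)%:E))%E).
  apply: ge0_le_integral => //.
  - by move=> z _; rewrite lee_fin -expr2 sqr_ge0.
  - apply/measurable_EFinP/measurable_funM.
      by apply: measurable_funB => //; exact: measurable_Qz.
    by apply: measurable_funB => //; exact: measurable_Qz.
  - apply: emeasurable_funD => //; apply: emeasurable_funM => //.
    by apply/measurable_EFinP/measurable_funX; exact: measurable_nrm2.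
  - move=> z _; rewrite -EFinM -EFinD lee_fin /=.
    have QU : Q z ^+ 2 <= U ^+ 2 * nrm2 z ^+ 2.
      rewrite -exprMn ler_sqr ?nnegrE ?Qz_ge0//.
        by have /andP[] := Qz_bounds z.
      by have /andP[_ /(le_trans (Qz_ge0 z))] := Qz_bounds z.
    have := sqr_ge0 (Q z + E); move: QU; rewrite !fctE/=; nra.
rewrite ge0_integralD//=; last first.
- by move=> z _; rewrite lee_fin mulr_ge0 ?sqr_ge0.
- apply: emeasurable_funM => //.
  by apply/measurable_EFinP/measurable_funX; exact: measurable_nrm2.
- by move=> z _; rewrite mule_ge0// lee_fin ?sqr_ge0// mulr_ge0// sqr_ge0.
rewrite integral_cst//= probability_setT mule1 lte_add_pinfty ?ltry//.
rewrite ge0_integralZl//.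
- by rewrite lte_mul_pinfty// ?lee_fin ?integral_nrm2_sqr_lty// mulr_ge0// sqr_ge0.
- by apply/measurable_EFinP/measurable_funX; exact: measurable_nrm2.
- by move=> z _; rewrite lee_fin sqr_ge0.
- by rewrite lee_fin mulr_ge0// sqr_ge0.
Qed.

Lemma V_std_ge0 : 0 <= V_std f theta.
Proof. by rewrite divr_ge0 ?sqr_ge0// fine_ge0// variance_ge0. Qed.

Lemma Qz_chebyshev (e : R) : 0 < e ->
  (gauss [set z | (e * E_Qz f theta <= `|Q z - E_Qz f theta|)%R] <=
   (V_std f theta / e ^+ 2)%:E)%E.
Proof.
move=> e0; have E0 := E_Qz_gt0.
pose X : {RV gauss >-> R} :=
  HB.pack Q (isMeasurableFun.Build _ _ _ _ _ measurable_Qz).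
have := chebyshev X (mulr_gt0 e0 E0); move=> /le_trans; apply.
rewrite -(fineK variance_Qz_fin) -EFinM lee_fin /V_std exprMn.
by rewrite le_eqVlt; apply/orP; left; apply/eqP; field; rewrite !gt_eqF.
Qed.

Definition success : set (d.-tuple R) :=
  [set z | f (m + sigma *: rvec z) <= f m].

Lemma measurable_success : measurable success.
Proof.
have -> : success = (fun z => f (m + sigma *: rvec z)) @^-1` `]-oo, f m]%classic.
  by apply/seteqP; split=> z /=; rewrite in_itv.
by rewrite -[X in measurable X]setTI; apply: measurable_step.
Qed.

Definition psucc : R := fine (gauss success).

Lemma psuccE : gauss success = psucc%:E.
Proof. by rewrite /psucc fineK// fin_num_measure//; exact: measurable_success. Qed.

(** The step size on the natural scale of the problem: if [Qz] were equal to its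
    mean, the success probability would be [Phi (- sigma_hat / 2)]. *)
Definition sigma_hat : R := sigma * E_Qz f theta / N.

(** The increment of [f_increment] divided by [sigma] and by the norm of the
    gradient. *)
Lemma successP z :
  (f (m + sigma *: rvec z) <= f m) =
  (ze z <= - (sigma_hat / 2) * (Q z / E_Qz f theta)).
Proof.
rewrite -subr_le0 f_increment /sigma_hat; have E0 := E_Qz_gt0.
have -> : - (sigma * E_Qz f theta / N / 2) * (Q z / E_Qz f theta) =
   - (sigma ^+ 2 / 2 * Q z) / (sigma * N) by field; rewrite !gt_eqF.
by rewrite ler_pdivlMr ?mulr_gt0// mulrC -lerBrDr sub0r.
Qed.

Lemma sigma_hat_gt0 : 0 < sigma_hat.
Proof. by rewrite divr_gt0// mulr_gt0// E_Qz_gt0. Qed.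

Let measurable_ze_le x : measurable [set z | ze z <= x].
Proof.
rewrite (_ : mkset _ = ze @^-1` `]-oo, x]%classic).
  by rewrite -[X in measurable X]setTI; apply: measurable_ze.
by apply/seteqP; split => z /=; rewrite in_itv.
Qed.

Let measurable_deviation e :
  measurable [set z | e * E_Qz f theta <= `|Q z - E_Qz f theta|].
Proof.
rewrite (_ : mkset _ = (fun z => `|Q z - E_Qz f theta|) @^-1` `[e * E_Qz f theta, +oo[%classic).
  rewrite -[X in measurable X]setTI.
  have mQ : measurable_fun setT (fun z => `|Q z - E_Qz f theta|).
    apply: measurableT_comp => //; apply: measurable_funB => //.
    exact: measurable_Qz.
  exact: mQ.
by apply/seteqP; split => z /=; rewrite in_itv/= andbT.
Qed.

(** Outside an event controlled by Chebyshev's inequality, [Qz] is at most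
    [1 + e] times its mean, and then [successP] reduces success to a condition
    on the standard normal variable [z_e]. *)
Lemma psucc_ge (e : R) : 0 < e ->
  Phi (- (sigma_hat * (1 + e) / 2)) - V_std f theta / e ^+ 2 <= psucc.
Proof.
move=> e0; rewrite lerBlDr -lee_fin EFinD -psuccE -ze_cdf.
apply: (le_trans _ (leeD (lexx _) (Qz_chebyshev e0))).
apply: (le_trans _ (measureU2 _ _ _)) => //; last exact: measurable_success.
apply: le_measure; rewrite ?inE//.
  by apply: measurableU => //; exact: measurable_success.
move=> z /= zle; rewrite /success/= successP.
have [|dev] := leP (e * E_Qz f theta) `|Q z - E_Qz f theta|; first by right.
left; apply: le_trans zle _; have E0 := E_Qz_gt0; have h0 := sigma_hat_gt0.
have : Q z / E_Qz f theta <= 1 + e.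
  rewrite ler_pdivrMr//.
  by have := ltW (le_lt_trans (ler_norm _) dev); lra.
by move=> qe; rewrite mulNr lerN2 [leRHS]mulrAC ler_wpM2l// divr_ge0// ltW.
Qed.

Lemma psucc_le (e : R) : 0 < e ->
  psucc <= Phi (- (sigma_hat * (1 - e) / 2)) + V_std f theta / e ^+ 2.
Proof.
move=> e0; rewrite -lee_fin EFinD -psuccE -ze_cdf.
apply: (le_trans _ (leeD (lexx _) (Qz_chebyshev e0))).
apply: (le_trans _ (measureU2 _ _ _)) => //.
apply: le_measure; rewrite ?inE//.
- exact: measurable_success.
- exact: measurableU.
move=> z /=; rewrite /success/= successP => zle.
have [|dev] := leP (e * E_Qz f theta) `|Q z - E_Qz f theta|; first by right.
left; apply: (le_trans zle); have E0 := E_Qz_gt0; have h0 := sigma_hat_gt0.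
have : 1 - e <= Q z / E_Qz f theta.
  rewrite ler_pdivlMr//.
  by move: dev; rewrite ltr_norml => /andP[dev _]; lra.
by move=> qe; rewrite mulNr lerN2 [leLHS]mulrAC ler_wpM2l// divr_ge0// ltW.
Qed.

End one_step.

(** * Expected decrease in one step *)

Section expected_decrease.
Context {R : realType} {d : nat}.
Variables (L U : R) (f : 'rV[R]_d -> R).
Hypotheses (L0 : 0 < L) (A1 : assumption_A1 L U f).
Local Notation gauss := (std_gauss R d).

Definition decrease (m : 'rV[R]_d) (s : R) (z : d.-tuple R) : R :=
  Num.max 0 (f m - f (m + expR s *: rvec z)).

Definition mean_decrease (m : 'rV[R]_d) (s : R) : R :=
  fine (\int[gauss]_z (decrease m s z)%:E)%E.

Lemma measurable_decrease m s : measurable_fun setT (decrease m s).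
Proof.
apply: measurable_maxr => //; apply: measurable_funB => //.
exact: (measurable_step A1).
Qed.

Lemma decrease_ge0 m s z : 0 <= decrease m s z.
Proof. by rewrite le_max lexx. Qed.

Lemma decrease_le m s z : decrease m s z <= f m.
Proof. by rewrite ge_max (f_ge0 A1)/= gerBl (f_ge0 A1). Qed.

Lemma integral_decrease m s :
  (\int[gauss]_z (decrease m s z)%:E = (mean_decrease m s)%:E)%E.
Proof.
rewrite /mean_decrease fineK// ge0_fin_numE; last first.
  by apply: integral_ge0 => z _; rewrite lee_fin decrease_ge0.
apply: (@le_lt_trans _ _ (\int[gauss]_z (f m)%:E)%E).
  apply: ge0_le_integral => //.
  - by move=> z _; rewrite lee_fin decrease_ge0.
  - by apply/measurable_EFinP; exact: measurable_decrease.
  - by move=> z _; rewrite lee_fin decrease_le.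
by rewrite integral_cst//= probability_setT mule1 ltry.
Qed.

(** Where [z_e <= 0], the decrease is at least the linear gain minus the
    remainder of [f_increment]; elsewhere it is nonnegative.  On average the
    linear gain is [sigma * N] times [1 / sqrt (2 pi)], while the hypothesis,
    later instantiated with [k = kappa_inf f], says which share of the mean of
    [Qz] lies on the half-space [z_e <= 0]. *)
Lemma mean_decrease_ge (m : 'rV[R]_d) (s k : R) : m != 0 -> 0 < k ->
  E_Qz_neg f (m, s) <= E_Qz f (m, s) / k ->
  expR s * enorm (grad f m) / (2 * k) *
    (Num.sqrt (2 / pi) * k - sigma_hat f m s) <= mean_decrease m s.
Proof.
move=> m0 k0 Ek; set sigma := expR s; set N := enorm _.
have sigma0 : 0 < sigma by exact: expR_gt0.
have N0 : 0 < N by exact: (grad_neq0 L0 A1 m0).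
have [EQn /andP[En0 _]] := integral_Qz_neg L0 A1 s m0.
(* [normal_peak 1] is [1 / sqrt (2 pi)]. *)
have peakE : 2 * normal_peak 1 = Num.sqrt (2 / pi) :> R.
  rewrite -[LHS]ger0_norm ?mulr_ge0 ?normal_peak_ge0// -sqrtr_sqr.
  congr Num.sqrt; rewrite /normal_peak expr1n mul1r exprMn exprVn.
  have := pi_gt0 R; move: (@pi R) => c c0.
  by rewrite sqr_sqrtr ?mulrn_wge0 ?ltW//; field; rewrite gt_eqF.
have ineq : sigma * N * normal_peak 1 <=
    mean_decrease m s + sigma ^+ 2 / 2 * E_Qz_neg f (m, s).
  rewrite -lee_fin EFinD EFinM (EFinM (_ / 2)) -integral_decrease -EQn.
  rewrite -(integral_ze_neg_part L0 A1 s m0).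
  have mze := @measurable_ze R d f m s.
  have mQn := measurable_Qz_neg A1 m s.
  have mmax : measurable_fun setT (fun z => Num.max (- z_e f (m, s) z) 0).
    by apply: measurable_maxr => //; exact: measurable_funN.
  have Qn0 z : 0 <= Qz f (m, s) z * \1_[set z | z_e f (m, s) z <= 0] z.
    by rewrite mulr_ge0// (Qz_ge0 L0 A1).
  have s20 : 0 <= sigma ^+ 2 / 2 by rewrite divr_ge0 ?exprn_ge0// ltW.
  have sN0 : 0 <= sigma * N by rewrite mulr_ge0// ltW.
  rewrite -!ge0_integralZl_real//; last first.
    by move=> z; rewrite le_max lexx orbT.
  rewrite -ge0_integralD_real//; last 4 first.
  - exact: measurable_decrease.
  - by move=> z; exact: decrease_ge0.
  - exact: measurable_funM.
  - by move=> z; rewrite mulr_ge0.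
  apply: ge0_le_integral => //.
  - by move=> z _; rewrite lee_fin mulr_ge0// le_max lexx orbT.
  - exact/measurable_EFinP/measurable_funM.
  - apply/measurable_EFinP/measurable_funD; first exact: measurable_decrease.
    exact: measurable_funM.
  move=> z _; rewrite lee_fin indicE.
  have [z0|z0] := leP (z_e f (m, s) z) 0.
    rewrite max_l ?oppr_ge0// mem_set// mulr1 -lerBlDr.
    rewrite /decrease le_max; apply/orP; right.
    by have := f_increment L0 A1 s m0 z; rewrite -/N -/sigma; lra.
  rewrite max_r; last by rewrite oppr_le0 ltW.
  rewrite mulr0 addr_ge0 ?decrease_ge0//.
  by rewrite mulr_ge0// mulr_ge0// (Qz_ge0 L0 A1).
have : sigma ^+ 2 / 2 * E_Qz_neg f (m, s) <= sigma ^+ 2 / 2 * (E_Qz f (m, s) / k).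
  by rewrite ler_wpM2l// divr_ge0 ?exprn_ge0// ltW.
move: ineq => + h2; rewrite -lerBlDr => /(le_trans _); apply.
apply: le_trans (lerB (lexx _) h2).
rewrite -peakE /sigma_hat -/sigma -/N.
by rewrite le_eqVlt; apply/orP; left; apply/eqP; field; rewrite !gt_eqF.
Qed.

(** The norm of the gradient is replaced by [Num.sqrt (2 * L * f m)] through
    [f_le_grad], which makes the bound a function of [expR s / Num.sqrt (f m)]
    alone. *)
Lemma mean_decrease_rel_ge (m : 'rV[R]_d) (s k u : R) : m != 0 -> 0 < k ->
  E_Qz_neg f (m, s) <= E_Qz f (m, s) / k ->
  sigma_hat f m s <= u -> u <= Num.sqrt (2 / pi) * k ->
  expR s / Num.sqrt (f m) * Num.sqrt (2 * L) / (2 * k) *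
    (Num.sqrt (2 / pi) * k - u) <= mean_decrease m s / f m.
Proof.
move=> m0 k0 Ek su uk.
have fm : 0 < f m by rewrite (f_gt0 A1).
have sq : 0 < Num.sqrt (f m) by rewrite sqrtr_gt0.
rewrite ler_pdivlMr//; apply: le_trans (mean_decrease_ge m0 k0 Ek).
have NL : Num.sqrt (2 * L) * Num.sqrt (f m) <= enorm (grad f m).
  rewrite -sqrtrM; last by rewrite mulr_ge0// ltW.
  rewrite -[leRHS]ger0_norm ?enorm_ge0// -sqrtr_sqr ler_sqrt ?sqr_ge0//.
  exact: (f_le_grad L0 A1).
apply: (@le_trans _ _ (expR s * (Num.sqrt (2 * L) * Num.sqrt (f m)) / (2 * k) *
    (Num.sqrt (2 / pi) * k - u))).
  rewrite le_eqVlt; apply/orP; left; apply/eqP.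
  rewrite -[X in _ * X = _](sqr_sqrtr (ltW fm)).
  by field; rewrite !gt_eqF.
apply: ler_pM.
- by rewrite divr_ge0 ?mulr_ge0 ?sqrtr_ge0 ?expR_ge0// ltW.
- by rewrite subr_ge0.
- by rewrite ler_wpM2r ?invr_ge0 ?mulr_ge0 ?(ltW k0)// ler_wpM2l ?expR_ge0.
- by rewrite lerB.
Qed.

End expected_decrease.

(** * The thresholds on the step size *)

Section Phi_inv_theory.
Context {R : realType}.
Implicit Types p q x : R.

Lemma Phi_inv_ltP p x : 0 < p < 1 -> (x < Phi_inv p) = (Phi x < p).
Proof. by move=> p01; rewrite -Phi_lt Phi_invK. Qed.

Lemma Phi_inv_gtP p x : 0 < p < 1 -> (Phi_inv p < x) = (p < Phi x).
Proof. by move=> p01; rewrite -Phi_lt Phi_invK. Qed.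

Lemma Phi_inv_le p q : 0 < p < 1 -> 0 < q < 1 ->
  (Phi_inv p <= Phi_inv q) = (p <= q).
Proof. by move=> p01 q01; rewrite -Phi_le !Phi_invK. Qed.

Lemma Phi_inv_gt0 p : 1 / 2 < p < 1 -> 0 < Phi_inv p.
Proof.
move=> /andP[p2 p1]; rewrite Phi_inv_ltP ?Phi0// p1 andbT.
by apply: lt_trans p2.
Qed.

End Phi_inv_theory.

Section thresholds.
Context {R : realType} {d : nat}.
Variables (f : 'rV[R]_d -> R).
Implicit Types (theta : state R d) (q e : R).
Local Notation V := (V_std f).

Lemma V_ge0 theta : 0 <= V theta.
Proof. by case: theta => m s; exact: V_std_ge0. Qed.

(** The lower limit on [e] says that [q + V / e ^+ 2] stays below [1 / 2], so that
    [Phi_inv] is applied inside [`]1 / 2, 1[]. *)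
Lemma high_range theta q e : 0 < q < 1 / 2 ->
  Num.sqrt (2 * V theta / (1 - 2 * q)) < e ->
  [/\ 0 < e, 0 <= V theta / e ^+ 2 & q + V theta / e ^+ 2 < 1 / 2].
Proof.
move=> /andP[q0 q2] ve; have V0 := V_ge0 theta.
have e0 : 0 < e by apply: le_lt_trans ve; exact: sqrtr_ge0.
have q21 : 0 < 1 - 2 * q by lra.
split => //; first by rewrite divr_ge0// sqr_ge0.
have : 2 * V theta / (1 - 2 * q) < e ^+ 2.
  rewrite -[ltLHS]sqr_sqrtr ?ltr_sqr ?nnegrE ?sqrtr_ge0 ?(ltW e0)//.
  by apply: divr_ge0; [exact: mulr_ge0 | exact: ltW].
rewrite ltr_pdivrMr// => h.
have : V theta / e ^+ 2 < (1 - 2 * q) / 2.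
  by rewrite ltr_pdivrMr ?exprn_gt0//; lra.
by lra.
Qed.

Lemma low_range theta q e : 0 < q < 1 / 2 ->
  Num.sqrt (V theta / q) < e < 1 ->
  [/\ 0 < e, 0 <= V theta / e ^+ 2 & V theta / e ^+ 2 < q].
Proof.
move=> /andP[q0 q2] /andP[ve e1]; have V0 := V_ge0 theta.
have e0 : 0 < e by apply: le_lt_trans ve; exact: sqrtr_ge0.
split => //; first by rewrite divr_ge0// sqr_ge0.
have : V theta / q < e ^+ 2.
  rewrite -[ltLHS]sqr_sqrtr ?ltr_sqr ?nnegrE ?sqrtr_ge0 ?(ltW e0)//.
  by apply: divr_ge0 => //; exact: ltW.
by rewrite ltr_pdivrMr// => h; rewrite ltr_pdivrMr ?exprn_gt0// mulrC.
Qed.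

(** [2 * Phi_inv (1 - q)] is the threshold in the ideal case of a constant [Qz].
    It separates [B_high] from [B_low] (see [B_low_elt_ge]), which is also what
    bounds the sets that define them. *)
Lemma B_high_elt_le theta q e : 0 < q < 1 / 2 ->
  Num.sqrt (2 * V theta / (1 - 2 * q)) < e ->
  0 <= 2 * Phi_inv (1 - (q + V theta / e ^+ 2)) / (1 + e) <= 2 * Phi_inv (1 - q).
Proof.
move=> q02 ve; have [e0 v0 v2] := high_range q02 ve; have /andP[q0 q2] := q02.
have p0 : 0 < Phi_inv (1 - (q + V theta / e ^+ 2)).
  by apply: Phi_inv_gt0; apply/andP; split; lra.
rewrite divr_ge0 ?mulr_ge0 ?(ltW p0) ?addr_ge0 ?(ltW e0)//=.
rewrite ler_pdivrMr ?addr_gt0// -[leRHS]mulrA ler_pM2l//.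
apply: (@le_trans _ _ (Phi_inv (1 - q))).
  by rewrite Phi_inv_le; [lra|apply/andP; split; lra..].
rewrite ler_peMr//; last by lra.
by apply/ltW/Phi_inv_gt0; apply/andP; split; lra.
Qed.

Lemma B_high_has_sup theta q : 0 < q < 1 / 2 ->
  has_sup [set 2 * Phi_inv (1 - (q + V theta / e ^+ 2)) / (1 + e) | e in
       [set e : R | Num.sqrt (2 * V theta / (1 - 2 * q)) < e]].
Proof.
move=> q02; split.
  by eexists; exists (Num.sqrt (2 * V theta / (1 - 2 * q)) + 1) => //=; rewrite ltrDl.
by exists (2 * Phi_inv (1 - q)) => _ [e /= ve <-]; have /andP[] := B_high_elt_le q02 ve.
Qed.

Lemma B_high_ge_elt theta q e : 0 < q < 1 / 2 ->
  Num.sqrt (2 * V theta / (1 - 2 * q)) < e ->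
  2 * Phi_inv (1 - (q + V theta / e ^+ 2)) / (1 + e) <= B_high f theta q.
Proof.
move=> q02 ve; apply: sup_ubound; last by exists e.
by have [] := B_high_has_sup theta q02.
Qed.

Lemma B_high_ge0 theta q : 0 < q < 1 / 2 -> 0 <= B_high f theta q.
Proof.
move=> q02; pose e := Num.sqrt (2 * V theta / (1 - 2 * q)) + 1.
have ve : Num.sqrt (2 * V theta / (1 - 2 * q)) < e by rewrite ltrDl.
apply: le_trans (B_high_ge_elt q02 ve).
by have /andP[] := B_high_elt_le q02 ve.
Qed.

Lemma B_high_le theta q : 0 < q < 1 / 2 -> B_high f theta q <= 2 * Phi_inv (1 - q).
Proof.
move=> q02; apply: ge_sup; first by have [] := B_high_has_sup theta q02.
by move=> _ [e /= ve <-]; have /andP[] := B_high_elt_le q02 ve.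
Qed.

Lemma B_low_elt_ge theta q e : 0 < q < 1 / 2 ->
  Num.sqrt (V theta / q) < e < 1 ->
  2 * Phi_inv (1 - q) <= 2 * Phi_inv (1 - (q - V theta / e ^+ 2)) / (1 - e).
Proof.
move=> q02 ve; have [e0 v0 vq] := low_range q02 ve; have /andP[q0 q2] := q02.
have e1 : e < 1 by case/andP: ve.
rewrite ler_pdivlMr ?subr_gt0// -[leLHS]mulrA ler_pM2l//.
apply: (@le_trans _ _ (Phi_inv (1 - q))).
  by rewrite ler_piMr//; [apply/ltW/Phi_inv_gt0; apply/andP; split; lra|lra].
by rewrite Phi_inv_le; [lra|apply/andP; split; lra..].
Qed.

Lemma B_low_has_inf theta q : 0 < q < 1 / 2 -> V theta < q ->
  has_inf [set 2 * Phi_inv (1 - (q - V theta / e ^+ 2)) / (1 - e) | e in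
       [set e : R | Num.sqrt (V theta / q) < e < 1]].
Proof.
move=> q02 Vq; have /andP[q0 q2] := q02; split.
  have v1 : Num.sqrt (V theta / q) < 1.
    by rewrite -sqrtr1 ltr_sqrt// ltr_pdivrMr// mul1r.
  eexists; exists ((Num.sqrt (V theta / q) + 1) / 2) => //=.
  by apply/andP; split; lra.
by exists (2 * Phi_inv (1 - q)) => _ [e /= ve <-]; exact: B_low_elt_ge.
Qed.

Lemma B_low_ge theta q : 0 < q < 1 / 2 -> V theta < q ->
  2 * Phi_inv (1 - q) <= B_low f theta q.
Proof.
move=> q02 Vq; apply: lb_le_inf; first by have [] := B_low_has_inf q02 Vq.
by move=> _ [e /= ve <-]; exact: B_low_elt_ge.
Qed.

Section success_probability.
Variables (L U : R).
Hypotheses (L0 : 0 < L) (A1 : assumption_A1 L U f).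
Variables (m : 'rV[R]_d) (s : R).
Hypothesis m0 : m != 0.

(** [B_high] optimises over [e] the bound [psucc_ge]: below it, some [e] yields a
    success probability of at least [q]. *)
Lemma psucc_ge_of_small q : 0 < q < 1 / 2 ->
  sigma_hat f m s < B_high f (m, s) q -> q <= psucc f m s.
Proof.
move=> q02 small; have /andP[q0 q2] := q02.
have [_ [e /= ve <-]] := sup_gt (B_high_has_sup (m, s) q02).1 small.
have [e0 v0 v2] := high_range q02 ve.
rewrite ltr_pdivlMr ?addr_gt0// -ltr_pdivrMl// mulrC.
rewrite Phi_inv_ltP; last by apply/andP; split; lra.
by have := psucc_ge L0 A1 s m0 e0; rewrite PhiN; lra.
Qed.

(** The counterpart of [psucc_ge_of_small] for [psucc_le], optimised over [e]. *)
Lemma psucc_le_of_large q : 0 < q < 1 / 2 -> V (m, s) < q ->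
  B_low f (m, s) q < sigma_hat f m s -> psucc f m s <= q.
Proof.
move=> q02 Vq large; have /andP[q0 q2] := q02.
have [_ [e /= ve <-]] := inf_lt (B_low_has_inf q02 Vq).1 large.
have [e0 v0 vq] := low_range q02 ve; have /andP[_ e1] := ve.
rewrite ltr_pdivrMr ?subr_gt0// -ltr_pdivlMl// [ltRHS]mulrC.
rewrite Phi_inv_gtP; last by apply/andP; split; lra.
by have := psucc_le L0 A1 s m0 e0; rewrite PhiN; lra.
Qed.

End success_probability.

End thresholds.

(** * A potential with negative drift *)

Section potential.
Context {R : realType}.
Implicit Types v c D S delta : R.

(** [D] is the logarithm of [f m] and [S] that of the step size, so that
    [S - D / 2] is the logarithm of the step size relative to [Num.sqrt (f m)],
    which is comparable to the distance to the optimum.  The penalty on its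
    distance to [c] accounts for the phases in which the step size is badly
    adapted and [f] hardly decreases. *)
Definition potential v c D S : R := D + v * `|S - D / 2 - c|.

(** A decrease of [D] moves the argument of the penalty by half as much; with
    [v <= 1] at least half of the decrease remains. *)
Lemma potential_move v c D D' S delta : 0 <= v <= 1 -> D' <= D ->
  potential v c D' (S + delta) <=
  potential v c D S + (D' - D) / 2 + v * `|delta|.
Proof.
move=> /andP[v0 v1] DD; rewrite /potential.
have : `|S + delta - D' / 2 - c| <= `|S - D / 2 - c| + (D - D') / 2 + `|delta|.
  rewrite (_ : S + delta - D' / 2 - c = S - D / 2 - c + (D - D') / 2 + delta); last by field.
  apply: (le_trans (ler_normD _ _)); rewrite lerD2r.
  apply: (le_trans (ler_normD _ _)); rewrite lerD2l.
  by rewrite ger0_norm//; lra.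
move=> /(ler_wpM2l v0); rewrite !mulrDr => h.
suff : v * ((D - D') / 2) <= (D - D') / 2 by lra.
by rewrite ler_piMl//; lra.
Qed.

Lemma potential_le v c D D' S : 0 <= v <= 1 -> D' <= D ->
  potential v c D' S <= potential v c D S.
Proof.
move=> v01 DD; have := potential_move c S 0 v01 DD.
rewrite addr0 normr0 mulr0 addr0 => /le_trans; apply.
by rewrite gerDl; lra.
Qed.

(** To the left of the kink the penalty is affine, so that the drift of [S] is
    transmitted exactly; likewise to the right in [potential_large]. *)
Lemma potential_small v c D S delta : S - D / 2 <= c -> S - D / 2 + delta <= c ->
  potential v c D (S + delta) = potential v c D S - v * delta.
Proof. by move=> h1 h2; rewrite /potential !ler0_norm; [ring|lra|lra]. Qed.

Lemma potential_large v c D S delta : c <= S - D / 2 -> c <= S - D / 2 + delta ->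
  potential v c D (S + delta) = potential v c D S + v * delta.
Proof. by move=> h1 h2; rewrite /potential !ger0_norm; [ring|lra|lra]. Qed.

End potential.

Lemma expR_le_quadratic (R : realType) (x : R) : x <= 1 / 2 ->
  expR x <= 1 + x + 2 * x ^+ 2.
Proof.
move=> x2; have x1 : 0 < 1 - x by lra.
have : expR x <= (1 - x)^-1.
  rewrite -[expR x]invrK -expRN lef_pV2 ?posrE ?expR_gt0//.
  exact: expR_ge1Dx.
move=> /le_trans; apply; rewrite -[_^-1]mul1r ler_pdivrMr//.
by have := sqr_ge0 x; nra.
Qed.

(** Chernoff's method: for a small exponent the quadratic bound of the
    exponential turns a bound on the mean into one on the exponential moment. *)
Lemma integral_expR_le dT (T : measurableType dT) (R : realType)
    (mu : probability T R) (h : T -> R) (a b eta C lam : R) :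
  measurable_fun setT h -> (forall x, 0 <= h x <= 1) ->
  (\int[mu]_x (h x)%:E = eta%:E)%E -> `|a| + `|b| <= C ->
  0 <= lam -> lam * C <= 1 / 2 ->
  (\int[mu]_x (expR (lam * (a + b * h x)))%:E <=
   (expR (lam * (a + b * eta) + 2 * (lam * C) ^+ 2))%:E)%E.
Proof.
move=> mh h01 heta abC lam0 lamC.
have C0 : 0 <= C by rewrite (le_trans _ abC)// addr_ge0.
(* [k] is the quadratic bound with its last term at its largest value, which
   leaves an affine function of [h x]. *)
pose k0 := 1 + lam * a + 2 * (lam * C) ^+ 2; pose k1 := lam * b.
pose k (x : T) := k0 + k1 * h x.
have kE x : k x = 1 + lam * (a + b * h x) + 2 * (lam * C) ^+ 2 by rewrite /k /k0 /k1; ring.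
have ptw x : expR (lam * (a + b * h x)) <= k x.
  have /andP[h0 h1] := h01 x.
  have ab : `|a + b * h x| <= C.
    apply: le_trans abC; apply: (le_trans (ler_normD _ _)); rewrite lerD2l.
    by rewrite normrM (ger0_norm h0) ler_piMr.
  have lab : `|lam * (a + b * h x)| <= lam * C by rewrite normrM ger0_norm// ler_wpM2l.
  have h2 : lam * (a + b * h x) <= 1 / 2.
    by rewrite (le_trans (ler_norm _))// (le_trans lab).
  rewrite kE (le_trans (expR_le_quadratic h2))// lerD2l ler_pM2l//.
  by rewrite -real_normK ?num_real// ler_sqr ?nnegrE// mulr_ge0.
have mk : measurable_fun setT k by apply: measurable_funD => //; exact: measurable_funM.
have mexp : measurable_fun setT (fun x => expR (lam * (a + b * h x))).
  apply: measurableT_comp => //; apply: measurable_funM => //.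
  by apply: measurable_funD => //; exact: measurable_funM.
have inth : mu.-integrable setT (EFin \o h).
  apply/integrableP; split; first exact/measurable_EFinP.
  rewrite (eq_integral (EFin \o h)) ?heta ?ltry// => x _ /=.
  by rewrite ger0_norm//; have /andP[] := h01 x.
apply: (@le_trans _ _ (\int[mu]_x (k x)%:E)%E).
  apply: ge0_le_integral => //.
  - exact/measurable_EFinP.
  - exact/measurable_EFinP.
  - by move=> x _; rewrite lee_fin.
rewrite /k; under eq_integral do rewrite EFinD EFinM.
rewrite integralD//; last 2 first.
- exact: finite_measure_integrable_cst.
- exact: integrableZl.
rewrite (integral_cst mu measurableT k0%:E)/= probability_setT mule1.
rewrite integralZl// heta -EFinM -EFinD lee_fin.
have -> : k0 + k1 * eta =
  1 + (lam * (a + b * eta) + 2 * (lam * C) ^+ 2) by rewrite /k0 /k1; ring.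
exact: expR_ge1Dx.
Qed.

Section drift.
Context {R : realType} {d : nat}.
Variables (L U : R) (f : 'rV[R]_d -> R).
Hypotheses (A1 : assumption_A1 L U f).
Variables (aup adown : R).
Hypotheses (aup1 : 1 < aup) (adown01 : 0 < adown < 1).
Local Notation gauss := (std_gauss R d).
Local Notation p := (p_target aup adown).
Local Notation Lam := (ln (aup / adown)).

Lemma Lam_gt0 : 0 < Lam.
Proof.
have /andP[a0 a1] := adown01; rewrite ln_gt0// ltr_pdivlMr// mul1r.
exact: lt_trans aup1.
Qed.

Lemma LamE : Lam = ln aup - ln adown.
Proof.
have /andP[a0 a1] := adown01.
by rewrite ln_div ?posrE// (lt_trans ltr01).
Qed.

(** The definition of [p_target]: [ln sigma] has mean increment zero exactly when
    the success probability is [p_target], since it moves by [(1 - p) * Lam] with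
    probability [p] and by [- p * Lam] otherwise. *)
Lemma ln_adownE : ln adown = - (p * Lam).
Proof.
have /andP[a0 a1] := adown01.
rewrite /p_target divfK ?gt_eqF ?Lam_gt0//.
by rewrite div1r lnV ?posrE// opprK.
Qed.

Lemma ln_aupE : ln aup = (1 - p) * Lam.
Proof. by have := LamE; rewrite ln_adownE; lra. Qed.

Definition next (m : 'rV[R]_d) (s : R) (z : d.-tuple R) : state R d :=
  if f (m + expR s *: rvec z) <= f m then (m + expR s *: rvec z, s + ln aup)
  else (m, s + ln adown).

(** At the minimum of [f] the potential tends to [-oo], hence the value [0], which
    [expR] of a potential with [ln 0 = 0] would miss. *)
Definition exp_potential (lam v c y S : R) : R :=
  if y == 0 then 0 else expR (lam * potential v c (ln y) S).

Lemma measurable_exp_potential dT (T : measurableType dT) (lam v c : R)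
    (y S : T -> R) : measurable_fun setT y -> measurable_fun setT S ->
  measurable_fun setT (fun t => exp_potential lam v c (y t) (S t)).
Proof.
move=> my mS; have mln : measurable_fun setT (fun t => ln (y t)).
  exact: measurableT_comp.
apply: measurable_fun_ifT => //; first exact: measurable_fun_eqr.
apply: measurableT_comp => //; apply: measurable_funM => //.
apply: measurable_funD => //; apply: measurable_funM => //.
apply: measurableT_comp => //; apply: measurable_funB => //.
by apply: measurable_funB => //; exact: measurable_funM.
Qed.

Definition lyapunov (lam v c : R) (theta : state R d) : R :=
  exp_potential lam v c (f theta.1) theta.2.

Lemma lyapunov_ge0 lam v c theta : 0 <= lyapunov lam v c theta.
Proof. by rewrite /lyapunov /exp_potential; case: ifP => // _; exact: expR_ge0. Qed.

Lemma measurable_lyapunov_next lam v c m s :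
  measurable_fun setT (fun z => lyapunov lam v c (next m s z)).
Proof.
have mf := measurable_step A1 m s.
apply: (eq_measurable_fun (fun z => if f (m + expR s *: rvec z) <= f m
    then exp_potential lam v c (f (m + expR s *: rvec z)) (s + ln aup)
    else lyapunov lam v c (m, s + ln adown))).
  by move=> z _; rewrite /next; case: ifP.
apply: measurable_fun_ifT => //; first exact: measurable_fun_ler.
exact: measurable_exp_potential.
Qed.

(** The increment of the potential is dominated by a random variable bounded by
    [C] and of mean at most [- r].  This variable is affine in some [h] with
    values in [`[0, 1]], because in each regime only one quantity has to be
    integrated: the indicator of success or the relative decrease of [f].
    Reaching the minimum is left out, as it only helps. *)
Definition drift_certificate (v c C r : R) (m : 'rV[R]_d) (s : R) : Prop :=
  exists a b eta : R, exists h : d.-tuple R -> R,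
  [/\ measurable_fun setT h /\ (forall z, 0 <= h z <= 1),
      (\int[gauss]_z (h z)%:E = eta%:E)%E,
      `|a| + `|b| <= C, a + b * eta <= - r
    & forall z, f (next m s z).1 != 0 ->
      potential v c (ln (f (next m s z).1)) (next m s z).2 <=
      potential v c (ln (f m)) s + (a + b * h z)].

(** For a small [lam] the linear gain [lam * r] dominates the quadratic error. *)
Lemma lyapunov_drift (v c C r lam : R) (m : 'rV[R]_d) (s : R) :
  m != 0 -> drift_certificate v c C r m s ->
  0 <= lam -> lam * C <= 1 / 2 ->
  (\int[gauss]_z (lyapunov lam v c (next m s z))%:E <=
   (expR (- (lam * r) + 2 * (lam * C) ^+ 2) * lyapunov lam v c (m, s))%:E)%E.
Proof.
move=> m0 [a [b [eta [h [[mh h01] heta abC abr step]]]]] lam0 lamC.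
have fm : f m != 0 by rewrite (f_eq0 A1).
have mexp : measurable_fun setT (fun z => expR (lam * (a + b * h z))).
  apply: measurableT_comp => //; apply: measurable_funM => //.
  by apply: measurable_funD => //; exact: measurable_funM.
have W0 := lyapunov_ge0 lam v c (m, s).
apply: (@le_trans _ _ (\int[gauss]_z
    ((lyapunov lam v c (m, s)) * expR (lam * (a + b * h z)))%:E)%E).
  apply: ge0_le_integral => //.
  - by move=> z _; rewrite lee_fin lyapunov_ge0.
  - by apply/measurable_EFinP; exact: measurable_lyapunov_next.
  - exact/measurable_EFinP/measurable_funM.
  move=> z _; rewrite lee_fin {1}/lyapunov {1}/exp_potential; case: ifPn => [_|fz].
    by rewrite mulr_ge0// expR_ge0.
  rewrite /lyapunov /exp_potential/= (negbTE fm) -expRD ler_expR -mulrDr ler_wpM2l//.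
  exact: step.
rewrite ge0_integralZl_real//.
rewrite mulrC EFinM lee_wpmul2l ?lee_fin//.
apply: le_trans (integral_expR_le mh h01 heta abC lam0 lamC) _.
rewrite lee_fin ler_expR lerD2r -mulrN ler_wpM2l//.
Qed.

Lemma next_level m s z : f (next m s z).1 <= f m.
Proof. by rewrite /next; case: ifP. Qed.

Let ln_next (m : 'rV[R]_d) (s : R) z : m != 0 -> f (next m s z).1 != 0 ->
  ln (f (next m s z).1) <= ln (f m).
Proof.
move=> m0 fz; rewrite ler_ln ?posrE ?next_level//.
  by rewrite lt_neqAle eq_sym fz (f_ge0 A1).
by rewrite (f_gt0 A1).
Qed.

Let integral_success m s :
  (\int[gauss]_z (\1_(success f m s) z)%:E = (psucc f m s)%:E)%E.
Proof.
have mS := measurable_success A1 m s.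
by rewrite integral_indic ?setIT//; exact: (psuccE A1 m s).
Qed.

Let success01 m s z : 0 <= (\1_(success f m s) z : R) <= 1.
Proof. by rewrite indicE ler0n lern1 leq_b1. Qed.

Let measurable_success_indic m s :
  measurable_fun setT (\1_(success f m s) : _ -> R).
Proof. by apply: measurable_indic; have := measurable_success A1 m s. Qed.

Hypothesis p01 : 0 < p < 1.

(** With a step size so small that one increase does not cross the kink, the
    potential decreases as [S] increases, and [S] grows on average because
    successes are more frequent than [p]. *)
Lemma drift_small (v c q : R) (m : 'rV[R]_d) (s : R) : m != 0 -> 0 <= v <= 1 ->
  s - ln (f m) / 2 + ln aup <= c -> q <= psucc f m s ->
  drift_certificate v c (1 + 2 * Lam) (v * Lam * (q - p)) m s.
Proof.
move=> m0 v01 small qs; have [v0 v1] := andP v01; have [p0 p1] := andP p01.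
have Lam0 := Lam_gt0.
(* On success [S] moves by [(1 - p) * Lam] and otherwise by [- p * Lam]. *)
exists (v * p * Lam), (- (v * Lam)), (psucc f m s), (\1_(success f m s)).
split=> //.
- rewrite normrN (ger0_norm (mulr_ge0 (mulr_ge0 v0 (ltW p0)) (ltW Lam0))).
  rewrite (ger0_norm (mulr_ge0 v0 (ltW Lam0))).
  have vp1 : v * p <= 1 := le_trans (ler_piMl (ltW p0) v1) (ltW p1).
  have : v * p * Lam <= Lam by rewrite ler_piMl ?(ltW Lam0).
  by have : v * Lam <= Lam by [rewrite ler_piMl ?(ltW Lam0)]; lra.
- have : 0 <= v * Lam * (psucc f m s - q) by rewrite !mulr_ge0 ?subr_ge0// ltW.
  by lra.
move=> z fz; apply: le_trans (potential_le c _ v01 (ln_next m0 fz)) _.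
have aup0 : 0 < ln aup by rewrite ln_gt0.
have adown0 : ln adown < 0 by rewrite ln_adownE oppr_lt0 mulr_gt0.
rewrite /next indicE; case: ifPn => fz' /=.
  rewrite mem_set//= potential_small; [|lra|lra].
  by rewrite mulr1 ln_aupE; lra.
rewrite memNset/=; last exact/negP.
rewrite potential_small; [|lra|lra].
by rewrite mulr0 ln_adownE; lra.
Qed.

(** The mirror image of [drift_small]: one decrease of the step size does not
    cross the kink, and successes are rarer than [p]. *)
Lemma drift_large (v c q : R) (m : 'rV[R]_d) (s : R) : m != 0 -> 0 <= v <= 1 ->
  c <= s - ln (f m) / 2 + ln adown -> psucc f m s <= q ->
  drift_certificate v c (1 + 2 * Lam) (v * Lam * (p - q)) m s.
Proof.
move=> m0 v01 large qs; have [v0 v1] := andP v01; have [p0 p1] := andP p01.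
have Lam0 := Lam_gt0.
exists (- (v * p * Lam)), (v * Lam), (psucc f m s), (\1_(success f m s)).
split=> //.
- rewrite normrN (ger0_norm (mulr_ge0 (mulr_ge0 v0 (ltW p0)) (ltW Lam0))).
  rewrite (ger0_norm (mulr_ge0 v0 (ltW Lam0))).
  have vp1 : v * p <= 1 := le_trans (ler_piMl (ltW p0) v1) (ltW p1).
  have : v * p * Lam <= Lam by rewrite ler_piMl ?(ltW Lam0).
  by have : v * Lam <= Lam by [rewrite ler_piMl ?(ltW Lam0)]; lra.
- have : 0 <= v * Lam * (q - psucc f m s) by rewrite !mulr_ge0 ?subr_ge0// ltW.
  by lra.
move=> z fz; apply: le_trans (potential_le c _ v01 (ln_next m0 fz)) _.
have aup0 : 0 < ln aup by rewrite ln_gt0.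
have adown0 : ln adown < 0 by rewrite ln_adownE oppr_lt0 mulr_gt0.
rewrite /next indicE; case: ifPn => fz' /=.
  rewrite mem_set//= potential_large; [|lra|lra].
  by rewrite mulr1 ln_aupE; lra.
rewrite memNset/=; last exact/negP.
rewrite potential_large; [|lra|lra].
by rewrite mulr0 ln_adownE; lra.
Qed.

(** Half of the expected relative decrease of [f] survives [potential_move]; the
    move of the step size costs at most [v * Lam]. *)
Lemma drift_middle (v c : R) (m : 'rV[R]_d) (s : R) : m != 0 -> 0 <= v <= 1 ->
  drift_certificate v c (1 + 2 * Lam)
    (mean_decrease f m s / f m / 2 - v * Lam) m s.
Proof.
move=> m0 v01; have [v0 v1] := andP v01; have [p0 p1] := andP p01.
have Lam0 := Lam_gt0; have fm : 0 < f m by rewrite (f_gt0 A1).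
exists (v * Lam), (- (1 / 2)), (mean_decrease f m s / f m),
  (fun z => (f m)^-1 * decrease f m s z).
split=> //.
- split; first by apply: measurable_funM => //; exact: (measurable_decrease A1).
  move=> z; rewrite mulr_ge0 ?invr_ge0 ?(ltW fm) ?decrease_ge0//=.
  by rewrite mulrC ler_pdivrMr// mul1r (decrease_le A1).
- rewrite ge0_integralZl_real ?(integral_decrease A1).
  + by rewrite -EFinM mulrC.
  + exact: (measurable_decrease A1).
  + by move=> z; exact: decrease_ge0.
  + by rewrite invr_ge0 ltW.
- rewrite normrN !ger0_norm ?mulr_ge0 ?(ltW Lam0)//.
  by have : v * Lam <= Lam by [rewrite ler_piMl ?(ltW Lam0)]; lra.
- lra.
move=> z fz.
have fz0 : 0 < f (next m s z).1 by rewrite lt_neqAle eq_sym fz (f_ge0 A1).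
have := ln_next m0 fz.
(* [ln x <= x - 1]: the logarithm decreases at least as much as [f] does
   relatively to [f m]. *)
have lnle : ln (f (next m s z).1) - ln (f m) <= - ((f m)^-1 * decrease f m s z).
  rewrite -ln_div ?posrE//.
  apply: (@le_trans _ _ (f (next m s z).1 / f m - 1)).
    have := expR_ge1Dx (ln (f (next m s z).1 / f m)).
    by rewrite lnK ?posrE ?divr_gt0//; lra.
  have -> : f (next m s z).1 / f m - 1 =
    (f m)^-1 * (f (next m s z).1 - f m) by field; rewrite gt_eqF.
  rewrite -mulrN ler_wpM2l ?invr_ge0 ?(ltW fm)// lerNr opprB /decrease /next.
  case: ifPn => [le|/=]; first by rewrite max_r ?subr_ge0.
  by rewrite -ltNge => lt; rewrite max_l ?subrr// subr_le0 ltW.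
move: fz fz0 lnle; rewrite /next; case: ifPn => fz' /= fz fz0 lnle lele.
  apply: le_trans (potential_move c s (ln aup) v01 lele) _.
  have : v * `|ln aup| <= v * Lam.
    by rewrite ler_wpM2l// ger0_norm ?ln_ge0 ?(ltW aup1)// ln_aupE ler_piMl ?(ltW Lam0)//; lra.
  lra.
apply: le_trans (potential_move c s (ln adown) v01 lele) _.
have : v * `|ln adown| <= v * Lam.
  rewrite ler_wpM2l// ln_adownE normrN (ger0_norm (mulr_ge0 (ltW p0) (ltW Lam0))).
  by rewrite ler_piMl ?(ltW Lam0) ?(ltW p1).
lra.
Qed.

End drift.

(** * Drift of the potential in every state *)

Section quantities.
Context {R : realType} {d : nat}.
Variables (L U : R) (f : 'rV[R]_d -> R).
Hypotheses (d0 : (0 < d)%N) (L0 : 0 < L) (A1 : assumption_A1 L U f).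
Local Notation k := (kappa_inf f).
Local Notation K := (kappa_inf f * Num.sqrt (2 / pi)).

Lemma Theta0_neq0 : @Theta0 R d !=set0.
Proof.
exists (const_mx 1, 0); rewrite /Theta0/=; apply/eqP => /rowP/(_ (Ordinal d0)).
by rewrite !mxE => /eqP; rewrite oner_eq0.
Qed.

Lemma E_Qz_bounds (theta : state R d) : theta.1 != 0 ->
  0 < E_Qz f theta <= E_Q f.
Proof.
case: theta => m s /= m0; rewrite (E_Qz_gt0 L0 A1 _ m0)/=.
apply: ub_le_sup; last by exists (m, s).
by exists (`|U| * @mean_nrm2 R d) => _ [[m' s'] /= m'0 <-]; exact: (E_Qz_le L0 A1).
Qed.

Lemma E_Q_gt0 : 0 < E_Q f.
Proof.
have [theta th0] := Theta0_neq0.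
by have /andP[/lt_le_trans + h] := E_Qz_bounds th0; apply.
Qed.

Lemma kappa_inf_ge1 : 1 <= k.
Proof.
apply: lb_le_inf.
  by have [theta th0] := Theta0_neq0; eexists; exists theta.
move=> _ [[m s] /= m0 <-].
have [_ /andP[n0 nE]] := integral_Qz_neg L0 A1 s m0.
by rewrite ler_pdivlMr// mul1r.
Qed.

Lemma E_Qz_neg_le (m : 'rV[R]_d) (s : R) : m != 0 ->
  E_Qz_neg f (m, s) <= E_Qz f (m, s) / k.
Proof.
move=> m0; have k1 := kappa_inf_ge1.
have [_ /andP[n0 nE]] := integral_Qz_neg L0 A1 s m0.
rewrite ler_pdivlMr; last exact: lt_le_trans k1.
rewrite -ler_pdivlMl// mulrC; apply: ge_inf; last by exists (m, s).
exists 0 => _ [[m' s'] /= m'0 <-].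
have [_ /andP[n'0 n'E]] := integral_Qz_neg L0 A1 s' m'0.
by rewrite divr_ge0// ?ltW// (lt_le_trans n'0).
Qed.

Lemma B_high_inf_le theta q : 0 < q < 1 / 2 -> theta.1 != 0 ->
  B_high_inf f q <= B_high f theta q.
Proof.
move=> q02 th0; apply: ge_inf; last by exists theta.
by exists 0 => _ [t _ <-]; exact: B_high_ge0.
Qed.

(** [q] is larger than every point where the comparison with [K] fails, so it is
    not one of them. *)
Lemma I_q_low_dom q : I_q f q -> low_dom f q /\ (B_low_sup f q < K%:E)%E.
Proof.
move=> [q02]; rewrite gt_max => /andP[Vq supq].
have dom : low_dom f q.
  split=> // theta th0; rewrite -lte_fin; apply: le_lt_trans Vq.
  by apply: ereal_sup_ubound; exists theta.
split=> //; rewrite ltNge; apply/negP => Kq.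
have : (q%:E < q%:E)%E.
  by apply: le_lt_trans supq; apply: ereal_sup_ubound; exists q.
by rewrite ltxx.
Qed.

Lemma B_low_sup_fin q : I_q f q -> B_low_sup f q = (fine (B_low_sup f q))%:E.
Proof.
move=> Iq; have [[q02 Vq] Kq] := I_q_low_dom Iq; rewrite fineK//.
rewrite fin_numE; apply/andP; split; last by rewrite lt_eqF// (lt_trans Kq) ?ltry.
have [theta th0] := Theta0_neq0.
rewrite gt_eqF// (@lt_le_trans _ _ (B_low f theta q)%:E) ?ltNyr//.
by apply: ereal_sup_ubound; exists theta.
Qed.

Lemma B_low_le_sup theta q : I_q f q -> theta.1 != 0 ->
  B_low f theta q <= fine (B_low_sup f q).
Proof.
move=> Iq th0; rewrite -lee_fin -(B_low_sup_fin Iq).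
by apply: ereal_sup_ubound; exists theta.
Qed.

(** [f_le_grad] bounds the norm of the gradient from below. *)
Lemma sigma_hat_le (m : 'rV[R]_d) (s : R) : m != 0 ->
  sigma_hat f m s <= expR s / Num.sqrt (f m) * (E_Q f / Num.sqrt (2 * L)).
Proof.
move=> m0; have /andP[E0 EE] := @E_Qz_bounds (m, s) m0.
have N0 := grad_neq0 L0 A1 m0.
have fm : 0 < f m by rewrite (f_gt0 A1).
have sq : 0 < Num.sqrt (f m) by rewrite sqrtr_gt0.
have sL : 0 < Num.sqrt (2 * L) by rewrite sqrtr_gt0 mulr_gt0.
have NL : Num.sqrt (f m) * Num.sqrt (2 * L) <= enorm (grad f m).
  rewrite -sqrtrM ?(ltW fm)// mulrC -[leRHS]ger0_norm ?enorm_ge0// -sqrtr_sqr.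
  by rewrite ler_sqrt ?sqr_ge0// (f_le_grad L0 A1).
rewrite /sigma_hat mulf_div; apply: ler_pM.
- by rewrite mulr_ge0 ?expR_ge0// ltW.
- by rewrite invr_ge0 ltW.
- by rewrite ler_wpM2l ?expR_ge0.
- by rewrite lef_pV2 ?posrE ?mulr_gt0.
Qed.

End quantities.

Section drift_everywhere.
Context {R : realType} {d : nat}.
Variables (L U : R) (f : 'rV[R]_d -> R).
Hypotheses (d0 : (0 < d)%N) (L0 : 0 < L) (A1 : assumption_A1 L U f).
Variables (aup adown : R).
Hypotheses (aup1 : 1 < aup) (adown01 : 0 < adown < 1).
Local Notation p := (p_target aup adown).
Local Notation Lam := (ln (aup / adown)).
Local Notation k := (kappa_inf f).
Variables (ql qh : R).
Hypotheses (Iql : I_q f ql) (Iqh : I_q_high aup adown f ql qh).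
Hypothesis qpq : ql < p < qh.
Local Notation ell := (B_high_inf f qh).
Local Notation u := (fine (B_low_sup f ql)).
Local Notation w := (w_rate L f ql qh).
Hypotheses (ell_gt0 : 0 < ell) (Q0 : 0 <= Q_inf f ql).

Let Lam0 : 0 < Lam. Proof. exact: Lam_gt0. Qed.

Let k0 : 0 < k.
Proof. by apply: lt_le_trans (kappa_inf_ge1 d0 L0 A1). Qed.

Let uK : u < Num.sqrt (2 / pi) * k.
Proof.
by rewrite mulrC -lte_fin -(B_low_sup_fin d0 Iql); have [_] := I_q_low_dom Iql.
Qed.

Lemma Q_inf_le : Q_inf f ql <= 1 / 2.
Proof.
rewrite /Q_inf; set S := [set q | _].
have [->|/set0P[q Sq]] := eqVneq S set0; first by rewrite inf0; lra.
apply: (@le_trans _ _ q); last by case: Sq => /andP[_ /ltW].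
apply: ge_inf => //; exists 0 => t [/andP[t0 _] _]; exact: ltW.
Qed.

(** The lower bound of [mean_decrease_rel_ge] at the smallest relative step size
    of the middle regime; [w_rate] is this quantity times [Q_inf <= 1 / 2]. *)
Definition w_middle : R :=
  L / E_Q f * (ell / k) * (Num.sqrt (2 / pi) * k - u).

Let w_middle_ge0 : 0 <= w_middle.
Proof.
rewrite /w_middle mulr_ge0 ?subr_ge0 ?(ltW uK)//.
by rewrite mulr_ge0 ?divr_ge0 ?(ltW L0) ?(ltW (E_Q_gt0 d0 L0 A1)) ?(ltW ell_gt0) ?(ltW k0).
Qed.

Lemma w_rateE : w = w_middle * Q_inf f ql. Proof. by []. Qed.

(** At this slope the drift towards the kink, [penalty_slope * Lam] times a gap of
    probabilities, is at least [rate].  In the middle regime the moves of the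
    step size cost at most [penalty_slope * Lam <= w / 4], and half of the
    decrease of [f] is at least [w]. *)
Definition penalty_slope : R := Num.min (w / 4) Lam / Lam.

(** With [s1 = ell * sqrt (2 * L) / E_Q], a relative step size below [s1] forces
    [sigma_hat < ell].  The factor [aup] lets the step size grow once from there
    without crossing the kink. *)
Definition kink : R := ln aup + ln (ell * Num.sqrt (2 * L) / E_Q f).

Definition rate : R := Num.min (w / 4) Lam * Num.min (p - ql) (qh - p).

Lemma drift_certificate_le v c C r r' (m : 'rV[R]_d) s : r <= r' ->
  drift_certificate f aup adown v c C r' m s ->
  drift_certificate f aup adown v c C r m s.
Proof.
move=> rr [a [b [eta [h [h1 h2 h3 h4 h5]]]]]; exists a, b, eta, h; split => //.
by apply: le_trans h4 _; rewrite lerN2.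
Qed.

(** Either the relative step size is below [s1] and successes have probability at
    least [qh], or [sigma_hat <= u] and [f] decreases in expectation, or
    [sigma_hat > u] and successes have probability at most [ql].  In the last
    case [I_q_high] provides a gap of a factor [aup / adown] between the
    thresholds, so that the step size is more than one decrease to the right of
    the kink. *)
Lemma drift_everywhere (m : 'rV[R]_d) s : m != 0 ->
  drift_certificate f aup adown penalty_slope kink (1 + 2 * Lam) rate m s.
Proof.
move=> m0; have [ql02 _] := Iql; have [qh02 qhsup] := Iqh.
have /andP[ql0 ql2] := ql02; have /andP[qh0 qh2] := qh02.
have /andP[qlp pqh] := qpq; have [[_ Vql] _] := I_q_low_dom Iql.
have p01 : 0 < p < 1 by apply/andP; split; lra.
have w0 : 0 <= w by rewrite w_rateE mulr_ge0.
have min0 : 0 <= Num.min (w / 4) Lam by rewrite le_min divr_ge0//= ltW.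
have v01 : 0 <= penalty_slope <= 1.
  by rewrite divr_ge0 ?(ltW Lam0)//= ler_pdivrMr// mul1r ge_min lexx orbT.
have vLam : penalty_slope * Lam = Num.min (w / 4) Lam by rewrite divfK// gt_eqF.
have fm : 0 < f m by rewrite (f_gt0 A1).
have EQ0 := E_Q_gt0 d0 L0 A1.
have sL : 0 < Num.sqrt (2 * L) by rewrite sqrtr_gt0 mulr_gt0.
pose s1 := ell * Num.sqrt (2 * L) / E_Q f.
have s10 : 0 < s1 by rewrite divr_gt0// mulr_gt0.
pose es := expR s / Num.sqrt (f m).
have es0 : 0 < es by rewrite divr_gt0 ?expR_gt0// sqrtr_gt0.
have lnes : ln es = s - ln (f m) / 2.
  rewrite ln_div ?posrE ?expR_gt0 ?sqrtr_gt0// expRK; congr (_ - _).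
  have : ln (Num.sqrt (f m)) *+ 2 = ln (f m).
    by rewrite -lnXn ?sqrtr_gt0// sqr_sqrtr// ltW.
  by lra.
have shat := sigma_hat_le L0 A1 s m0; rewrite -/es in shat.
have rc : Num.min (p - ql) (qh - p) <= 1 / 2 by rewrite ge_min; apply/orP; left; lra.
(* [es] is the step size relative to [Num.sqrt (f m)]. *)
have [small|large] := ltP es s1.
  apply: (@drift_certificate_le _ _ _ _ (penalty_slope * Lam * (qh - p))).
    by rewrite vLam /rate ler_wpM2l// ge_min lexx orbT.
  apply: (drift_small A1 aup1 adown01 p01 m0 v01).
    rewrite -lnes /kink addrC lerD2l -/s1 ler_ln ?posrE//; exact: ltW.
  apply: (psucc_ge_of_small L0 A1 m0 qh02).
  apply: (lt_le_trans _ (@B_high_inf_le R d f (m, s) qh qh02 m0)).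
  apply: le_lt_trans shat _.
  by rewrite -ltr_pdivlMr ?divr_gt0// invf_div mulrA.
have [mid|big] := leP (sigma_hat f m s) u.
  apply: (drift_certificate_le _ (drift_middle A1 aup1 adown01 p01 kink s m0 v01)).
  have := mean_decrease_rel_ge L0 A1 m0 k0 (E_Qz_neg_le d0 L0 A1 s m0) mid (ltW uK).
  have : w_middle <= es * Num.sqrt (2 * L) / (2 * k) * (Num.sqrt (2 / pi) * k - u).
    rewrite /w_middle ler_wpM2r ?subr_ge0 ?(ltW uK)//.
    apply: (@le_trans _ _ (s1 * Num.sqrt (2 * L) / (2 * k))).
      rewrite /s1 le_eqVlt; apply/orP; left; apply/eqP.
      have -> : ell * Num.sqrt (2 * L) / E_Q f * Num.sqrt (2 * L) / (2 * k) =
        ell * Num.sqrt (2 * L) ^+ 2 / E_Q f / (2 * k) by ring.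
      by rewrite sqr_sqrtr ?mulr_ge0 ?(ltW L0)//; field; rewrite !gt_eqF.
    by rewrite ler_wpM2r ?invr_ge0 ?mulr_ge0 ?(ltW k0)// ler_wpM2r// ltW.
  rewrite -/es vLam /rate.
  have minw : Num.min (w / 4) Lam <= w / 4 by rewrite ge_min lexx.
  have ww : w <= w_middle / 2.
    by rewrite w_rateE ler_wpM2l//; have := Q_inf_le; rewrite mul1r.
  have : Num.min (w / 4) Lam * Num.min (p - ql) (qh - p) <= Num.min (w / 4) Lam * (1 / 2).
    by rewrite ler_wpM2l.
  lra.
apply: (@drift_certificate_le _ _ _ _ (penalty_slope * Lam * (p - ql))).
  by rewrite vLam /rate ler_wpM2l// ge_min lexx.
have lowbig : B_low f (m, s) ql < sigma_hat f m s.
  by apply: le_lt_trans big; apply: B_low_le_sup.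
apply: (drift_large A1 aup1 adown01 p01 m0 v01); last first.
  by apply: (psucc_le_of_large L0 A1 m0 ql02) => //; exact: Vql.
have /andP[ad0 ad1] := adown01.
(* Otherwise [qh] would belong to a set of which it exceeds the supremum. *)
have gap : aup / adown * ell < sigma_hat f m s.
  apply: le_lt_trans lowbig.
  apply: (@le_trans _ _ (aup / adown * B_high f (m, s) qh)).
    apply: ler_wpM2l; last exact: (@B_high_inf_le R d f (m, s)).
    by rewrite divr_ge0// ltW// (lt_trans ltr01).
  rewrite leNgt; apply/negP => lt_low.
  have : (qh%:E < qh%:E)%E.
    apply: le_lt_trans qhsup.
    apply: (@le_trans _ _ (ereal_sup [set r%:E | r in [set r | high_dom r /\
          (B_low f (m, s) ql <= aup / adown * B_high f (m, s) r)%R]])).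
      by apply: ereal_sup_ubound; exists qh => //; split => //; exact: ltW.
    by apply: ereal_sup_ubound; exists (m, s).
  by rewrite ltxx.
have aa0 : 0 < aup / adown by rewrite divr_gt0// (lt_trans ltr01).
have : ln (aup / adown * s1) <= ln es.
  rewrite ler_ln ?posrE//; last exact: mulr_gt0.
  have := ltW (lt_le_trans gap shat).
  rewrite -ler_pdivrMr ?divr_gt0// invf_div => /(le_trans _); apply.
  by rewrite le_eqVlt; apply/orP; left; apply/eqP; rewrite /s1; ring.
rewrite lnM ?posrE// lnes (LamE aup1 adown01) /kink -/s1.
lra.
Qed.

End drift_everywhere.

(** * Positivity of the rate *)

Section positivity.
Context {R : realType} {d : nat}.
Variables (L U : R) (f : 'rV[R]_d -> R).
Hypotheses (d0 : (0 < d)%N) (L0 : 0 < L) (A1 : assumption_A1 L U f)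
  (A2 : assumption_A2 f).
Variables (aup adown : R).
Hypotheses (aup1 : 1 < aup) (adown01 : 0 < adown < 1).
Local Notation p := (p_target aup adown).
Local Notation Lam := (ln (aup / adown)).
Local Notation k := (kappa_inf f).
Local Notation K := (kappa_inf f * Num.sqrt (2 / pi)).

Lemma V_sup_ge0 : (0 <= V_sup f)%E.
Proof.
have [theta th0] := @Theta0_neq0 R d d0.
apply: (@le_trans _ _ (V_std f theta)%:E); first by rewrite lee_fin V_ge0.
by apply: ereal_sup_ubound; exists theta.
Qed.

Lemma V_sup_fin : V_sup f = (fine (V_sup f))%:E.
Proof.
by rewrite fineK// ge0_fin_numE ?V_sup_ge0//; apply: lt_trans A2 _; exact: ltry.
Qed.

Lemma V_le_sup theta : theta.1 != 0 -> V_std f theta <= fine (V_sup f).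
Proof.
move=> th0; rewrite -lee_fin -V_sup_fin.
by apply: ereal_sup_ubound; exists theta.
Qed.

(** The variances are bounded, so that a single large [e] yields a positive lower
    bound for [B_high] in all states. *)
Lemma B_high_inf_gt0 q : 0 < q < 1 / 2 -> 0 < B_high_inf f q.
Proof.
move=> q02; have /andP[q0 q2] := q02; set vs := fine (V_sup f).
have vs0 : 0 <= vs by rewrite fine_ge0// V_sup_ge0.
have q21 : 0 < 1 - 2 * q by lra.
(* With [a <= e ^+ 2], [V / e ^+ 2] is at most half of the room between [q] and
   [1 / 2]. *)
pose a := 4 * vs / (1 - 2 * q).
have a0 : 0 <= a by apply: divr_ge0; [exact: mulr_ge0|exact: ltW].
pose e := Num.sqrt a + 1.
have e0 : 0 < e by rewrite ltr_wpDl// sqrtr_ge0.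
pose b := 2 * Phi_inv (1 - (1 + 2 * q) / 4) / (1 + e).
have b0 : 0 < b.
  rewrite /b; apply: divr_gt0; last exact: addr_gt0.
  by rewrite mulr_gt0//; apply: Phi_inv_gt0; apply/andP; split; lra.
apply: (lt_le_trans b0); apply: lb_le_inf.
  by have [theta th0] := @Theta0_neq0 R d d0; eexists; exists theta.
move=> _ [theta th0 <-].
have V0 := V_ge0 f theta; have Vvs := V_le_sup th0; rewrite -/vs in Vvs.
have Va : 2 * V_std f theta / (1 - 2 * q) <= a.
  by rewrite /a ler_wpM2r ?invr_ge0 ?(ltW q21)//; lra.
have range : Num.sqrt (2 * V_std f theta / (1 - 2 * q)) < e.
  by rewrite /e ltr_pwDr// ler_wsqrtr.
apply: le_trans (B_high_ge_elt q02 range).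
have [_ v0 v2] := high_range q02 range.
rewrite /b ler_wpM2r ?invr_ge0 ?addr_ge0 ?(ltW e0)// ler_pM2l//.
rewrite Phi_inv_le; [|apply/andP; split; lra..].
suff : V_std f theta / e ^+ 2 <= (1 - 2 * q) / 4 by lra.
rewrite ler_pdivrMr ?exprn_gt0//.
have ae : a <= e ^+ 2.
  rewrite -[leLHS](sqr_sqrtr a0) ler_sqr ?nnegrE ?sqrtr_ge0 ?(ltW e0)//.
  by rewrite lerDl.
have : 4 * vs <= (1 - 2 * q) * e ^+ 2.
  by move: ae; rewrite /a ler_pdivrMr// (mulrC (e ^+ 2)).
by lra.
Qed.

Lemma K_gt0 : 0 < K.
Proof.
rewrite mulr_gt0 ?sqrtr_gt0 ?divr_gt0 ?pi_gt0//.
by apply: lt_le_trans (kappa_inf_ge1 d0 L0 A1).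
Qed.

(** The second term of the minimum in [assumption_A2], since
    [kappa / 2 * 3 / sqrt (2 pi) = 3 / 4 * K]. *)
Lemma V_sup_lt_tail : 4 * fine (V_sup f) < 1 - Phi (3 / 4 * K).
Proof.
have sE : 3 / Num.sqrt (2 * pi) * (k / 2) = 3 / 4 * K :> R.
  have -> : Num.sqrt (2 / pi) = 2 / Num.sqrt (2 * pi) :> R.
    have := pi_gt0 R; move: (@pi R) => c c0.
    have s0 : 0 < Num.sqrt (2 * c) by rewrite sqrtr_gt0 mulr_gt0.
    rewrite -[RHS]ger0_norm ?divr_ge0 ?(ltW s0)// -sqrtr_sqr expr_div_n.
    by rewrite sqr_sqrtr ?mulr_ge0 ?(ltW c0)//; congr Num.sqrt; field; rewrite gt_eqF.
  have s0 : 0 < Num.sqrt (2 * pi) :> R by rewrite sqrtr_gt0 mulr_gt0 ?pi_gt0.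
  by move: s0; move: (Num.sqrt _) => c c0; field; rewrite gt_eqF.
have := A2; rewrite /assumption_A2 V_sup_fin lte_fin => A2r.
have : fine (V_sup f) < 1 / 4 * (1 - Phi (k / 2 * (3 / Num.sqrt (2 * pi)))).
  by apply: lt_le_trans A2r _; rewrite ler_pM2l// ge_min lexx orbT.
by rewrite (mulrC (k / 2)) sE; lra.
Qed.

Variable ql : R.
Hypothesis Iql : I_q f ql.

(** The choice [e = 1 / 2] in [B_high] gives [K <= B_high] as soon as
    [Phi (3 / 4 * K) < 1 - q - 4 * V], which [V_sup_lt_tail] ensures for all small
    [q]; and [B_low_sup f ql < K]. *)
Lemma Q_inf_gt0 : 0 < Q_inf f ql.
Proof.
have [[ql02 Vql] BK] := I_q_low_dom Iql; have /andP[ql0 ql2] := ql02.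
have tail := V_sup_lt_tail; set vs := fine (V_sup f) in tail.
have K0 := K_gt0.
pose q0 := 1 - Phi (3 / 4 * K) - 4 * vs.
have q0_gt0 : 0 < q0 by rewrite subr_gt0.
apply: (lt_le_trans q0_gt0); apply: lb_le_inf.
  (* The set is not empty, otherwise its infimum would be zero by convention: any
     [q] above [ql] belongs to it. *)
  exists ((ql + 1 / 2) / 2); have q02 : 0 < (ql + 1 / 2) / 2 < 1 / 2.
    by apply/andP; split; lra.
  split=> //; have [theta th0] := @Theta0_neq0 R d d0.
  apply: (@lt_le_trans _ _ (B_low f theta ql)%:E); last first.
    by apply: ereal_sup_ubound; exists theta.
  rewrite lte_fin; apply: le_lt_trans (@B_high_inf_le R d f theta _ q02 th0) _.
  apply: le_lt_trans (B_high_le f theta q02) _.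
  apply: lt_le_trans (B_low_ge ql02 (Vql _ th0)).
  rewrite ltr_pM2l// ltNge Phi_inv_le; [|apply/andP; split; lra..].
  by rewrite -ltNge; lra.
move=> q [q02 Bq]; have /andP[q_gt0 q_lt2] := q02.
rewrite leNgt; apply/negP => qq0.
have : K <= B_high_inf f q.
  apply: lb_le_inf.
    by have [theta th0] := @Theta0_neq0 R d d0; eexists; exists theta.
  move=> _ [theta th0 <-].
  have V0 := V_ge0 f theta; have Vvs := V_le_sup th0; rewrite -/vs in Vvs.
  have Phi34 : 1 / 2 < Phi (3 / 4 * K) by rewrite -Phi0 Phi_lt mulr_gt0.
  have range : Num.sqrt (2 * V_std f theta / (1 - 2 * q)) < 1 / 2.
    have -> : 1 / 2 = Num.sqrt (1 / 4) :> R.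
      rewrite (_ : 1 / 4 = (1 / 2) ^+ 2); last by field.
      by rewrite sqrtr_sqr ger0_norm.
    rewrite ltr_sqrt// ltr_pdivrMr; first by rewrite /q0 in qq0; lra.
    by lra.
  apply: le_trans (B_high_ge_elt q02 range).
  have -> : V_std f theta / (1 / 2) ^+ 2 = 4 * V_std f theta by field.
  rewrite ler_pdivlMr; last by lra.
  suff : 3 / 4 * K < Phi_inv (1 - (q + 4 * V_std f theta)) by lra.
  rewrite Phi_inv_ltP; last by rewrite /q0 in qq0; apply/andP; split; lra.
  by rewrite /q0 in qq0; lra.
rewrite leNgt => /negP; apply; rewrite -lte_fin; exact: lt_trans BK.
Qed.

Lemma w_rate_gt0 qh : 0 < qh < 1 / 2 -> 0 < w_rate L f ql qh.
Proof.
move=> qh02; have k0 : 0 < k by apply: lt_le_trans (kappa_inf_ge1 d0 L0 A1).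
rewrite /w_rate !mulr_gt0 ?invr_gt0 ?(E_Q_gt0 d0 L0 A1) ?B_high_inf_gt0 ?Q_inf_gt0//.
rewrite subr_gt0 mulrC -lte_fin -(B_low_sup_fin d0 Iql).
by have [_] := I_q_low_dom Iql.
Qed.

(** For [r] close to [1 / 2], [B_high r <= 2 * Phi_inv (1 - r)] is close to zero,
    whereas [B_low ql >= 2 * Phi_inv (1 - ql)] is bounded away from it. *)
Lemma I_q_high_nonempty q : q < 1 / 2 ->
  exists qh, I_q_high aup adown f ql qh /\ q < qh.
Proof.
move=> q2; have [[ql02 Vql] BK] := I_q_low_dom Iql; have /andP[ql0 ql2] := ql02.
have /andP[ad0 ad1] := adown01.
have rho0 : 0 < aup / adown by rewrite divr_gt0// (lt_trans ltr01).
(* [1 - Phi y] is the largest [r] at which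
   [aup / adown * (2 * Phi_inv (1 - r))] can reach [2 * Phi_inv (1 - ql)]. *)
pose y := Phi_inv (1 - ql) / (aup / adown).
have y0 : 0 < y.
  by rewrite divr_gt0//; apply: Phi_inv_gt0; apply/andP; split; lra.
have Phiy : 1 / 2 < Phi y by rewrite -Phi0 Phi_lt.
have Phiy1 := Phi_lt1 y.
pose qmax := Num.max q (1 - Phi y).
have qmax2 : qmax < 1 / 2 by rewrite gt_max q2/=; lra.
have [q_le y_le] : q <= qmax /\ 1 - Phi y <= qmax by rewrite !le_max !lexx orbT.
exists ((qmax + 1 / 2) / 2); split; last by lra.
split; first by apply/andP; split; lra.
apply: (@le_lt_trans _ _ (1 - Phi y)%:E); last by rewrite lte_fin; lra.
apply: ge_ereal_sup => _ [theta th0 <-]; apply: ge_ereal_sup => _ [r [/= r02 Br] <-].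
rewrite lee_fin; have /andP[r0 r2] := r02.
suff : Phi y <= 1 - r by lra.
rewrite leNgt -Phi_inv_gtP; last by apply/andP; split; lra.
apply/negP => lt_y.
have := B_low_ge ql02 (Vql _ th0); have := B_high_le f theta r02.
move=> /(ler_wpM2l (ltW rho0)) h1 /le_trans/(_ Br)/le_trans/(_ h1).
rewrite leNgt => /negP; apply.
by rewrite mulrCA ltr_pM2l// mulrC -ltr_pdivlMr.
Qed.

Lemma rate_le qh : 0 < qh < 1 / 2 -> ql < p < qh ->
  Num.min (w_rate L f ql qh / 4) Lam * Num.min (p - ql) (qh - p) <= Lam / 2.
Proof.
move=> /andP[qh0 qh2] /andP[qlp pqh]; have [[/andP[ql0 ql2] _] _] := I_q_low_dom Iql.
have Lam0 := Lam_gt0 aup1 adown01.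
apply: ler_pM.
- rewrite le_min (ltW Lam0) andbT divr_ge0// ltW// w_rate_gt0//.
  by apply/andP.
- by rewrite le_min !subr_ge0 !ltW.
- by rewrite ge_min lexx orbT.
- by rewrite ge_min; apply/orP; left; lra.
Qed.

Lemma rate_gt0 qh : 0 < qh < 1 / 2 -> ql < p < qh ->
  0 < Num.min (w_rate L f ql qh / 4) Lam * Num.min (p - ql) (qh - p).
Proof.
move=> qh02 /andP[qlp pqh]; rewrite mulr_gt0// lt_min.
  by rewrite divr_gt0 ?w_rate_gt0//= Lam_gt0.
by rewrite !subr_gt0 qlp.
Qed.

End positivity.

(** * The Markov chain of the states *)

Lemma std_gauss_hyperplane (R : realType) (d : nat) (a : 'rV[R]_d) (x : R) :
  enorm a = 1 -> std_gauss R d [set z | dotv a (rvec z) = x] = 0%E.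
Proof.
move=> a1; have := @std_gauss_linear R d a [set x].
rewrite a1 normal_prob_set1; apply => //; exact: oner_neq0.
Qed.

Section tuple_chain.
Context {R : realType} {d : nat}.
Variables (L U : R) (f : 'rV[R]_d -> R).
Hypotheses (d0 : (0 < d)%N) (L0 : 0 < L) (A1 : assumption_A1 L U f).
Variables (aup adown : R).

(** The product sigma-algebra is carried by tuples, so that the Markov chain is run
    there and read through [rvec]. *)
Definition tuple_move (xsz : (d.-tuple R * R) * d.-tuple R) : d.-tuple R :=
  [tuple tnth xsz.1.1 i + expR xsz.1.2 * tnth xsz.2 i | i < d].

Lemma rvec_tuple_move x s z :
  rvec (tuple_move ((x, s), z)) = rvec x + expR s *: rvec z.
Proof. by apply/rowP => i; rewrite !mxE tnth_mktuple. Qed.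

Lemma measurable_tuple_move : measurable_fun setT tuple_move.
Proof.
apply/measurable_fun_tnthP => i.
apply: (eq_measurable_fun (fun xsz : (d.-tuple R * R) * d.-tuple R =>
    tnth xsz.1.1 i + expR xsz.1.2 * tnth xsz.2 i)).
  by move=> xsz _ /=; rewrite tnth_mktuple.
have mtn := @measurable_tnth _ R d i.
apply: measurable_funD.
  exact: (measurableT_comp mtn (measurableT_comp measurable_fst measurable_fst)).
apply: measurable_funM; last exact: (measurableT_comp mtn measurable_snd).
apply: (measurableT_comp (@measurable_expR R)).
exact: (measurableT_comp measurable_snd measurable_fst).
Qed.

Definition tuple_step (xsz : (d.-tuple R * R) * d.-tuple R) : d.-tuple R * R :=
  if f (rvec (tuple_move xsz)) <= f (rvec xsz.1.1)
  then (tuple_move xsz, xsz.1.2 + ln aup) else (xsz.1.1, xsz.1.2 + ln adown).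

Lemma measurable_f_rvec : measurable_fun setT (fun x : d.-tuple R => f (rvec x)).
Proof. by have [] := A1. Qed.

Lemma measurable_tuple_step : measurable_fun setT tuple_step.
Proof.
have ms : measurable_fun setT
    (fun xsz : (d.-tuple R * R) * d.-tuple R => xsz.1.2).
  exact: (measurableT_comp measurable_snd measurable_fst).
have mx : measurable_fun setT
    (fun xsz : (d.-tuple R * R) * d.-tuple R => xsz.1.1).
  exact: (measurableT_comp measurable_fst measurable_fst).
apply: measurable_fun_ifT.
- apply: measurable_fun_ler.
    exact: (measurableT_comp measurable_f_rvec measurable_tuple_move).
  exact: (measurableT_comp measurable_f_rvec mx).
- apply: measurable_fun_pair; first exact: measurable_tuple_move.
  exact: measurable_funD.
- by apply: measurable_fun_pair => //; exact: measurable_funD.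
Qed.

Definition state_of (xs : d.-tuple R * R) : state R d := (rvec xs.1, xs.2).

Definition tuple_of_state (theta : state R d) : d.-tuple R * R :=
  ([tuple theta.1 ord0 i | i < d], theta.2).

Lemma tuple_of_stateK : cancel tuple_of_state state_of.
Proof.
case=> m s; congr (_, _); apply/rowP => i; by rewrite mxE tnth_mktuple.
Qed.

Lemma state_of_step xs z :
  state_of (tuple_step (xs, z)) = next f aup adown (rvec xs.1) xs.2 z.
Proof.
case: xs => x s; rewrite /tuple_step /next rvec_tuple_move/=.
by case: ifP => _ //; rewrite /state_of/= rvec_tuple_move.
Qed.

Context (dO : measure_display) (Omega : measurableType dO) (P : probability Omega R).
Variables (z : nat -> {RV P >-> d.-tuple R}) (hz : iid_std_gauss z).
Variable theta0 : state R d.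

Local Notation chain := (random_recursion tuple_step (tuple_of_state theta0) z).

Lemma ES_process_chain t w :
  ES_process aup adown f theta0 z t w = state_of (chain t w).
Proof.
elim: t => [|t IHt] /=; first by rewrite tuple_of_stateK.
rewrite state_of_step /ES_process/= -/(ES_process _ _ _ _ _ _ _) IHt.
by rewrite /ES_update /next /state_of/= /sigma_of/=; case: ifP => _ //=; rewrite addr0.
Qed.

(** Moving exactly onto the optimum forces the first coordinate of the noise to
    take one given value.  In this way the indicator of being at the optimum is a
    supermartingale that starts from zero.  The logarithms of the convergence
    rate would not see such an arrival, because of [ln 0 = 0]. *)
Lemma ae_nonzero : theta0.1 != 0 ->
  {ae P, forall w, forall t, (ES_process aup adown f theta0 z t w).1 != 0}.
Proof.
move=> th0; apply: ae_foralln => t.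
pose W (xs : d.-tuple R * R) : \bar R := (if f (rvec xs.1) == 0 then 1 else 0)%:E.
have mfx : measurable_fun setT (fun xs : d.-tuple R * R => f (rvec xs.1)).
  exact: (measurableT_comp measurable_f_rvec measurable_fst).
have mW : measurable_fun setT W.
  apply/measurable_EFinP; apply: measurable_fun_ifT => //.
  exact: measurable_fun_eqr.
have W0 xs : (0 <= W xs)%E by rewrite /W; case: ifP.
have drift xs : (\int[std_gauss R d]_y W (tuple_step (xs, y)) <= 1%:E * W xs)%E.
  have mWx : measurable_fun setT (fun y => W (tuple_step (xs, y))).
    exact: (measurableT_comp mW
      (measurableT_comp measurable_tuple_step (pair1_measurable xs))).
  rewrite mul1e {2}/W; case: ifPn => fx.
    rewrite -[leRHS](_ : (\int[std_gauss R d]_y (cst 1 y) = 1)%E); last first.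
      by rewrite integral_cst//= probability_setT mule1.
    apply: ge0_le_integral => //.
    by move=> y _; rewrite /W; case: ifP.
  pose a : 'rV[R]_d := delta_mx ord0 (Ordinal d0).
  have aE y : dotv a y = y ord0 (Ordinal d0).
    rewrite /dotv (bigD1 (Ordinal d0))//= big1 ?addr0.
      by rewrite !mxE !eqxx mul1r.
    by move=> i ij; rewrite mxE eqxx (negbTE ij) mul0r.
  have a1 : enorm a = 1 by rewrite /enorm aE mxE !eqxx sqrtr1.
  pose H := [set y : d.-tuple R |
    dotv a (rvec y) = - (rvec xs.1 ord0 (Ordinal d0)) / expR xs.2].
  have mH : measurable H.
    rewrite (_ : H = (fun y => dotv a (rvec y)) @^-1`
      [set - (rvec xs.1 ord0 (Ordinal d0)) / expR xs.2])//.
    by rewrite -[X in measurable X]setTI; apply: measurable_dotv_rvec.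
  apply: (@le_trans _ _ (std_gauss R d H)); last by rewrite std_gauss_hyperplane.
  rewrite (_ : std_gauss R d H = (\int[std_gauss R d]_y (\1_H y)%:E)%E); last first.
    by rewrite integral_indic ?setIT.
  apply: ge0_le_integral => //.
    by apply/measurable_EFinP; exact: measurable_indic.
  move=> y _; rewrite /W lee_fin; case: ifPn => // fstep.
  rewrite indicE mem_set//= /H/= aE; move: fstep.
  have -> : rvec (tuple_step (xs, y)).1 = (next f aup adown (rvec xs.1) xs.2 y).1.
    by rewrite -state_of_step.
  rewrite /next; case: ifPn => [_|_]; last by rewrite (negbTE fx).
  rewrite /= (f_eq0 A1) => /eqP/rowP/(_ (Ordinal d0)).
  rewrite !mxE => /eqP; rewrite addrC addr_eq0 => /eqP h.
  apply/(canRL (mulfK _)); first by rewrite gt_eqF// expR_gt0.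
  by rewrite mulrC h.
have := @random_recursion_supermartingale _ _ _ _ _ _ _ P tuple_step
  (tuple_of_state theta0) z measurable_tuple_step hz.1 _ hz.2 W 1 mW W0 ler01 drift t.
have -> : W (tuple_of_state theta0) = 0%E.
  rewrite /W -[rvec _]/(state_of (tuple_of_state theta0)).1 tuple_of_stateK.
  by rewrite (f_eq0 A1) (negbTE th0).
rewrite mule0 => le0.
have mWt : measurable_fun setT (fun w => W (chain t w)).
  exact: (measurableT_comp mW (measurable_random_recursion _ _ measurable_tuple_step t)).
have /(ae_eq_integral_abs P measurableT mWt).1 : (\int[P]_w `|W (chain t w)| = 0)%E.
  apply/eqP; rewrite eq_le; apply/andP; split; last exact: integral_ge0.
  by under eq_integral do rewrite gee0_abs//.
apply: filterS => w /(_ I); rewrite ES_process_chain /W/=.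
by case: ifPn => [_ /eqP|]; [rewrite onee_eq0|rewrite (f_eq0 A1)].
Qed.

(** The exponential of [lam] times the potential decays geometrically in
    expectation, hence almost surely, and the potential is at least [ln (f m)]. *)
Lemma ae_potential_decay v c C r r' : 0 <= v ->
  (forall m s, m != 0 -> drift_certificate f aup adown v c C r m s) ->
  0 < C -> r' < r -> theta0.1 != 0 ->
  {ae P, forall w, exists C' : R, forall t,
    let m := (ES_process aup adown f theta0 z t w).1 in
    m != 0 -> ln (f m) <= C' - r' * t%:R}.
Proof.
move=> v0 cert C0 rr th0.
(* Small enough for [lyapunov_drift] to apply, and for its quadratic error to
   fit into the loss [r - r']. *)
pose lam := Num.min (1 / 2 / C) ((r - r') / (4 * C ^+ 2)).
have lam0 : 0 < lam.
  by rewrite lt_min !divr_gt0//= ?subr_gt0// mulr_gt0// exprn_gt0.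
have lamC : lam * C <= 1 / 2 by rewrite -ler_pdivlMr// ge_min lexx.
have lamr : 2 * (lam * C) ^+ 2 < lam * (r - r').
  have : lam * (4 * C ^+ 2) <= r - r'.
    by rewrite -ler_pdivlMr ?mulr_gt0 ?exprn_gt0// ge_min lexx orbT.
  move=> /(ler_wpM2l (ltW lam0)) h; apply: lt_le_trans h.
  have : 0 < (lam * C) ^+ 2 by rewrite exprn_gt0// mulr_gt0.
  rewrite exprMn; lra.
pose W (xs : d.-tuple R * R) : \bar R := (lyapunov f lam v c (state_of xs))%:E.
have mW : measurable_fun setT W.
  apply/measurable_EFinP; apply: measurable_exp_potential.
    exact: (measurableT_comp measurable_f_rvec measurable_fst).
  exact: measurable_snd.
have W0 xs : (0 <= W xs)%E by rewrite lee_fin lyapunov_ge0.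
have drift xs : (\int[std_gauss R d]_y W (tuple_step (xs, y)) <=
    (expR (- (lam * r - 2 * (lam * C) ^+ 2)))%:E * W xs)%E.
  under eq_integral do rewrite /W state_of_step.
  have [x0|x0] := eqVneq (rvec xs.1) 0.
    rewrite (eq_integral (cst 0%E)).
      by rewrite integral0 mule_ge0// lee_fin expR_ge0.
    move=> y _; rewrite /lyapunov /exp_potential.
    have := next_level f aup adown (rvec xs.1) xs.2 y.
    rewrite {2}x0; have [_ _ _ _ ->] := A1 => le0.
    by rewrite eq_le le0 (f_ge0 A1).
  apply: le_trans (lyapunov_drift A1 x0 (cert _ xs.2 x0) (ltW lam0) lamC) _.
  by rewrite opprB addrC EFinM.
have := @random_recursion_as_decay _ _ _ _ _ _ _ P tuple_step (tuple_of_state theta0) z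
  measurable_tuple_step hz.1 _ hz.2 W _ (lam * r') mW W0 _ _ drift.
have lt1 : lam * r' < lam * r - 2 * (lam * C) ^+ 2 by lra.
move=> /(_ (ltry _) lt1); apply: filterS => w [C' C'P].
exists (ln C' / lam) => t /=; rewrite ES_process_chain => m0.
have fm : f (rvec (chain t w).1) != 0 by rewrite (f_eq0 A1).
have := C'P t; rewrite lee_fin /lyapunov /exp_potential/= (negbTE fm) => le.
have C'0 : 0 < C'.
  by have := lt_le_trans (expR_gt0 _) le; rewrite pmulr_lgt0// expR_gt0.
move: le; rewrite -{1}(lnK C'0) -expRD ler_expR /potential => le.
rewrite -(ler_pM2l lam0) mulrBr mulrCA divff ?gt_eqF// mulr1.
have := mulr_ge0 v0 (normr_ge0 ((chain t w).2 -
  ln (f (rvec (chain t w).1)) / 2 - c)).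
by move=> /(ler_wpM2l (ltW lam0)); rewrite mulr0; lra.
Qed.

End tuple_chain.

(** * From the potential to the convergence rate *)

Lemma limn_esup_le (R : realType) (u : nat -> \bar R) (a : \bar R) (N : nat) :
  (forall t, (N <= t)%N -> (u t <= a)%E) -> (limn_esup u <= a)%E.
Proof.
move=> ua; apply: (@le_trans _ _ (ereal_sup (u @` [set t | (N <= t)%N]))).
  by apply: ereal_inf_lbound; exists [set t | (N <= t)%N] => //; exists N.
by apply: ge_ereal_sup => _ [t /= Nt <-]; exact: ua.
Qed.

Section limsup_rate.
Context {R : realType} {d : nat}.
Variables (L U : R) (f : 'rV[R]_d -> R).
Hypotheses (L0 : 0 < L) (A1 : assumption_A1 L U f).

(** [f] dominates the squared norm, so that a linear decrease of [ln f] is worth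
    half of it for the logarithm of the norm: this is the factor [1 / 2] of
    [B_upper]. *)
Lemma limsup_log_rate_le (theta : nat -> state R d) (C r r' : R) :
  (forall t, (theta t).1 != 0) ->
  (forall t, ln (f (theta t).1) <= C - r * t%:R) -> r' < r ->
  (limsup_log_rate 0 theta <= (- (r' / 2))%:E)%E.
Proof.
move=> m0 decay rr.
have norm0 t : 0 < enorm (theta t).1 by rewrite enorm_gt0.
have lnnorm t : 2 * ln (enorm (theta t).1) <= C - r * t%:R - ln (L / 2).
  have fm : 0 < f (theta t).1 by rewrite (f_gt0 A1).
  rewrite lerBrDr; apply: le_trans (decay t).
  have -> : 2 * ln (enorm (theta t).1) = ln (enorm (theta t).1 ^+ 2).
    by rewrite lnXn// mulr2n; ring.
  rewrite -lnM ?posrE ?exprn_gt0 ?divr_gt0// mulrC ler_ln ?posrE//.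
    exact: (f_quadratic_lb A1).
  by rewrite mulr_gt0 ?exprn_gt0 ?divr_gt0.
pose A := (C - ln (L / 2)) / 2 - ln (enorm (theta 0).1).
pose x := `|2 * A / (r - r')|.
apply: (@limn_esup_le _ _ _ (Num.bound x).+1) => t Nt.
have t0 : 0 < t%:R :> R by rewrite ltr0n; apply: leq_ltn_trans Nt.
rewrite lee_fin !subr0 ln_div ?posrE// mulrC ler_pdivrMr//.
have xt : 2 * A / (r - r') <= t%:R.
  rewrite (le_trans (ler_norm _))// -/x ltW//.
  apply: (lt_trans (archi_boundP (normr_ge0 _))).
  by rewrite ltr_nat.
move: xt; rewrite ler_pdivrMr ?subr_gt0// /A.
have := lnnorm t.
lra.
Qed.

Lemma measurable_enorm_rvec :
  measurable_fun setT (fun x : d.-tuple R => enorm (rvec x)).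
Proof.
apply: (measurableT_comp _ measurable_nrm2).
by apply: continuous_measurable_fun; exact: sqrt_continuous.
Qed.

Context (aup adown : R) (dO : measure_display) (Omega : measurableType dO)
  (P : probability Omega R).
Variables (z : nat -> {RV P >-> d.-tuple R}) (theta0 : state R d).

Lemma measurable_limsup_log_rate : measurable_fun setT (fun w =>
  limsup_log_rate 0 (fun t => ES_process aup adown f theta0 z t w)).
Proof.
apply: measurable_fun_limn_esup => t; apply/measurable_EFinP.
have mn s : measurable_fun setT
    (fun w => enorm ((ES_process aup adown f theta0 z s w).1 - 0)).
  apply: (eq_measurable_fun (fun w => enorm (rvec (random_recursion
      (tuple_step f aup adown) (tuple_of_state theta0) z s w).1))).
    by move=> w _; rewrite ES_process_chain subr0.
  apply: (measurableT_comp measurable_enorm_rvec).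
  apply: (measurableT_comp measurable_fst).
  exact: (measurable_random_recursion _ _ (measurable_tuple_step A1 aup adown)).
apply: measurable_funM => //; apply: measurableT_comp => //.
apply: measurable_funM; first exact: mn.
exact: (measurable_cst ((enorm (theta0.1 - 0))^-1)).
Qed.

End limsup_rate.

Section rate_of_f.
Context {R : realType} {d : nat}.
Variables (L U : R) (f : 'rV[R]_d -> R).
Hypotheses (d0 : (0 < d)%N) (L0 : 0 < L) (hf : S_class L U f).
Variables (aup adown : R).
Hypotheses (aup1 : 1 < aup) (adown01 : 0 < adown < 1).
Local Notation p := (p_target aup adown).
Hypothesis Iqp : I_q f p.
Local Notation B := (B_upper L aup adown f).

Let A1 : assumption_A1 L U f := hf.1.
Let A2 : assumption_A2 f := hf.2.

Definition rates : set R := [set r : R | exists qlow qhigh : R,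
    [/\ I_q f qlow, I_q_high aup adown f qlow qhigh, qlow < p < qhigh
      & r = Num.min (w_rate L f qlow qhigh / 4) (ln (aup / adown)) *
            Num.min (p - qlow) (qhigh - p)]].

(** [p] is strictly larger than the lower end of [I_q], hence there is room for
    [ql] in between, and [I_q_high_nonempty] provides [qh]. *)
Lemma exists_rate : exists2 r, rates r & 0 < r.
Proof.
have [/andP[p0 p2] ] := Iqp; set M := Order.max _ _ => Mp.
have M0 : (0 <= M)%E by rewrite le_max (V_sup_ge0 f d0).
have ME : M = (fine M)%:E by rewrite fineK// ge0_fin_numE// (lt_trans Mp) ?ltry.
have fM0 : 0 <= fine M by rewrite fine_ge0.
move: Mp; rewrite ME lte_fin => fMp.
(* [M] is the lower end of [I_q f]. *)
pose ql := (fine M + p) / 2.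
have Iql : I_q f ql.
  split; first by apply/andP; split; rewrite /ql; lra.
  by rewrite -/M ME lte_fin /ql; lra.
have [qh [Iqh pqh]] := I_q_high_nonempty aup1 adown01 Iql p2.
have qpq : ql < p < qh by rewrite pqh andbT /ql; lra.
eexists; first by exists ql, qh; split.
by have [qh02 _] := Iqh; exact: (rate_gt0 d0 L0 A1 A2 aup1 adown01 Iql qh02 qpq).
Qed.

Lemma rates_has_sup : has_sup rates.
Proof.
split; first by have [r rr _] := exists_rate; exists r.
exists (ln (aup / adown) / 2) => _ [ql [qh [Iql [qh02 _] qpq ->]]].
exact: (rate_le d0 L0 A1 A2).
Qed.

Lemma B_upper_gt0 : 0 < B.
Proof.
rewrite /B_upper mulr_gt0//; have [r rr r0] := exists_rate.
apply: (lt_le_trans r0); apply: sup_ubound => //.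
by have [] := rates_has_sup.
Qed.

Context (dO : measure_display) (Omega : measurableType dO) (P : probability Omega R).
Variables (z : nat -> {RV P >-> d.-tuple R}) (hz : iid_std_gauss z).
Variable theta0 : state R d.
Hypothesis th0 : theta0.1 != 0.

(** Countably many rates approach the supremum, and the almost sure events
    attached to them have an almost sure intersection. *)
Lemma ae_limsup_log_rate : {ae P, forall w,
  (limsup_log_rate 0 (fun t => ES_process aup adown f theta0 z t w) <= (- B)%:E)%E}.
Proof.
pose rn (n : nat) : R := sup rates - n.+1%:R^-1.
have decay : {ae P, forall w, forall n, exists C' : R, forall t,
    let m := (ES_process aup adown f theta0 z t w).1 in
    m != 0 -> ln (f m) <= C' - rn n * t%:R}.
  apply: ae_foralln => n.
  have n0 : 0 < n.+1%:R^-1 :> R by rewrite invr_gt0.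
  have [_ [ql [qh [Iql Iqh qpq ->]]] rr] := sup_adherent n0 rates_has_sup.
  have [qh02 _] := Iqh.
  have ell0 := B_high_inf_gt0 d0 A2 qh02.
  have Q0 := Q_inf_gt0 d0 L0 A1 A2 Iql.
  have w0 := w_rate_gt0 d0 L0 A1 A2 Iql qh02.
  have Lam0 := Lam_gt0 aup1 adown01.
  apply: (@ae_potential_decay _ _ _ _ _ A1 _ _ _ _ _ _ hz theta0
    (penalty_slope L f aup adown ql qh) (kink L f aup qh) (1 + 2 * ln (aup / adown))
    (rate L f aup adown ql qh)) => //.
  - by rewrite divr_ge0 ?(ltW Lam0)// le_min (ltW Lam0) divr_ge0 ?(ltW w0).
  - move=> m s m0.
    exact: (drift_everywhere d0 L0 A1 aup1 adown01 Iql Iqh qpq ell0 (ltW Q0) s m0).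
  - by rewrite addr_gt0// mulr_gt0.
apply: filterS2 (ae_nonzero d0 A1 aup adown hz th0) decay => w m0 wdecay.
apply/lee_addgt0Pr => e e0.
have [n ne] : exists n, n.+1%:R^-1 < 2 * e.
  have e2 : 0 <= (2 * e)^-1 by rewrite invr_ge0 mulr_ge0// ltW.
  exists (Num.bound (2 * e)^-1).
  rewrite -[ltRHS]invrK ltf_pV2 ?posrE ?invr_gt0 ?mulr_gt0//.
  by apply: (lt_trans (archi_boundP e2)); rewrite ltr_nat.
have [C' C'P] := wdecay n.
have lt_rn : sup rates - 2 * e < rn n by rewrite /rn ltrD2l ltrN2.
apply: le_trans (limsup_log_rate_le L0 A1 m0 (fun t => C'P t (m0 t)) lt_rn) _.
rewrite -EFinD lee_fin /B_upper -/rates; lra.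
Qed.

End rate_of_f.

(** * Reduction to a translate of f *)

Section reduction.
Context {R : realType} {d : nat}.
Variables (gamma : R) (f h : 'rV[R]_d -> R) (x : 'rV[R]_d) (g : R -> R).
Hypotheses (g_mono : {homo g : a b / a < b})
  (hg : forall y, (h y <= gamma -> h y = g (f (y - x))) /\
                  (gamma < h y -> gamma < g (f (y - x)))).
Variables (aup adown : R) (theta0 : state R d) (zeta : nat -> 'rV[R]_d).
Hypothesis h0 : h theta0.1 <= gamma.

Let acceptE m y : h m <= gamma -> (h y <= h m) = (f (y - x) <= f (m - x)).
Proof.
move=> hm; have gle a b : (g a <= g b) = (a <= b).
  apply/idP/idP; last by rewrite le_eqVlt => /predU1P[->//|/g_mono/ltW].
  by apply: contraTT; rewrite -!ltNge; exact: g_mono.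
have [/(_ hm) hmE _] := hg m; have [hyE hyG] := hg y.
have [hy|hy] := leP (h y) gamma; first by rewrite hmE (hyE hy) gle.
rewrite -(gle (f (y - x))) -hmE; apply/idP/idP => le.
  by have := lt_le_trans hy (le_trans le hm); rewrite ltxx.
by have := lt_le_trans (hyG hy) (le_trans le hm); rewrite ltxx.
Qed.

(** The search with [h] never leaves its sublevel set, and there [h] and [f],
    shifted by [x], accept the same moves: [g] is strictly increasing, and a point
    outside of the sublevel set is rejected by both. *)
Lemma ES_translate t : let theta := ES aup adown h theta0 zeta t in
  h theta.1 <= gamma /\
  ES aup adown f (theta0.1 - x, theta0.2) zeta t = (theta.1 - x, theta.2).
Proof.
elim: t => [//|t [IHh IHf]] /=.
set th := ES _ _ h _ _ t in IHh IHf *; rewrite IHf /ES_update /sigma_of/=.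
have E : th.1 - x + expR th.2 *: zeta t = th.1 + expR th.2 *: zeta t - x.
  by rewrite addrAC.
rewrite E -acceptE//; case: ifPn => acc /=; last by rewrite !addr0.
by rewrite E; split=> //; exact: le_trans IHh.
Qed.

End reduction.

(** * The upper convergence rate *)

Lemma ae_probability1 dO (Omega : measurableType dO) (R : realType)
    (P : probability Omega R) (E : set Omega) :
  measurable E -> {ae P, forall w, E w} -> P E = 1%E.
Proof.
move=> mE aeE; have mCE := measurableC mE.
have : P (~` E) = 0%E by apply: measure_negligible.
rewrite probability_setC// => /eqP; rewrite sube_eq ?fin_num_measure//.
by rewrite add0e => /eqP <-.
Qed.

Theorem theorem14 (R : realType) (d : nat) (L U gamma aup adown : R)
    (hd : (3 < d)%N) (hL : 0 < L) (hLU : L <= U)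
    (haup : 1 < aup) (hadown : 0 < adown < 1)
    (f : 'rV[R]_d -> R) (hf : S_class L U f)
    (h : 'rV[R]_d -> R) (hh : T_class gamma f h) (mh : borel_fun h)
    (xopt : 'rV[R]_d) (hxopt : unique_global_min h xopt)
    (dO : measure_display) (Omega : measurableType dO) (P : probability Omega R)
    (z : nat -> {RV P >-> d.-tuple R}) (hz : iid_std_gauss z)
    (theta0 : state R d) (hm0 : theta0.1 != xopt) (hgamma : h theta0.1 <= gamma)
    (hp : I_q f (p_target aup adown)) :
  let theta := ES_process aup adown h theta0 z in
  let B := B_upper L aup adown f in
  [/\ 0 < B,
      P [set w | (limsup_log_rate xopt (fun t => theta t w) <= (- B)%:E)%E]
        = 1%E
    & forall CR : R, is_CR_upper P xopt theta CR -> expR (- CR) <= expR (- B)].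
Proof.
move=> theta B.
have d0 : (0 < d)%N by apply: leq_trans hd.
have [x [hx [g [g_mono hg]]]] := hh.
(* Two unique global minima of [h] coincide. *)
have xE : x = xopt.
  apply/eqP/negP => /negP xx.
  have := lt_trans (hxopt _ xx) (hx xopt _).
  by rewrite ltxx eq_sym => /(_ xx).
rewrite {x}xE in hx hg.
pose theta0' : state R d := (theta0.1 - xopt, theta0.2).
have th0' : theta0'.1 != 0 by rewrite subr_eq0.
pose limsup_f w := limsup_log_rate 0 (fun t => ES_process aup adown f theta0' z t w).
have limsupE w : limsup_log_rate xopt (fun t => theta t w) = limsup_f w.
  rewrite /limsup_f /limsup_log_rate; congr limn_esup; apply/funext => t.
  have tr s : (theta s w).1 - xopt = (ES_process aup adown f theta0' z s w).1 - 0.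
    have [_ E] := ES_translate g_mono hg aup adown
      (fun s => rvec (z s w)) hgamma s.
    by rewrite subr0 /ES_process E.
  by rewrite !tr.
have mlimsup : measurable_fun setT limsup_f.
  exact: (measurable_limsup_log_rate hf.1).
have mB : measurable [set w | (limsup_f w <= (- B)%:E)%E].
  rewrite (_ : mkset _ = limsup_f @^-1` `]-oo, (- B)%:E]%classic).
    rewrite -[X in measurable X]setTI; apply: mlimsup => //.
    exact: emeasurable_itv.
  by apply/seteqP; split=> w /=; rewrite in_itv.
have PB : P [set w | (limsup_f w <= (- B)%:E)%E] = 1%E.
  apply: ae_probability1 => //.
  exact: (ae_limsup_log_rate d0 hL hf haup hadown hp hz th0').
split.
- exact: (B_upper_gt0 d0 hL hf haup hadown hp).
- by under eq_set do rewrite limsupE.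
move=> CR; rewrite /is_CR_upper => PCR; rewrite ler_expR lerN2 leNgt.
(* Otherwise the event that defines [CR] would have probability one and avoid
   the event of [PB], which has probability one too. *)
apply/negP => CRB.
have mCR : measurable [set w | limsup_f w = (- CR)%:E].
  rewrite (_ : mkset _ = limsup_f @^-1` [set (- CR)%:E])//.
  rewrite -[X in measurable X]setTI; apply: mlimsup => //.
move: PCR; under eq_set do rewrite limsupE; move=> PCR.
have : (1 <= P (~` [set w | (limsup_f w <= (- B)%:E)%E]))%E.
  rewrite -PCR; apply: le_measure; rewrite ?inE//; first exact: measurableC.
  by move=> w /= ->; rewrite lee_fin lerN2 leNgt CRB.
by rewrite probability_setC// PB subee// lee_fin ler10.
Qed.
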